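(* Let $\dot{L}$ be a Lévy white noise on $\mathbb{R}^d$ with characteristic triplet $(a,\gamma,\nu)$ and let $G:\mathbb{R}^d\to\mathbb{R}$ be a measurable function with $G\in L^1(\mathbb{R}^d)$. For $R>0$ and $x\in\mathbb{R}^d$ define $$G_R(x):=\int_{B_R(x)}|G(y)|\,\lambda^d(dy),\qquad h_R(x):=x\int_0^{1/x} d_{G_R}(\alpha)\,\lambda^1(d\alpha)\quad (x>0).$$ Assume that for every $R>0$, $$\int_{\mathbb{R}}\mathbf{1}_{|r|>1}\,h_R(|r|)\,\nu(dr)<\infty .$$ Then $s(\varphi):=\langle \dot{L}, G\ast\varphi\rangle$, $\varphi\in\mathcal{D}(\mathbb{R}^d)$, is well defined and defines a stationary generalized random process.
   Context: $(\Omega,\mathcal{F},\mathcal{P})$ is a probability space and $L^0(\Omega)$ denotes the real random variables, with convergence meaning convergence in probability. $\mathcal{D}(\mathbb{R}^d)$ is the space of infinitely differentiable compactly supported functions $\mathbb{R}^d\to\mathbb{R}$, with $\varphi_n\to\varphi$ meaning that all supports lie in a common compact set and $\sup_x|D^\alpha(\varphi_n-\varphi)(x)|\to0$ for every multi-index $\alpha$. A generalized random process is a map $s:\mathcal{D}(\mathbb{R}^d)\to L^0(\Omega)$ that is linear (almost surely) and continuous ($\varphi_n\to\varphi$ in $\mathcal{D}$ implies $s(\varphi_n)\to s(\varphi)$ in probability). A Lévy white noise with characteristic triplet $(a,\gamma,\nu)$ ($a\ge0$, $\gamma\in\mathbb{R}$, $\nu$ a measure on $\mathbb{R}$ with $\nu(\{0\})=0$,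 $\int\min(1,x^2)\nu(dx)<\infty$) is a generalized random process $\dot L$ with $\mathbb{E}\exp(i\langle\dot L,\varphi\rangle)=\exp\big(\int_{\mathbb{R}^d}\psi(\varphi(x))\lambda^d(dx)\big)$, where $\psi(z)=i\gamma z-\tfrac12 az^2+\int_{\mathbb{R}}(e^{ixz}-1-ixz\mathbf{1}_{|x|\le1})\nu(dx)$. $\dot L$ extends to a Lévy basis $L(A)=\langle\dot L,\mathbf{1}_A\rangle$ ($A$ bounded Borel), and for a measurable $f$ one sets $\langle\dot L,f\rangle:=\int f\,dL$ whenever $f$ is integrable with respect to $L$ in the sense of Rajput and Rosiński (the domain of $\dot L$ is the set of such $f$). A generalized process $s$ is stationary if for every $t\in\mathbb{R}^d$ the process $\varphi\mapsto\langle s,\varphi(\cdot-t)\rangle$ has the same law as $s$. For measurable $f$, $d_f(\alpha):=\lambda^d(\{x:|f(x)|>\alpha\})$ is its distribution function; $\lambda^d$ is Lebesgue measure and $B_R(x)$ is the open Euclidean ball of radius $R$ around $x$. *)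

(* Defs.v *)
From HB Require Import structures.
From mathcomp Require Import all_boot all_order all_algebra.
From mathcomp Require Import all_classical all_reals all_analysis.
Import Order.TTheory GRing.Theory Num.Theory.
Import numFieldTopology.Exports numFieldNormedType.Exports.

Set Implicit Arguments.
Unset Strict Implicit.
Unset Printing Implicit Defensive.

Local Open Scope ring_scope.
Local Open Scope classical_set_scope.

(* The space R^d is 'rV[R]_d (normed module: topology, derivatives).        *)
(* Borel sets / Lebesgue integrals are transported from d.-tuple R, which   *)
(* carries the product (= Borel) sigma-algebra in mathcomp-analysis.        *)

Definition rv_of_tuple {R : realType} {d : nat} (t : d.-tuple R) : 'rV[R]_d :=
  \row_i tnth t i.

(* iterated Lebesgue integral over R^n (= integral w.r.t. lambda^n for
   nonnegative measurable integrands, by Tonelli) *)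
Fixpoint iint {R : realType} (n : nat) : (n.-tuple R -> \bar R) -> \bar R :=
  match n return (n.-tuple R -> \bar R) -> \bar R with
  | 0 => fun f => f [tuple]
  | n'.+1 => fun f =>
      (\int[@lebesgue_measure R]_x iint (fun t => f (cons_tuple (x : R) t)))%E
  end.

Definition leb_int {R : realType} {d : nat} (f : 'rV[R]_d -> \bar R) : \bar R :=
  iint (fun t : d.-tuple R => f (rv_of_tuple t)).

Definition lebd {R : realType} {d : nat} (A : set 'rV[R]_d) : \bar R :=
  leb_int (fun x => (\1_A x)%:E).

Definition leb_intR {R : realType} {d : nat} (f : 'rV[R]_d -> R) : R :=
  fine (leb_int (fun x => (Num.max (f x) 0)%:E)
        - leb_int (fun x => (Num.max (- f x) 0)%:E))%E.

Definition borel_set {R : realType} {d : nat} (A : set 'rV[R]_d) : Prop :=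
  measurable (rv_of_tuple @^-1` A).

Definition borel_fun {R : realType} {d : nat} (f : 'rV[R]_d -> R) : Prop :=
  measurable_fun [set: d.-tuple R] (f \o rv_of_tuple).

Definition bdd_set {R : realType} {d : nat} (A : set 'rV[R]_d) : Prop :=
  exists M : R, forall x, A x -> `|x| <= M.

Definition bdd_borel {R : realType} {d : nat} (A : set 'rV[R]_d) : Prop :=
  borel_set A /\ bdd_set A.

Definition leb_null {R : realType} {d : nat} (A : set 'rV[R]_d) : Prop :=
  exists N, borel_set N /\ lebd N = 0%E /\ A `<=` N.

Definition L1 {R : realType} {d : nat} (f : 'rV[R]_d -> R) : Prop :=
  borel_fun f /\ (leb_int (fun x => (`|f x|)%:E) < +oo)%E.

Definition eball {R : realType} {d : nat} (x : 'rV[R]_d) (r : R) : set 'rV[R]_d :=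
  [set y | Num.sqrt (\sum_(i < d) (y 0 i - x 0 i) ^+ 2) < r].

Definition G_R {R : realType} {d : nat} (G : 'rV[R]_d -> R) (rad : R)
  (x : 'rV[R]_d) : R :=
  leb_intR (fun y => \1_(eball x rad) y * `|G y|).

Definition distrib {R : realType} {d : nat} (f : 'rV[R]_d -> R) (al : R) : \bar R :=
  lebd [set x | al < `|f x|].

Definition h_R {R : realType} {d : nat} (G : 'rV[R]_d -> R) (rad : R) (x : R)
  : \bar R :=
  (x%:E * \int[@lebesgue_measure R]_(al in [set al : R | (0 < al < x^-1)%R])
             distrib (G_R G rad) al)%E.

Definition convol {R : realType} {d : nat} (G phi : 'rV[R]_d -> R) (x : 'rV[R]_d) : R :=
  leb_intR (fun y => G y * phi (x - y)).

Definition translate {R : realType} {d : nat} (phi : 'rV[R]_d -> R) (t : 'rV[R]_d)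
  : 'rV[R]_d -> R := fun x => phi (x - t).

(* iterated partial derivatives: Dpart [:: i1; ...; ik] f = d_i1 ... d_ik f;
   every multi-index alpha is represented by such a list *)
Fixpoint Dpart {R : realType} {d : nat} (l : seq 'I_d) (f : 'rV[R]_d -> R)
  : 'rV[R]_d -> R :=
  match l with
  | [::] => f
  | i :: l' => 'D_('e_i) (Dpart l' f)
  end.

Definition smooth {R : realType} {d : nat} (f : 'rV[R]_d -> R) : Prop :=
  forall l : seq 'I_d, continuous (Dpart l f) /\
    forall (i : 'I_d) (x : 'rV[R]_d), derivable (Dpart l f) x 'e_i.

Definition test_fn {R : realType} {d : nat} (f : 'rV[R]_d -> R) : Prop :=
  smooth f /\ exists K : set 'rV[R]_d, compact K /\ forall x, ~ K x -> f x = 0.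

Definition cvg_D {R : realType} {d : nat} (phin : nat -> 'rV[R]_d -> R)
  (phi : 'rV[R]_d -> R) : Prop :=
  (exists K : set 'rV[R]_d, compact K /\
     forall x, ~ K x -> phi x = 0 /\ forall n, phin n x = 0) /\
  forall (l : seq 'I_d) (e : R), 0 < e ->
    \forall n \near \oo, forall x,
      `|Dpart l (fun y => phin n y - phi y) x| <= e.

Definition cvg_prob {R : realType} {dO : measure_display} {Omega : measurableType dO}
  (P : probability Omega R) (Xn : nat -> Omega -> R) (X : Omega -> R) : Prop :=
  forall e : R, 0 < e ->
    (fun n => P [set w | e < `|Xn n w - X w|]) @ \oo --> 0%E.

Definition gen_process {R : realType} {d : nat} {dO : measure_display}
  {Omega : measurableType dO} (P : probability Omega R)
  (s : ('rV[R]_d -> R) -> Omega -> R) : Prop :=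
  (forall phi, test_fn phi -> measurable_fun [set: Omega] (s phi)) /\
  (forall phi psi (a b : R), test_fn phi -> test_fn psi ->
     {ae P, forall w, s (fun x => a * phi x + b * psi x) w
                      = a * s phi w + b * s psi w}) /\
  (forall (phin : nat -> 'rV[R]_d -> R) phi,
     (forall n, test_fn (phin n)) -> test_fn phi -> cvg_D phin phi ->
     cvg_prob P (fun n => s (phin n)) (s phi)).

Definition same_law {R : realType} {d : nat} {dO : measure_display}
  {Omega : measurableType dO} (P : probability Omega R)
  (s1 s2 : ('rV[R]_d -> R) -> Omega -> R) : Prop :=
  forall (n : nat) (phi : 'I_n -> 'rV[R]_d -> R) (B : 'I_n -> set R),
    (forall i, test_fn (phi i)) -> (forall i, measurable (B i)) ->
    P (\bigcap_(i in [set: 'I_n]) [set w | B i (s1 (phi i) w)])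
    = P (\bigcap_(i in [set: 'I_n]) [set w | B i (s2 (phi i) w)]).

Definition stationary {R : realType} {d : nat} {dO : measure_display}
  {Omega : measurableType dO} (P : probability Omega R)
  (s : ('rV[R]_d -> R) -> Omega -> R) : Prop :=
  forall t : 'rV[R]_d, same_law P (fun phi => s (translate phi t)) s.

Definition independent {R : realType} {dO : measure_display}
  {Omega : measurableType dO} (P : probability Omega R) (n : nat)
  (X : 'I_n -> Omega -> R) : Prop :=
  forall B : 'I_n -> set R, (forall i, measurable (B i)) ->
    P (\bigcap_(i in [set: 'I_n]) (X i @^-1` B i))
    = (\prod_(i < n) P (X i @^-1` B i))%E.

Definition levy_triplet {R : realType} (a : R) (nu : {measure set R -> \bar R})
  : Prop :=
  0 <= a /\ nu [set 0] = 0%E /\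
  (\int[nu]_x (Num.min 1 ((x : R) ^+ 2))%:E < +oo)%E.

Definition psiRe {R : realType} (a : R) (nu : {measure set R -> \bar R}) (z : R) : R :=
  - (a * z ^+ 2) / 2 + fine (\int[nu]_x (cos ((x : R) * z) - 1)%:E)%E.

Definition psiIm_integrand {R : realType} (z x : R) : R :=
  sin (x * z) - x * z * (if `|x| <= 1 then 1 else 0).

Definition psiIm {R : realType} (gamma : R) (nu : {measure set R -> \bar R}) (z : R)
  : R :=
  gamma * z + fine (\int[nu]_x (psiIm_integrand z x)%:E)%E.

(* Levy white noise with triplet (a, gamma, nu):
   E exp(i <L, phi>) = exp(int psi(phi(x)) dx), written in real and imaginary
   parts *)
Definition levy_white_noise {R : realType} {d : nat} {dO : measure_display}
  {Omega : measurableType dO} (P : probability Omega R) (a gamma : R)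
  (nu : {measure set R -> \bar R}) (Ld : ('rV[R]_d -> R) -> Omega -> R) : Prop :=
  gen_process P Ld /\
  forall phi, test_fn phi ->
    let I1 := leb_intR (fun x => psiRe a nu (phi x)) in
    let I2 := leb_intR (fun x => psiIm gamma nu (phi x)) in
    (\int[P]_w (cos (Ld phi w))%:E = (expR I1 * cos I2)%:E)%E /\
    (\int[P]_w (sin (Ld phi w))%:E = (expR I1 * sin I2)%:E)%E.

Definition simple_ok {R : realType} {d : nat} (s : seq (R * set 'rV[R]_d)) : Prop :=
  (forall k, (k < size s)%N -> bdd_borel (nth (0, set0) s k).2) /\
  (forall k l, (k < l < size s)%N ->
     (nth (0, set0) s k).2 `&` (nth (0, set0) s l).2 = set0).

Definition simple_eval {R : realType} {d : nat} (s : seq (R * set 'rV[R]_d))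
  (x : 'rV[R]_d) : R :=
  \sum_(p <- s) p.1 * \1_(p.2) x.

Definition simple_int {R : realType} {d : nat} {Omega : Type}
  (L : set 'rV[R]_d -> Omega -> R) (s : seq (R * set 'rV[R]_d))
  (A : set 'rV[R]_d) (w : Omega) : R :=
  \sum_(p <- s) p.1 * L (A `&` p.2) w.

Definition RR_approx {R : realType} {d : nat} {dO : measure_display}
  {Omega : measurableType dO} (P : probability Omega R)
  (L : set 'rV[R]_d -> Omega -> R) (f : 'rV[R]_d -> R)
  (fs : nat -> seq (R * set 'rV[R]_d)) : Prop :=
  (forall k, simple_ok (fs k)) /\
  leb_null [set x | ~ ((fun k => simple_eval (fs k) x) @ \oo --> f x)] /\
  (forall A, borel_set A ->
     exists Y : Omega -> R, measurable_fun [set: Omega] Y /\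
       cvg_prob P (fun k => simple_int L (fs k) A) Y).

Definition RR_integrable {R : realType} {d : nat} {dO : measure_display}
  {Omega : measurableType dO} (P : probability Omega R)
  (L : set 'rV[R]_d -> Omega -> R) (f : 'rV[R]_d -> R) : Prop :=
  borel_fun f /\ exists fs, RR_approx P L f fs.

Definition RR_integral {R : realType} {d : nat} {dO : measure_display}
  {Omega : measurableType dO} (P : probability Omega R)
  (L : set 'rV[R]_d -> Omega -> R) (f : 'rV[R]_d -> R) (X : Omega -> R) : Prop :=
  borel_fun f /\ measurable_fun [set: Omega] X /\
  exists fs, RR_approx P L f fs /\
    cvg_prob P (fun k => simple_int L (fs k) [set: 'rV[R]_d]) X.

(* L is the Levy basis extending the Levy white noise Ld:
   an independently scattered, sigma-additive infinitely divisible random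
   measure on bounded Borel sets with E exp(iuL(A)) = exp(lambda(A) psi(u)),
   whose Rajput-Rosinski integral agrees with Ld on test functions *)
Definition levy_basis_of {R : realType} {d : nat} {dO : measure_display}
  {Omega : measurableType dO} (P : probability Omega R) (a gamma : R)
  (nu : {measure set R -> \bar R}) (Ld : ('rV[R]_d -> R) -> Omega -> R)
  (L : set 'rV[R]_d -> Omega -> R) : Prop :=
  (forall A, bdd_borel A -> measurable_fun [set: Omega] (L A)) /\
  (forall (n : nat) (A : 'I_n -> set 'rV[R]_d), (forall i, bdd_borel (A i)) ->
     (forall i j, i != j -> A i `&` A j = set0) ->
     independent P (fun i => L (A i))) /\
  (forall A : nat -> set 'rV[R]_d, (forall k, bdd_borel (A k)) ->
     trivIset [set: nat] A -> bdd_borel (\bigcup_k A k) ->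
     {ae P, forall w, (fun N => \sum_(k < N) L (A k) w) @ \oo
                        --> L (\bigcup_k A k) w}) /\
  (forall A, bdd_borel A -> forall u : R,
     (\int[P]_w (cos (u * L A w))%:E
        = (expR (fine (lebd A) * psiRe a nu u) * cos (fine (lebd A) * psiIm gamma nu u))%:E)%E /\
     (\int[P]_w (sin (u * L A w))%:E
        = (expR (fine (lebd A) * psiRe a nu u) * sin (fine (lebd A) * psiIm gamma nu u))%:E)%E) /\
  (forall phi, test_fn phi -> RR_integral P L phi (Ld phi)).

(* Main.v *)
(* With K(z) = |z| + z^2 + int_{|r|>1} min(1, |r z|) nu(dr), the exponent
   satisfies |psi| <= C K, and |G * phi| <= sup |phi| * G_R as soon as phi is
   supported in the ball of radius R. Since G_R is bounded and integrable, and
   since int min(1, |r| G_R) = h_R(|r|) by the layer cake formula, the hypothesis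
   yields that int K(c G_R) is finite for all c.

   For a simple function f, E exp(i u L(f)) = exp(int psi(u f)), so that L(f) is
   small in probability when int K(U f) is small for a large U. By dominated
   convergence the simple functions approximating G * phi from below in absolute
   value have Cauchy integrals, which gives existence; the same estimate applied
   to |G * (phi_n - phi)| <= eps G_R gives continuity. Linearity requires the
   integral not to depend on the approximating sequence, which is only assumed to
   converge almost everywhere together with its integrals over every Borel set:
   this is a gliding hump argument.

   Finally L(f) and L(f(. - t)) have the same characteristic function because
   Lebesgue measure is translation invariant. This passes to the limit, also for
   linear combinations, and joint characteristic functions determine joint laws. *)

Require Import Defs.
From HB Require Import structures.
From mathcomp Require Import all_boot all_order all_algebra.
From mathcomp Require Import all_classical all_reals all_analysis.
From mathcomp Require Import measurable_realfun ring lra.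
Import Order.TTheory GRing.Theory Num.Theory.
Import numFieldTopology.Exports numFieldNormedType.Exports.
Local Open Scope ring_scope.
Local Open Scope classical_set_scope.
Set Implicit Arguments.
Unset Strict Implicit.
Unset Printing Implicit Defensive.

(** * Expectations of bounded random variables *)

(** Independence and equality of laws are phrased with events, whereas what is known about [L] is a
    characteristic function. The bridge is the Poisson kernel: it is a mixture of cosines, and its
    primitive [atan] approximates half-lines. All comparisons of expectations carry arbitrary
    bounded weights, so that coordinates can be treated one at a time; this gives both the product
    formula for independent variables and the uniqueness of joint laws. The kernel of width 1 also
    gives the quantitative continuity estimate at frequency 0.

    [L] is additive only almost surely, and many lists of weighted sets represent one simple
    function. Lists may therefore overlap, and their integrals are compared through E min(1, |X|),
    which metrizes convergence in probability. Existence, uniqueness and continuity then rest on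
    measurability of [L] and on one estimate, called [q_small]: integrals of simple functions with
    small modular are small. Its dilation [U] depends on the precision, which is why the modular has
    to be finite for every multiple of a function. *)

Section BoundedExpectation.
Context {R : realType} {dO : measure_display} {Omega : measurableType dO}.
Variable P : probability Omega R.
Implicit Types (f g W V X Y : Omega -> R).

Definition bdd_meas f : Prop :=
  measurable_fun [set: Omega] f /\ exists M : R, forall w, `|f w| <= M.

Definition Ex f : R := \int[P]_w f w.

Lemma bdd_meas_integrable f : bdd_meas f -> P.-integrable setT (EFin \o f).
Proof.
move=> [mf [M fM]]; apply: measurable_bounded_integrable => //.
  by rewrite (le_lt_trans (probability_le1 P measurableT))// ltry.
exists M; split; first exact: num_real.
by move=> x Mx w _ /=; apply: le_trans (fM w) _; exact: ltW.
Qed.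

Lemma bdd_meas_cst (c : R) : bdd_meas (fun _ => c).
Proof. by split; [exact: measurable_cst | exists `|c|]. Qed.

Lemma bdd_measD f g : bdd_meas f -> bdd_meas g -> bdd_meas (fun w => f w + g w).
Proof.
move=> [mf [M fM]] [mg [N gN]]; split; first exact: measurable_funD.
by exists (M + N) => w; rewrite (le_trans (ler_normD _ _))// lerD.
Qed.

Lemma bdd_measM f g : bdd_meas f -> bdd_meas g -> bdd_meas (fun w => f w * g w).
Proof.
move=> [mf [M fM]] [mg [N gN]]; split; first exact: measurable_funM.
by exists (M * N) => w; rewrite normrM ler_pM.
Qed.

Lemma bdd_measZ (c : R) f : bdd_meas f -> bdd_meas (fun w => c * f w).
Proof. by move=> hf; apply: bdd_measM => //; exact: bdd_meas_cst. Qed.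

Lemma bdd_measN f : bdd_meas f -> bdd_meas (fun w => - f w).
Proof.
move=> [mf [M fM]]; split; first exact: measurableT_comp.
by exists M => w; rewrite normrN.
Qed.

Lemma bdd_measB f g : bdd_meas f -> bdd_meas g -> bdd_meas (fun w => f w - g w).
Proof. by move=> hf hg; apply: bdd_measD => //; exact: bdd_measN. Qed.

Lemma bdd_meas_norm f : bdd_meas f -> bdd_meas (fun w => `|f w|).
Proof.
move=> [mf [M fM]]; split; first exact: measurableT_comp.
by exists M => w; rewrite normr_id.
Qed.

Lemma bdd_meas_comp (g : R -> R) X : measurable_fun setT X ->
  measurable_fun setT g -> (exists M : R, forall x, `|g x| <= M) ->
  bdd_meas (fun w => g (X w)).
Proof.
move=> mX mg [M gM]; split; first exact: (measurableT_comp mg mX).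
by exists M => w; exact: gM.
Qed.

Lemma bdd_meas_cos X : measurable_fun setT X -> bdd_meas (fun w => cos (X w)).
Proof.
move=> mX; apply: (@bdd_meas_comp cos) => //.
  by apply: continuous_measurable_fun; exact: continuous_cos.
by exists 1 => x; rewrite ler_norml cos_geN1 cos_le1.
Qed.

Lemma bdd_meas_sin X : measurable_fun setT X -> bdd_meas (fun w => sin (X w)).
Proof.
move=> mX; apply: (@bdd_meas_comp sin) => //.
  by apply: continuous_measurable_fun; exact: continuous_sin.
by exists 1 => x; rewrite ler_norml sin_geN1 sin_le1.
Qed.

Lemma bdd_meas_indic (A : set Omega) : measurable A -> bdd_meas (\1_A).
Proof.
move=> mA; split; first exact: measurable_indic.
by exists 1 => w; rewrite indicE; case: (_ \in _); rewrite ?normr0 ?normr1.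
Qed.

Lemma bdd_meas_indic_comp (C : set R) X : measurable C -> measurable_fun setT X ->
  bdd_meas (fun w => \1_C (X w)).
Proof.
move=> mC mX; apply: (@bdd_meas_comp (\1_C)) => //.
by exists 1 => w; rewrite indicE; case: (_ \in _); rewrite ?normr0 ?normr1.
Qed.

Lemma ExD f g : bdd_meas f -> bdd_meas g ->
  Ex (fun w => f w + g w) = Ex f + Ex g.
Proof. by move=> /bdd_meas_integrable ? /bdd_meas_integrable ?; exact: RintegralD. Qed.

Lemma ExB f g : bdd_meas f -> bdd_meas g ->
  Ex (fun w => f w - g w) = Ex f - Ex g.
Proof. by move=> /bdd_meas_integrable ? /bdd_meas_integrable ?; exact: RintegralB. Qed.

Lemma ExZ (c : R) f : bdd_meas f -> Ex (fun w => c * f w) = c * Ex f.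
Proof. by move=> /bdd_meas_integrable ?; exact: RintegralZl. Qed.

Lemma Ex_cst (c : R) : Ex (fun _ => c) = c.
Proof. by rewrite /Ex Rintegral_cst//= [X in fine X](@probability_setT _ _ _ P) mulr1. Qed.

Lemma Ex_ge0 f : (forall w, 0 <= f w) -> 0 <= Ex f.
Proof. by move=> f0; apply: Rintegral_ge0. Qed.

Lemma le_Ex f g : bdd_meas f -> bdd_meas g -> (forall w, f w <= g w) ->
  Ex f <= Ex g.
Proof. by move=> /bdd_meas_integrable ? /bdd_meas_integrable ? fg; exact: le_Rintegral. Qed.

Lemma normr_Ex f : bdd_meas f -> `|Ex f| <= Ex (fun w => `|f w|).
Proof. by move=> /bdd_meas_integrable ?; exact: le_normr_Rintegral. Qed.

Lemma normr_Ex_le f (M : R) : bdd_meas f -> (forall w, `|f w| <= M) -> `|Ex f| <= M.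
Proof.
move=> hf fM; rewrite (le_trans (normr_Ex hf))// -[leRHS](Ex_cst M).
by apply: le_Ex => //; [exact: bdd_meas_norm | exact: bdd_meas_cst].
Qed.

Lemma Ex_indic (A : set Omega) : measurable A -> (Ex (\1_A))%:E = P A.
Proof.
move=> mA; rewrite /Ex /Rintegral integral_indic// setIT fineK//.
by rewrite fin_num_measure.
Qed.

Lemma EFin_Ex f : bdd_meas f -> (Ex f)%:E = (\int[P]_w (f w)%:E)%E.
Proof.
move=> /bdd_meas_integrable hf; rewrite /Ex /Rintegral fineK//.
exact: integrable_fin_num.
Qed.

Lemma cvg_Ex (F : nat -> Omega -> R) f (M : R) :
  (forall n, measurable_fun setT (F n)) -> measurable_fun setT f ->
  (forall n w, `|F n w| <= M) ->
  (forall w, F n w @[n --> \oo] --> f w) ->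
  Ex (F n) @[n --> \oo] --> Ex f.
Proof.
move=> mF mf FM Ff.
have fM w : `|f w| <= M.
  have h : `|F n w| @[n --> \oo] --> `|f w| by apply: cvg_norm.
  rewrite -(cvg_lim _ h)//; apply: limr_le; first by apply/cvg_ex; exists `|f w|.
  by apply: nearW => n; exact: FM.
have bF n : bdd_meas (F n) by split => //; exists M.
have bf : bdd_meas f by split => //; exists M.
apply: (@fine_cvg _ _ _ _ (fun n => \int[P]_w (F n w)%:E)%E).
rewrite EFin_Ex//.
have [|||||_ _ h] := @dominated_convergence _ _ _ P setT measurableT
  (fun n w => (F n w)%:E) (fun w => (f w)%:E) (cst M%:E).
- by move=> n; apply/measurable_EFinP.
- by apply/measurable_EFinP.
- by apply: aeW => w _; apply: cvg_EFin; [exact: nearW | exact: Ff].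
- by apply: (@bdd_meas_integrable (fun=> M)); exact: bdd_meas_cst.
- by apply: aeW => w n _; rewrite lee_fin.
exact: h.
Qed.

Lemma Ex_eq0_ae f : bdd_meas f -> (forall w, 0 <= f w) -> Ex f = 0 ->
  {ae P, forall w, f w = 0}.
Proof.
move=> hf f0 Ef0.
have mf : measurable_fun setT (EFin \o f) by apply/measurable_EFinP; case: hf.
have /(ae_eq_integral_abs P measurableT mf) : (\int[P]_x `|(EFin \o f) x| = 0)%E.
  rewrite -[RHS]/(0%:E) -Ef0 EFin_Ex//; apply: eq_integral => w _ /=.
  by rewrite ger0_norm.
by apply: filterS => w /= /(_ I) [].
Qed.

Lemma eq_Ex_ae f g : bdd_meas f -> bdd_meas g -> {ae P, forall w, f w = g w} ->
  Ex f = Ex g.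
Proof.
move=> hf hg fg; rewrite /Ex /Rintegral; congr fine; apply: ae_eq_integral => //.
- by apply/measurable_EFinP; case: hf.
- by apply/measurable_EFinP; case: hg.
- by apply: filterS fg => w -> _.
Qed.

End BoundedExpectation.

(** * Characteristic functions determine laws *)

Section Kernels.
Context {R : realType}.
Local Notation leb := (@lebesgue_measure R).

Lemma Rintegral_derivative (F f : R -> R) (a b : R) : a < b ->
  (forall x : R, is_derive x 1 F (f x)) -> continuous f ->
  \int[leb]_(x in `[a, b]) f x = F b - F a.
Proof.
move=> ab dF cf; rewrite /Rintegral (@continuous_FTC2 _ f F)//.
- exact: continuous_subspaceT.
- have cF : continuous F.
    move=> x; apply/differentiable_continuous/derivable1_diffP.
    by have [] := dF x.
  split; first by move=> x _; have [] := dF x.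
    by apply: cvg_at_right_filter; exact: cF.
  by apply: cvg_at_left_filter; exact: cF.
- by move=> x _; rewrite derive1E; have [_ ->] := dF x.
Qed.

(* The primitive [F] comes from integrating [exp (- (e - i y) u)]. *)
Lemma Rintegral_expR_cos (e y N : R) : 0 < e -> 0 < N ->
  \int[leb]_(u in `[0, N]) (expR (- (e * u)) * cos (u * y)) =
  e / (e ^+ 2 + y ^+ 2) +
    expR (- (e * N)) * ((y * sin (N * y) - e * cos (N * y)) / (e ^+ 2 + y ^+ 2)).
Proof.
move=> e0 N0.
have D0 : e ^+ 2 + y ^+ 2 != 0.
  by rewrite gt_eqF// ltr_pwDl ?exprn_gt0 ?sqr_ge0.
pose F u := expR (- (e * u)) *
  ((y * sin (u * y) - e * cos (u * y)) / (e ^+ 2 + y ^+ 2)).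
have dF (u : R) : is_derive u 1 F (expR (- (e * u)) * cos (u * y)).
  rewrite /F; apply: is_derive_eq.
  by rewrite /GRing.scale /=; field.
rewrite (Rintegral_derivative N0 dF).
  by rewrite /F !mulr0 !mul0r sin0 cos0 oppr0 expR0; field.
move=> u; apply: cvgM.
  apply: continuous_comp; last exact: continuous_expR.
  by apply: cvgN; apply: cvgM; [exact: cvg_cst | exact: cvg_id].
apply: continuous_comp; last exact: continuous_cos.
by apply: cvgM; [exact: cvg_id | exact: cvg_cst].
Qed.

(** The primitive in [c] is [atan ((c - x) / e)]. Integrating the kernel over its centre thus
    produces a smoothed indicator of [[a, b]], of height [pi] as [e] tends to 0. *)
Lemma Rintegral_poisson (e x a b : R) : 0 < e -> a < b ->
  \int[leb]_(c in `[a, b]) (e / (e ^+ 2 + (x - c) ^+ 2)) =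
  atan ((b - x) / e) - atan ((a - x) / e).
Proof.
move=> e0 ab.
have D0 c : e ^+ 2 + (x - c) ^+ 2 != 0.
  by rewrite gt_eqF// ltr_pwDl ?exprn_gt0 ?sqr_ge0.
have dF (c : R) : is_derive c 1 (fun c => atan ((c - x) / e))
    (e / (e ^+ 2 + (x - c) ^+ 2)).
  apply: is_derive_eq.
  rewrite /GRing.scale /=.
  have := D0 c; have := lt0r_neq0 e0 => e1 D1; field.
  by rewrite e1 D1.
rewrite (Rintegral_derivative ab dF)//.
move=> c; apply: cvgM; first exact: cvg_cst.
apply: cvgV; first exact: D0.
apply: cvgD; first exact: cvg_cst.
by apply: cvgM; apply: cvgB; [exact: cvg_cst | exact: cvg_id | exact: cvg_cst | exact: cvg_id].
Qed.

End Kernels.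

Section Swap.
Context {R : realType} {dO : measure_display} {Omega : measurableType dO}.
Variable P : probability Omega R.
Implicit Types (W V X Y : Omega -> R).
Local Notation leb := (@lebesgue_measure R).

Lemma Ex_Rintegral_swap (p : R -> R -> R) (a b M : R) W X :
  measurable_fun [set: R * R] (fun z => p z.1 z.2) ->
  (forall u x, `|p u x| <= M) -> bdd_meas W -> measurable_fun setT X ->
  Ex P (fun w => W w * \int[leb]_(u in `[a, b]) p u (X w)) =
  \int[leb]_(u in `[a, b]) Ex P (fun w => W w * p u (X w)).
Proof.
move=> mp pM bW mX; have [mW [N WN]] := bW.
(* The indicator moves the restriction to [[a, b]] into the integrand, so that Fubini applies on the
   whole product; [N * M] times the indicator is an integrable majorant. *)
pose f (z : Omega * R) : R := \1_(`[a, b]) z.2 * (W z.1 * p z.2 (X z.1)).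
have mf : measurable_fun setT (EFin \o f).
  apply/measurable_EFinP; apply: measurable_funM.
    by apply: measurableT_comp; [exact: measurable_indic | exact: measurable_snd].
  apply: measurable_funM; first exact: (measurableT_comp mW measurable_fst).
  apply: (measurableT_comp mp (f := fun z : R * R => p z.1 z.2)
    (g := fun z : Omega * R => (z.2, X z.1))).
  apply/measurable_fun_pair; first exact: measurable_snd.
  exact: (measurableT_comp mX measurable_fst).
have mpx x : measurable_fun setT (p ^~ x).
  exact: (measurableT_comp mp (measurable_pair2 x)).
have fle z : `|f z| <= (N * M) * \1_(`[a, b]) z.2.
  rewrite /f normrM mulrC ler_pM//; last by rewrite ger0_norm.
  by rewrite normrM ler_pM.
have NM0 (w : Omega) : 0 <= N * M.
  by apply: mulr_ge0; [exact: le_trans (WN w) | exact: le_trans (pM 0 0)].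
have if_ : (P \x leb)%E.-integrable setT (EFin \o f).
  apply/integrable12ltyP => //.
  apply: (@le_lt_trans _ _ (\int[P]_w ((N * M)%:E * leb `[a, b]))%E).
    apply: ge0_le_integral => //.
    - by move=> w _; apply: integral_ge0.
    - apply: (@measurable_fun_fubini_tonelli_F _ _ _ _ _ leb (abse \o (EFin \o f))) => //.
        exact: measurableT_comp.
      by move=> w; exact: abse_ge0.
    move=> w _; rewrite -(setIT `[a, b]) -integral_indic//.
    rewrite -ge0_integralZl_EFin ?(NM0 w)//; last first.
      by apply/measurable_EFinP; exact: measurable_indic.
    apply: ge0_le_integral => //.
    - apply: measurableT_comp => //.
      exact: (measurableT_comp mf (measurable_pair1 w)).
    - by apply/measurable_EFinP/measurable_funM => //.
    - by move=> u _; rewrite /= -EFinM lee_fin fle.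
  rewrite integral_cst//= probability_setT mule1 lebesgue_measure_itv/=.
  by case: ifP => _; rewrite -?EFinM ?mule0 ltry.
rewrite /Rintegral.
transitivity (fine (\int[P]_w \int[leb]_u (EFin \o f) (w, u))%E).
  rewrite {1}/Ex /Rintegral; congr fine; apply: eq_integral => w _.
  have ip : leb.-integrable `[a, b] (EFin \o (fun u => p u (X w))).
    apply: measurable_bounded_integrable => //.
    - rewrite /= lebesgue_measure_itv/=; by case: ifP => _; rewrite ltry.
    - by apply: measurable_funTS; exact: mpx.
    - by exists M; split; [exact: num_real|] => x Mx u _ /=;
        apply: le_trans (pM _ _) _; exact: ltW.
  rewrite EFinM /Rintegral fineK; last exact: integrable_fin_num.
  rewrite -integralZl// integral_mkcond; apply: eq_integral => u _.
  by rewrite patchE /= /f /= indicE; case: ifPn => uab;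
    rewrite ?(mul1r, mul0r).
rewrite Fubini//; congr fine; rewrite [in RHS]integral_mkcond.
apply: eq_integral => u _; rewrite patchE; case: ifPn => uab.
  rewrite EFin_Ex; last first.
    apply: bdd_measM => //; apply: (bdd_meas_comp (g := p u)) => //.
      exact: (measurableT_comp mp (measurable_pair1 u)).
    by exists M.
  by apply: eq_integral => w _; rewrite /f /= indicE uab mul1r.
rewrite [LHS]integral0_eq// => w _.
by rewrite /f /= indicE (negbTE uab) mul0r.
Qed.

End Swap.

(** * The Poisson kernel as a mixture of cosines *)

Section PoissonKernel.
Context {R : realType} {dO : measure_display} {Omega : measurableType dO}.
Variable P : probability Omega R.
Implicit Types (W V X Y : Omega -> R).
Local Notation leb := (@lebesgue_measure R).

Lemma eq_limits (u v : nat -> R) (l m : R) : u n @[n --> \oo] --> l ->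
  v n @[n --> \oo] --> m -> (forall n, u n = v n) -> l = m.
Proof.
move=> ul vm uv; have {}uv : u = v by exact/funext.
by move: ul; rewrite uv => ul; apply: (cvg_unique _ ul vm).
Qed.

Lemma cvg_expR_decay (e : R) : 0 < e -> expR (- (e * n%:R)) @[n --> \oo] --> (0 : R).
Proof.
move=> e0.
have -> : (fun n : nat => expR (- (e * n%:R))) = (fun n => expR (- e) ^+ n).
  by apply/funext => n; rewrite -expRM_natl mulrN [in RHS]mulrC.
by apply: cvg_expr; rewrite ger0_norm ?expR_ge0// expR_lt1 oppr_lt0.
Qed.

(** The numerator is at most [|y| + e], and [(|y| + e) * e <= 2 * (e ^+ 2 + y ^+ 2)] follows from
    [0 <= (|y| - e) ^+ 2]. Uniformity in [y] and [u] serves both to dominate the truncated kernels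
    and to make their boundary term vanish. *)
Lemma poisson_kernel_bound (e y u : R) : 0 < e ->
  `|(y * sin u - e * cos u) / (e ^+ 2 + y ^+ 2)| <= 2 / e.
Proof.
move=> e0.
have D0 : 0 < e ^+ 2 + y ^+ 2 by rewrite ltr_pwDl ?exprn_gt0 ?sqr_ge0.
rewrite normrM normfV (gtr0_norm D0) ler_pdivrMr// mulrAC ler_pdivlMr//.
have h : `|y * sin u - e * cos u| <= `|y| + e.
  rewrite (le_trans (ler_normB _ _))// !normrM (gtr0_norm e0).
  rewrite lerD// ler_piMr ?normr_ge0 ?(ltW e0)// ler_norml.
    by rewrite sin_geN1 sin_le1.
  by rewrite cos_geN1 cos_le1.
rewrite (le_trans (ler_wpM2r (ltW e0) h))//.
have := sqr_ge0 (`|y| - e); have := sqr_ge0 `|y|; rewrite -(real_normK (num_real y)).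
by nra.
Qed.

Section Compare.
Variables (W V X Y : Omega -> R).
Hypothesis bW : bdd_meas W.
Hypothesis bV : bdd_meas V.
Hypothesis mX : measurable_fun setT X.
Hypothesis mY : measurable_fun setT Y.

Hypothesis Ecos : forall u : R,
  Ex P (fun w => W w * cos (u * X w)) = Ex P (fun w => V w * cos (u * Y w)).
Hypothesis Esin : forall u : R,
  Ex P (fun w => W w * sin (u * X w)) = Ex P (fun w => V w * sin (u * Y w)).

Let Ecos_shift (W' X' : Omega -> R) (u c : R) : bdd_meas W' -> measurable_fun setT X' ->
  Ex P (fun w => W' w * cos (u * (X' w - c))) =
  cos (u * c) * Ex P (fun w => W' w * cos (u * X' w)) +
  sin (u * c) * Ex P (fun w => W' w * sin (u * X' w)).
Proof.
move=> bW' mX'.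
have mu : measurable_fun setT (fun w => u * X' w).
  by apply: measurable_funM => //; exact: measurable_cst.
have b1 := bdd_measM bW' (bdd_meas_cos mu).
have b2 := bdd_measM bW' (bdd_meas_sin mu).
rewrite -ExZ// -ExZ// -ExD//; [|exact: bdd_measZ|exact: bdd_measZ].
by congr Ex; apply/funext => w; rewrite mulrBr cosB; ring.
Qed.

(** The kernel is the limit of the integrals of [expR (- (e * u)) * cos (u * (x - c))] over
    [[0, n]], so it inherits the equality assumed for cosines and sines. The weights may be signed;
    later they carry the other coordinates. *)
Lemma Ex_poisson_eq (e c : R) : 0 < e ->
  Ex P (fun w => W w * (e / (e ^+ 2 + (X w - c) ^+ 2))) =
  Ex P (fun w => V w * (e / (e ^+ 2 + (Y w - c) ^+ 2))).
Proof.
move=> e0.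
(* The closed form of the integral over [[0, n]]: the kernel plus a boundary term that decays like
   [expR (- (e * n))]. *)
pose k (n : nat) (y : R) := e / (e ^+ 2 + y ^+ 2) +
  expR (- (e * n%:R)) * ((y * sin (n%:R * y) - e * cos (n%:R * y)) / (e ^+ 2 + y ^+ 2)).
have Dy y : 0 < e ^+ 2 + y ^+ 2 by rewrite ltr_pwDl ?exprn_gt0 ?sqr_ge0.
have ck n : continuous (k n).
  have cm : continuous (fun y : R => n%:R * y).
    by move=> y; apply: cvgM; [exact: cvg_cst | exact: cvg_id].
  have cD : continuous (fun y : R => (e ^+ 2 + y ^+ 2)^-1).
    move=> y; apply: cvgV; first by rewrite gt_eqF.
    by apply: cvgD; [exact: cvg_cst | apply: cvgM; exact: cvg_id].
  move=> y; apply: cvgD; first by apply: cvgM; [exact: cvg_cst | exact: cD].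
  apply: cvgM; first exact: cvg_cst.
  apply: cvgM; last exact: cD.
  apply: cvgB.
    apply: cvgM; first exact: cvg_id.
    by apply: continuous_comp; [exact: cm | exact: continuous_sin].
  apply: cvgM; first exact: cvg_cst.
  by apply: continuous_comp; [exact: cm | exact: continuous_cos].
have kb n y : `|k n y| <= 1 / e + 2 / e.
  rewrite (le_trans (ler_normD _ _))// lerD//.
    rewrite ger0_norm ?divr_ge0 ?(ltW e0) ?(ltW (Dy y))// ler_pdivrMr// mulrAC.
    by rewrite ler_pdivlMr// mul1r -expr2 lerDl sqr_ge0.
  rewrite normrM ger0_norm ?expR_ge0// -[leRHS]mul1r ler_pM ?expR_ge0//.
    by rewrite -expR0 ler_expR oppr_le0 mulr_ge0 ?(ltW e0).
  exact: poisson_kernel_bound.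
(* [n.+1] keeps the interval nondegenerate; [|u|] in place of [u] keeps the integrand bounded by 1
   on the whole line, as the exchange of integrals requires. *)
have kE (W' X' : Omega -> R) n : bdd_meas W' -> measurable_fun setT X' ->
    Ex P (fun w => W' w * k n.+1 (X' w - c)) =
    \int[leb]_(u in `[0, n.+1%:R])
      (expR (- (e * `|u|)) * Ex P (fun w => W' w * cos (u * (X' w - c)))).
  move=> bW' mX'.
  have mXc : measurable_fun setT (fun w => X' w - c).
    by apply: measurable_funB => //; exact: measurable_cst.
  transitivity (Ex P (fun w => W' w *
      \int[leb]_(u in `[0, n.+1%:R]) (expR (- (e * `|u|)) * cos (u * (X' w - c))))).
    congr Ex; apply/funext => w; congr (_ * _).
    rewrite /k -Rintegral_expR_cos//; apply: eq_Rintegral => u.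
    by rewrite inE/= in_itv/= => /andP[u0 _]; rewrite ger0_norm.
  rewrite (Ex_Rintegral_swap P (p := fun u x => expR (- (e * `|u|)) * cos (u * x))
    0 n.+1%:R (M := 1) _ _ bW' mXc)//.
  - apply: eq_Rintegral => u _; rewrite -ExZ.
      by congr Ex; apply/funext => w; ring.
    apply: bdd_measM => //; apply: bdd_meas_cos.
    by apply: measurable_funM => //; exact: measurable_cst.
  - apply: measurable_funM.
      apply: (measurableT_comp (f := expR)).
        by apply: continuous_measurable_fun; exact: continuous_expR.
      apply: measurableT_comp => //; apply: measurable_funM.
        exact: measurable_cst.
      by apply: measurableT_comp => //; exact: measurable_fst.
    apply: (measurableT_comp (f := cos)).
      by apply: continuous_measurable_fun; exact: continuous_cos.
    by apply: measurable_funM; [exact: measurable_fst | exact: measurable_snd].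
  - move=> u x; rewrite normrM ger0_norm ?expR_ge0// -[leRHS]mul1r.
    rewrite ler_pM ?expR_ge0//.
      by rewrite -expR0 ler_expR oppr_le0 mulr_ge0 ?(ltW e0).
    by rewrite ler_norml cos_geN1 cos_le1.
have lim (W' X' : Omega -> R) : bdd_meas W' -> measurable_fun setT X' ->
    Ex P (fun w => W' w * k n.+1 (X' w - c)) @[n --> \oo] -->
    Ex P (fun w => W' w * (e / (e ^+ 2 + (X' w - c) ^+ 2))).
  move=> [mW' [B WB]] mX'.
  have mk n : measurable_fun setT (fun w => k n (X' w - c)).
    apply: (measurableT_comp (f := k n)).
      by apply: continuous_measurable_fun; exact: ck.
    by apply: measurable_funB => //; exact: measurable_cst.
  have cv w : W' w * k n.+1 (X' w - c) @[n --> \oo] -->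
      W' w * (e / (e ^+ 2 + (X' w - c) ^+ 2)).
    apply: cvgM; first exact: cvg_cst.
    rewrite -[X in _ --> X]addr0; apply: cvgD; first exact: cvg_cst.
    apply/norm_cvg0P.
    apply: (@squeeze_cvgr _ _ _ _ (cst 0) (fun n => expR (- (e * n.+1%:R)) * (2 / e))).
    - apply: nearW => n; rewrite normr_ge0/= normrM ger0_norm ?expR_ge0//.
      by rewrite ler_wpM2l ?expR_ge0// poisson_kernel_bound.
    - exact: cvg_cst.
    - rewrite -[X in _ --> X](mul0r (2 / e)); apply: cvgMl.
      by have := cvg_expR_decay e0; rewrite -cvg_shiftS.
  apply: (cvg_Ex (M := B * (1 / e + 2 / e))).
  - by move=> n; apply: measurable_funM.
  - apply: (measurable_fun_cvg (h := fun n w => W' w * k n.+1 (X' w - c))) => //.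
      by move=> n; apply: measurable_funM.
  - by move=> n w; rewrite normrM ler_pM.
  - exact: cv.
have lX := lim _ _ bW mX; have lY := lim _ _ bV mY.
apply: (eq_limits lX lY) => n; rewrite !kE//; apply: eq_Rintegral => u _.
by rewrite !Ecos_shift// Ecos Esin.
Qed.

End Compare.

End PoissonKernel.

(** * From the Poisson kernel to half-lines and Borel sets *)

Section LawComparison.
Context {R : realType} {dO : measure_display} {Omega : measurableType dO}.
Variable P : probability Omega R.
Variables (W V X Y : Omega -> R).
Hypothesis bW : bdd_meas W.
Hypothesis bV : bdd_meas V.
Hypothesis mX : measurable_fun setT X.
Hypothesis mY : measurable_fun setT Y.
Local Notation leb := (@lebesgue_measure R).

Lemma Ex_atan_eq (e a b : R) : 0 < e -> a < b ->
  (forall c, Ex P (fun w => W w * (e / (e ^+ 2 + (X w - c) ^+ 2))) =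
             Ex P (fun w => V w * (e / (e ^+ 2 + (Y w - c) ^+ 2)))) ->
  Ex P (fun w => W w * (atan ((b - X w) / e) - atan ((a - X w) / e))) =
  Ex P (fun w => V w * (atan ((b - Y w) / e) - atan ((a - Y w) / e))).
Proof.
move=> e0 ab H.
have Dy y : 0 < e ^+ 2 + y ^+ 2 by rewrite ltr_pwDl ?exprn_gt0 ?sqr_ge0.
have E (W' X' : Omega -> R) : bdd_meas W' -> measurable_fun setT X' ->
    Ex P (fun w => W' w * (atan ((b - X' w) / e) - atan ((a - X' w) / e))) =
    \int[leb]_(c in `[a, b]) Ex P (fun w => W' w * (e / (e ^+ 2 + (X' w - c) ^+ 2))).
  move=> bW' mX'.
  rewrite -(Ex_Rintegral_swap P (p := fun c x => e / (e ^+ 2 + (x - c) ^+ 2)) a b (M := 1 / e))//.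
  - by congr Ex; apply/funext => w; rewrite Rintegral_poisson.
  - have c1 : continuous (fun y : R => e / (e ^+ 2 + y ^+ 2)).
      move=> y; apply: cvgM; first exact: cvg_cst.
      apply: cvgV; first by rewrite gt_eqF.
      by apply: cvgD; [exact: cvg_cst | apply: cvgM; exact: cvg_id].
    apply: (measurableT_comp (continuous_measurable_fun c1)).
    by apply: measurable_funB; [exact: measurable_snd | exact: measurable_fst].
  - move=> u x; rewrite ger0_norm ?divr_ge0 ?(ltW e0) ?(ltW (Dy _))//.
    by rewrite ler_pdivrMr// mulrAC ler_pdivlMr// mul1r -expr2 lerDl sqr_ge0.
by rewrite (E _ _ bW mX) (E _ _ bV mY); apply: eq_Rintegral => c _; exact: H.
Qed.

Lemma cvg_atan_pinfty (u : nat -> R) :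
  u n @[n --> \oo] --> +oo -> atan (u n) @[n --> \oo] --> pi / 2.
Proof. by move=> uy; exact: (cvg_comp _ _ uy (@cvgy_atan R)). Qed.

Lemma cvg_atan_ninfty (u : nat -> R) :
  - u n @[n --> \oo] --> +oo -> atan (u n) @[n --> \oo] --> - (pi / 2).
Proof.
move=> /cvg_atan_pinfty h.
have -> : (fun n => atan (u n)) = (fun n => - atan (- u n)).
  by apply/funext => n; rewrite atanN opprK.
exact: cvgN.
Qed.

(* An integral of the Poisson kernel of width [n.+1 ^- 2] over an interval
   tending to [`]-oo, b]], hence a smooth version of its indicator. *)
Let th (b : R) (n : nat) (x : R) := atan ((b + n.+1%:R^-1 - x) * n.+1%:R ^+ 2) -
   atan ((b - n.+1%:R - x) * n.+1%:R ^+ 2).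

Let cvgn_S : (n.+1%:R : R) @[n --> \oo] --> +oo.
Proof. by have := @cvgr_idn R; rewrite -cvg_shiftS. Qed.

(** The shift [n.+1%:R^-1] of the endpoint outweighs the width [n.+1 ^- 2] of the kernel, so the
    point [b] itself receives the full value [pi]: the limit is the closed half-line, without a half
    weight at its end. *)
Let th_cvg b x : th b n x @[n --> \oo] --> pi * \1_(`]-oo, b]) x.
Proof.
have lo : - ((b - n.+1%:R - x) * n.+1%:R ^+ 2) @[n --> \oo] --> +oo.
  apply: (@ger_cvgy _ _ _ _ (fun n : nat => n.+1%:R)); last exact: cvgn_S.
  have : \forall n \near \oo, (b - x + 1 <= n.+1%:R).
    by have /cvgryPge := cvgn_S; apply.
  apply: filterS => n hn.
  have n1 : 1 <= n.+1%:R :> R by rewrite ler1n.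
  by nra.
have ln := cvg_atan_ninfty lo.
have [xb|bx] := leP x b.
  rewrite indicE mem_set/= ?in_itv//=.
  rewrite mulr1 (_ : pi = pi / 2 - - (pi / 2)); last by field.
  apply: cvgB => //; apply: cvg_atan_pinfty.
  apply: (@ger_cvgy _ _ _ _ (fun n : nat => n.+1%:R)); last exact: cvgn_S.
  apply: nearW => n; set m : R := n.+1%:R.
  have m0 : 0 < m by rewrite ltr0n.
  have -> : (b + m^-1 - x) * m ^+ 2 = (b - x) * m ^+ 2 + m.
    by field; rewrite gt_eqF.
  by rewrite lerDr mulr_ge0 ?sqr_ge0// subr_ge0.
rewrite indicE memNset/= ?in_itv/= ?leNgt ?bx//.
rewrite mulr0 (_ : 0 = - (pi / 2) - - (pi / 2) :> R); last by rewrite subrr.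
apply: cvgB => //; apply: cvg_atan_ninfty.
apply: (@ger_cvgy _ _ _ _ (fun n : nat => n.+1%:R)); last exact: cvgn_S.
have : \forall n \near \oo, (2 / (x - b) <= n.+1%:R).
  by have /cvgryPge := cvgn_S; apply.
apply: filterS => n; set m : R := n.+1%:R => hn.
have m0 : 0 < m by rewrite ltr0n.
have -> : - ((b + m^-1 - x) * m ^+ 2) = (x - b) * m ^+ 2 - m.
  by field; rewrite gt_eqF.
have : 2 <= (x - b) * m by rewrite mulrC -ler_pdivrMr// subr_gt0.
by nra.
Qed.

(** A weighted uniqueness theorem for characteristic functions: the Poisson kernels give the
    half-lines, and Dynkin's argument gives all Borel sets. *)
Lemma Ex_law_eq :
  (forall u : R,
    Ex P (fun w => W w * cos (u * X w)) = Ex P (fun w => V w * cos (u * Y w))) ->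
  (forall u : R,
    Ex P (fun w => W w * sin (u * X w)) = Ex P (fun w => V w * sin (u * Y w))) ->
  forall C : set R, measurable C ->
    Ex P (fun w => W w * \1_C (X w)) = Ex P (fun w => V w * \1_C (Y w)).
Proof.
move=> Hc Hs.
(* Frequency 0 shows that the weights have equal total mass. *)
have EWV : Ex P W = Ex P V.
  have := Hc 0.
  by under eq_fun do rewrite mul0r cos0 mulr1; under [in RHS]eq_fun do rewrite mul0r cos0 mulr1.
have thE b n : Ex P (fun w => W w * th b n (X w)) = Ex P (fun w => V w * th b n (Y w)).
  rewrite /th; set m : R := n.+1%:R.
  have m0 : 0 < m by rewrite ltr0n.
  have := @Ex_atan_eq (m ^- 2) (b - m) (b + m^-1).
  rewrite invrK; apply; first by rewrite invr_gt0 exprn_gt0.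
    by rewrite ltrD2l (lt_trans (_ : _ < 0))// ?oppr_lt0// invr_gt0.
  by move=> c; apply: Ex_poisson_eq => //; rewrite invr_gt0 exprn_gt0.
have thlim b (W' X' : Omega -> R) : bdd_meas W' -> measurable_fun setT X' ->
    Ex P (fun w => W' w * th b n (X' w)) @[n --> \oo] -->
    Ex P (fun w => W' w * (pi * \1_(`]-oo, b]) (X' w))).
  move=> [mW' [B WB]] mX'.
  have mi : measurable_fun setT (fun w => W' w * (pi * \1_(`]-oo, b]) (X' w))).
    apply: measurable_funM => //; apply: measurable_funM => //.
    by have [] := bdd_meas_indic_comp (measurable_itv (Interval -oo%O (BRight b))) mX'.
  have mt n : measurable_fun setT (fun w => W' w * th b n (X' w)).
    have ma : measurable_fun setT (@atan R).
      by apply: continuous_measurable_fun; exact: continuous_atan.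
    apply: measurable_funM => //; apply: measurable_funB.
      apply: (measurableT_comp ma); apply: measurable_funM => //.
      by apply: measurable_funB.
    apply: (measurableT_comp ma); apply: measurable_funM => //.
    by apply: measurable_funB.
  apply: (cvg_Ex (M := B * (pi + pi))) => //.
  - move=> n w; rewrite normrM ler_pM// (le_trans (ler_normB _ _))//.
    have pi0 := pi_ge0 R.
    rewrite lerD// ler_norml.
      have := atan_gtNpi2 ((b + n.+1%:R^-1 - X' w) * n.+1%:R ^+ 2).
      have := atan_ltpi2 ((b + n.+1%:R^-1 - X' w) * n.+1%:R ^+ 2).
      by lra.
    have := atan_gtNpi2 ((b - n.+1%:R - X' w) * n.+1%:R ^+ 2).
    have := atan_ltpi2 ((b - n.+1%:R - X' w) * n.+1%:R ^+ 2).
    by lra.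
  - by move=> w; apply: cvgM; [exact: cvg_cst | exact: th_cvg].
have bi (C : set R) (Z : Omega -> R) : measurable C -> measurable_fun setT Z ->
  @bdd_meas R _ _ (fun w => \1_C (Z w)) by exact: bdd_meas_indic_comp.
have half b : Ex P (fun w => W w * \1_(`]-oo, b]) (X w)) =
              Ex P (fun w => V w * \1_(`]-oo, b]) (Y w)).
  apply: (mulfI (_ : pi != 0 :> R)); first by rewrite gt_eqF// pi_gt0.
  rewrite -!ExZ; [|by apply: bdd_measM => //; exact: bi|by apply: bdd_measM => //; exact: bi].
  have E (W' X' : Omega -> R) : (fun w => pi * (W' w * \1_(`]-oo, b]) (X' w))) =
       (fun w => W' w * (pi * \1_(`]-oo, b]) (X' w))) by apply/funext => w; ring.
  rewrite !E; apply: (eq_limits (thlim b _ _ bW mX) (thlim b _ _ bV mY)) => n.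
  exact: thE.
have diff (A B : set R) (W' X' : Omega -> R) : bdd_meas W' -> measurable_fun setT X' ->
    measurable A -> measurable B -> B `<=` A ->
    Ex P (fun w => W' w * \1_(A `\` B) (X' w)) =
    Ex P (fun w => W' w * \1_A (X' w)) - Ex P (fun w => W' w * \1_B (X' w)).
  move=> bW' mX' mA mB BA; rewrite -ExB; [|by apply: bdd_measM => //; exact: bi|by apply: bdd_measM => //; exact: bi].
  congr Ex; apply/funext => w; rewrite -mulrBr; congr (_ * _).
  rewrite !indicE in_setD; case: (boolP (X' w \in B)) => XB /=.
    by rewrite andbF mem_set ?subrr//; apply: BA; exact/set_mem.
  by rewrite andbT subr0.
(* A lambda-system containing the rays. The weights may be signed, so increasing unions are handled
   by bounded rather than monotone convergence. *)
pose H := [set C : set R | measurable C /\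
  Ex P (fun w => W w * \1_C (X w)) = Ex P (fun w => V w * \1_C (Y w))].
have HT : H setT.
  split => //.
  have E (W' X' : Omega -> R) : (fun w => W' w * \1_setT (X' w)) = W'.
    by apply/funext => w; rewrite indicT mulr1.
  by rewrite !E.
have lamH : lambda_system setT H.
  split => //.
  - move=> A B BA [mA HA] [mB HB]; split; first exact: measurableD.
    by rewrite !diff// HA HB.
  - move=> F ndF HF.
    have mF : measurable (\bigcup_n F n).
      by apply: bigcupT_measurable => n; have [] := HF n.
    split=> //.
    have lim (W' X' : Omega -> R) : bdd_meas W' -> measurable_fun setT X' ->
        Ex P (fun w => W' w * \1_(F n) (X' w)) @[n --> \oo] -->
        Ex P (fun w => W' w * \1_(\bigcup_n F n) (X' w)).
      move=> bW' mX'; have [mW' [B WB]] := bW'.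
      apply: (cvg_Ex (M := B)).
      + move=> n; apply: (bdd_measM bW' (bi _ _ _ _)).1 => //.
        by have [] := HF n.
      + by apply: (bdd_measM bW' (bi _ _ _ _)).1.
      + move=> n w; rewrite normrM indicE.
        by case: (_ \in _); rewrite ?normr1 ?mulr1// normr0 mulr0 (le_trans _ (WB w)).
      + move=> w; apply: cvgM; first exact: cvg_cst.
        have [Fw|Fw] := pselect ((\bigcup_n F n) (X' w)).
          have [k _ Fk] := Fw.
          rewrite [X in _ --> X](_ : _ = 1); last by rewrite indicE mem_set.
          apply: cvg_near_cst; exists k => // n /= kn.
          rewrite indicE mem_set//.
          by have /subsetPset := ndF _ _ kn; apply.
        rewrite [X in _ --> X](_ : _ = 0); last by rewrite indicE memNset.
        apply: cvg_near_cst; apply: nearW => n /=.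
        rewrite indicE memNset// => Fn; apply: Fw; by exists n.
    apply: (eq_limits (lim _ _ bW mX) (lim _ _ bV mY)) => n.
    by have [] := HF n.
move=> C mC.
suff : H C by case.
apply: (@lambda_system_subset _ (@RGenOInfty.G R) _ setT H lamH) => //.
- move=> A B [x ->] [y ->]; exists (Num.max x y).
  apply/seteqP; split => z /=; rewrite !in_itv/= !andbT gt_max.
    by move=> [-> ->].
  by move=> /andP[].
- move=> _ [x ->].
  have -> : `]x, +oo[%classic = setT `\` `]-oo, x]%classic :> set R.
    apply/seteqP; split => z /=; rewrite !in_itv/= ?andbT.
      by move=> xz; split => //; apply/negP; rewrite -ltNge.
    by move=> [_ /negP]; rewrite -ltNge.
  split; first exact: measurableD.
  by rewrite !diff// half; case: HT => _ ->.
- have mC' : (ocitv (R:=R)).-sigma.-measurable C by exact: mC.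
  by rewrite RGenOInfty.measurableE in mC'.
Qed.

End LawComparison.

Lemma indic_pred (R : realType) (T : Type) (b : T -> bool) (x : T) :
  \1_([set t | b t]) x = (b x)%:R :> R.
Proof. by rewrite indicE; congr ((nat_of_bool _)%:R); apply/idP/idP => [/set_mem|/mem_set]. Qed.

Section LayerCakeTransfer.
Context {R : realType} {dO : measure_display} {Omega : measurableType dO}.
Variable P : probability Omega R.
Local Notation leb := (@lebesgue_measure R).

Lemma Rintegral_indic_lt (y M : R) : 0 <= y <= M ->
  \int[leb]_(t in `[0, M]) (t < y)%R%:R = y.
Proof.
move=> /andP[y0 yM].
rewrite /Rintegral (_ : (fun t : R => ((t < y)%R%:R)%:E) =
    (fun t => (\1_([set t : R | t < y]) t)%:E)); last first.
  by apply/funext => t; rewrite indic_pred.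
have mA : measurable [set t : R | t < y].
  rewrite (_ : mkset _ = `]-oo, y[%classic); first exact: measurable_itv.
  by apply/seteqP; split => t /=; rewrite in_itv.
rewrite integral_indic// (_ : _ `&` _ = `[0, y[%classic).
  have /= -> := lebesgue_measure_itv (Interval (BLeft 0) (BLeft y)).
  by rewrite lte_fin; case: ltP => h /=;
    [rewrite subr0|apply/eqP; rewrite eq_le y0 h].
apply/seteqP; split => t /=; rewrite !in_itv/=.
  by move=> [ty /andP[-> _]].
by move=> /andP[-> ty]; split => //; rewrite (le_trans _ yM)// ltW.
Qed.

(** Layer cake: [g + M] takes values in [[0, M + M]] and is the integral over the levels [t] of the
    indicators of [[set x | t < g x + M]]. The exchange of integrals reduces the claim to these
    indicators, and [C = setT] removes the added constant [M]. *)
Lemma Ex_transfer (W V X Y : Omega -> R) (g : R -> R) :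
  bdd_meas W -> bdd_meas V -> measurable_fun setT X -> measurable_fun setT Y ->
  measurable_fun setT g -> (exists M : R, forall x, `|g x| <= M) ->
  (forall C : set R, measurable C ->
    Ex P (fun w => W w * \1_C (X w)) = Ex P (fun w => V w * \1_C (Y w))) ->
  Ex P (fun w => W w * g (X w)) = Ex P (fun w => V w * g (Y w)).
Proof.
move=> bW bV mX mY mg [M gM] H.
have gM0 x : 0 <= g x + M <= M + M.
  by have := gM x; rewrite ler_norml => /andP[g1 g2]; apply/andP; split; lra.
have E (W' X' : Omega -> R) : bdd_meas W' -> measurable_fun setT X' ->
    Ex P (fun w => W' w * g (X' w)) =
    \int[leb]_(t in `[0, M + M]) Ex P (fun w => W' w * \1_([set x | t < g x + M]) (X' w))
    - M * Ex P (fun w => W' w * \1_setT (X' w)).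
  move=> bW' mX'.
  rewrite -(Ex_Rintegral_swap P (p := fun t x => \1_([set x | t < g x + M]) x) 0 (M + M) (M := 1))//.
  - rewrite -ExZ; last first.
      by apply: bdd_measM => //; exact: bdd_meas_indic_comp.
    rewrite -ExB.
    + congr Ex; apply/funext => w.
      have -> : \int[leb]_(u in `[0, M + M]) \1_([set x | u < g x + M]) (X' w) = g (X' w) + M.
        rewrite -[RHS](Rintegral_indic_lt (gM0 (X' w))); apply: eq_Rintegral => u _.
        by rewrite indic_pred.
      by rewrite indicT /=; ring.
    + have -> : (fun w : Omega => W' w *
          \int[leb]_(u in `[0, M + M]) \1_([set x | u < g x + M]) (X' w)) =
          (fun w : Omega => W' w * (g (X' w) + M)).
        apply/funext => w; congr (_ * _).
        rewrite -[RHS](Rintegral_indic_lt (gM0 (X' w))); apply: eq_Rintegral => u _.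
        by rewrite indic_pred.
      apply: bdd_measM => //; apply: bdd_measD; last exact: bdd_meas_cst.
      by apply: bdd_meas_comp => //; exists M.
    + by apply: bdd_measZ; apply: bdd_measM => //; exact: bdd_meas_indic_comp.
  - rewrite (_ : (fun z : R * R => _) = \1_([set z : R * R | z.1 < g z.2 + M])).
      apply: measurable_indic; rewrite -[X in measurable X]setTI.
      have : measurable_fun [set: R * R] (fun z => z.1 < g z.2 + M).
        apply: measurable_fun_ltr; first exact: measurable_fst.
        apply: measurable_funD => //; exact: (measurableT_comp mg measurable_snd).
      by move/(_ measurableT [set true] I).
    by apply/funext => z; rewrite !indic_pred.
  - by move=> u x; rewrite indicE; case: (_ \in _); rewrite ?normr0 ?normr1.
have e1 := H setT measurableT.
have e2 : \int[leb]_(t in `[0, M + M]) Ex P (fun w => W w * \1_([set x | t < g x + M]) (X w)) =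
          \int[leb]_(t in `[0, M + M]) Ex P (fun w => V w * \1_([set x | t < g x + M]) (Y w)).
  apply: eq_Rintegral => t _; apply: H.
  rewrite -[X in measurable X]setTI.
  have : measurable_fun [set: R] (fun z => t < g z + M).
    apply: measurable_fun_ltr; first exact: measurable_cst.
    by apply: measurable_funD.
  by move/(_ measurableT [set true] I).
rewrite (E _ _ bW mX) (E _ _ bV mY).
exact: (f_equal2 (fun x y => x - M * y) e2 e1).
Qed.

End LayerCakeTransfer.

(** * Independence and joint laws of finite families *)

Section FiniteFamilies.
Context {R : realType} {dO : measure_display} {Omega : measurableType dO}.
Variable P : probability Omega R.
Variable n : nat.

Lemma bdd_meas_prod (Q : pred 'I_n) (F : 'I_n -> Omega -> R) :
  (forall i, bdd_meas (F i)) -> bdd_meas (fun w => \prod_(i < n | Q i) F i w).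
Proof.
move=> bF; elim: index_enum => [|i s ih].
  by under eq_fun do rewrite big_nil; exact: bdd_meas_cst.
under eq_fun do rewrite big_cons.
by case: (Q i) => //; exact: bdd_measM.
Qed.

Lemma measurable_fun_sumord (Q : pred 'I_n) (F : 'I_n -> Omega -> R) :
  (forall i, measurable_fun setT (F i)) ->
  measurable_fun setT (fun w => \sum_(i < n | Q i) F i w).
Proof.
move=> mF; elim: index_enum => [|i s ih].
  by under eq_fun do rewrite big_nil; exact: measurable_cst.
under eq_fun do rewrite big_cons.
by case: (Q i) => //; exact: measurable_funD.
Qed.

Lemma ltn_ord_split (T : Type) (idx : T) (op : Monoid.com_law idx) (F : 'I_n -> T)
  (k : 'I_n) : \big[op/idx]_(i < n | (i < k.+1)%N) F i =
  op (F k) (\big[op/idx]_(i < n | (i < k)%N) F i).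
Proof.
rewrite (bigD1 k)//=; congr (op _ _); apply: eq_bigl => i.
by rewrite ltnS [RHS]ltn_neqAle andbC.
Qed.

Lemma leq_ord_split (T : Type) (idx : T) (op : Monoid.com_law idx) (F : 'I_n -> T)
  (k : 'I_n) : \big[op/idx]_(i < n | (k <= i)%N) F i =
  op (F k) (\big[op/idx]_(i < n | (k < i)%N) F i).
Proof.
rewrite (bigD1 k)//=; congr (op _ _); apply: eq_bigl => i.
by rewrite [RHS]ltn_neqAle andbC eq_sym.
Qed.

Section Mixed.
Variables (X : 'I_n -> Omega -> R).
Hypothesis mX : forall i, measurable_fun setT (X i).

(* [Ex_law_eq] and [Ex_transfer] move the coordinates one at a time between the
   trigonometric part [tail_sum] and the indicator part [head_indic]. *)
Definition head_indic (k : nat) (B : 'I_n -> set R) (w : Omega) : R :=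
  \prod_(i < n | (i < k)%N) \1_(B i) (X i w).

Definition tail_sum (k : nat) (u : 'I_n -> R) (w : Omega) : R :=
  \sum_(i < n | (k <= i)%N) u i * X i w.

Lemma bdd_meas_head_indic k B : (forall i, measurable (B i)) ->
  bdd_meas (head_indic k B).
Proof. by move=> mB; apply: bdd_meas_prod => i; exact: bdd_meas_indic_comp. Qed.

Lemma measurable_tail_sum k u : measurable_fun setT (tail_sum k u).
Proof. by apply: measurable_fun_sumord => i; apply: measurable_funM. Qed.

Lemma tail_sumS (k : 'I_n) u w : tail_sum k u w = u k * X k w + tail_sum k.+1 u w.
Proof. by rewrite /tail_sum leq_ord_split. Qed.

Lemma tail_sum_last u w : tail_sum n u w = 0.
Proof. by rewrite /tail_sum big_pred0// => i; rewrite leqNgt ltn_ord. Qed.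

Lemma head_indicS (k : 'I_n) B w :
  head_indic k.+1 B w = \1_(B k) (X k w) * head_indic k B w.
Proof. by rewrite /head_indic ltn_ord_split. Qed.

Lemma head_indic_last B w : head_indic n B w = \1_(\bigcap_(i in [set: 'I_n]) (X i @^-1` B i)) w.
Proof.
rewrite /head_indic indicE.
case: (boolP (w \in _)) => [/set_mem h|h].
  by rewrite big1// => i _; rewrite indicE mem_set//; exact: h.
have : ~ (forall i, B i (X i w)).
  by move=> h'; move/negP: h; apply; apply/mem_set => i _; exact: h'.
move=> /existsNP[i Bi]; rewrite (bigD1 i) ?ltn_ord//= indicE memNset//.
by rewrite mul0r.
Qed.

Lemma head_indic0 B w : head_indic 0 B w = 1.
Proof. by rewrite /head_indic big_pred0. Qed.

Definition set_upd (B : 'I_n -> set R) (k : 'I_n) (C : set R) : 'I_n -> set R :=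
  fun i => if i == k then C else B i.

Lemma measurable_set_upd B k C : (forall i, measurable (B i)) -> measurable C ->
  forall i, measurable (set_upd B k C i).
Proof. by move=> mB mC i; rewrite /set_upd; case: eqP. Qed.

Lemma head_indic_upd B (k : 'I_n) C w :
  head_indic k (set_upd B k C) w = head_indic k B w.
Proof.
apply: eq_bigr => i ik; rewrite /set_upd; case: eqP => // e.
by move: ik; rewrite e ltnn.
Qed.

End Mixed.

(** With indicators in every coordinate this is the definition of independence. The coordinates are
    then changed from indicators to trigonometric functions one by one, starting from the last, and
    the addition formulas reassemble the product. *)
Lemma independent_Ex_cos_sin (X : 'I_n -> Omega -> R) (u a b : 'I_n -> R) :
  (forall i, measurable_fun setT (X i)) -> independent P X ->
  (forall i, Ex P (fun w => cos (u i * X i w)) = expR (a i) * cos (b i)) ->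
  (forall i, Ex P (fun w => sin (u i * X i w)) = expR (a i) * sin (b i)) ->
  Ex P (fun w => cos (\sum_(i < n) u i * X i w)) =
    expR (\sum_(i < n) a i) * cos (\sum_(i < n) b i) /\
  Ex P (fun w => sin (\sum_(i < n) u i * X i w)) =
    expR (\sum_(i < n) a i) * sin (\sum_(i < n) b i).
Proof.
move=> mX indX hc hs.
pose A k := \sum_(i < n | (k <= i)%N) a i.
pose D k := \sum_(i < n | (k <= i)%N) b i.
pose p (B : 'I_n -> set R) k := \prod_(i < n | (i < k)%N) Ex P (fun w => \1_(B i) (X i w)).
have mcu i : measurable_fun setT (fun w => u i * X i w) by exact: measurable_funM.
(* [j] counts the coordinates already trigonometric. The sets [B] stay quantified so that the set of
   the next coordinate can be replaced by an arbitrary one. *)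
suff H j : (j <= n)%N -> forall B, (forall i, measurable (B i)) ->
    Ex P (fun w => head_indic X (n - j) B w * cos (tail_sum X (n - j) u w)) =
      p B (n - j)%N * (expR (A (n - j)%N) * cos (D (n - j)%N)) /\
    Ex P (fun w => head_indic X (n - j) B w * sin (tail_sum X (n - j) u w)) =
      p B (n - j)%N * (expR (A (n - j)%N) * sin (D (n - j)%N)).
  have := H n (leqnn _) (fun=> setT) (fun=> measurableT).
  rewrite subnn /p big_pred0// !mul1r /A /D.
  have E (f : R -> R) : (fun w => head_indic X 0 (fun=> setT) w * f (tail_sum X 0 u w)) =
      (fun w => f (\sum_(i < n) u i * X i w)).
    by apply/funext => w; rewrite head_indic0 mul1r.
  by rewrite !E.
elim: j => [_ B mB|j ih jn B mB].
  rewrite subn0 /A /D !(@big_pred0 _ _ _ _ _ (fun i : 'I_n => (n <= i)%N)); last 2 first.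
    by move=> i; rewrite leqNgt ltn_ord.
    by move=> i; rewrite leqNgt ltn_ord.
  rewrite expR0 sin0 cos0 !mulr1 mulr0.
  have -> : (fun w => head_indic X n B w * cos (tail_sum X n u w)) = head_indic X n B.
    by apply/funext => w; rewrite tail_sum_last cos0 mulr1.
  have -> : (fun w => head_indic X n B w * sin (tail_sum X n u w)) = (fun=> 0).
    by apply/funext => w; rewrite tail_sum_last sin0 mulr0.
  rewrite Ex_cst; split; last by rewrite mulr0.
  have mI (i : 'I_n) : measurable (X i @^-1` B i).
    by rewrite -[X in measurable X]setTI; exact: mX.
  rewrite (_ : head_indic X n B = \1_(\bigcap_(i in [set: 'I_n]) (X i @^-1` B i))); last first.
    by apply/funext => w; exact: head_indic_last.
  apply: EFin_inj; rewrite Ex_indic; last first.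
    by apply: fin_bigcap_measurable => //; exact: finite_finset.
  rewrite indX// /p (@big_mkcond _ _ _ _ _ (fun i : 'I_n => (i < n)%N)) -prodEFin.
  by apply: eq_bigr => i _; rewrite ltn_ord -Ex_indic.
have kn : (n - j.+1 < n)%N by rewrite ltn_subrL/= (leq_trans _ jn).
have [k kE] : exists k : 'I_n, nat_of_ord k = (n - j.+1)%N by exists (Ordinal kn).
have kS : (n - j)%N = k.+1 by rewrite kE -subSn.
rewrite -kE.
have {}ih := ih (ltnW jn); rewrite kS in ih.
have bh := @bdd_meas_head_indic X mX k B mB.
have bt := @measurable_tail_sum X mX k.+1 u.
(* The induction hypothesis with an arbitrary [C] in slot [k] says that the remaining factors, used
   as a weight on [X k], act like the constant [p B k * c]; [Ex_transfer] extends this from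
   indicators to [g]. *)
have key (T : R -> R) (c : R) (g : R -> R) :
    measurable_fun setT T -> (forall x, `|T x| <= 1) ->
    measurable_fun setT g -> (forall x, `|g x| <= 1) ->
    (forall B, (forall i, measurable (B i)) ->
      Ex P (fun w => head_indic X k.+1 B w * T (tail_sum X k.+1 u w)) = p B k.+1 * c) ->
    Ex P (fun w => head_indic X k B w * (T (tail_sum X k.+1 u w) * g (X k w))) =
      p B k * c * Ex P (fun w => g (X k w)).
  move=> mT T1 mg g1 HT.
  have bT : bdd_meas (fun w => T (tail_sum X k.+1 u w)).
    by apply: bdd_meas_comp => //; exists 1.
  rewrite -ExZ; last by apply: bdd_meas_comp => //; exists 1.
  under eq_fun do rewrite mulrA.
  apply: (@Ex_transfer _ _ _ P _ (fun=> p B k * c)) => //.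
  - exact: bdd_measM.
  - exact: bdd_meas_cst.
  - by exists 1.
  - move=> C mC.
    have := HT _ (measurable_set_upd k mB mC).
    rewrite ExZ; last exact: bdd_meas_indic_comp.
    rewrite [p _ k.+1]ltn_ord_split /=.
    have -> : \prod_(i < n | (i < k)%N) Ex P (fun w => \1_(set_upd B k C i) (X i w)) = p B k.
      apply: eq_bigr => i ik; rewrite /set_upd; case: eqP => // e.
      by move: ik; rewrite e ltnn.
    have -> : set_upd B k C k = C by rewrite /set_upd eqxx.
    move=> h.
    transitivity (Ex P (fun w => \1_C (X k w)) * p B k * c); last by ring.
    rewrite -h; congr Ex; apply/funext => w.
    by rewrite head_indicS head_indic_upd /set_upd eqxx; ring.
have mcos : measurable_fun setT (@cos R).
  by apply: continuous_measurable_fun; exact: continuous_cos.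
have msin : measurable_fun setT (@sin R).
  by apply: continuous_measurable_fun; exact: continuous_sin.
have c1 (x : R) : `|cos x| <= 1 by rewrite ler_norml cos_geN1 cos_le1.
have s1 (x : R) : `|sin x| <= 1 by rewrite ler_norml sin_geN1 sin_le1.
have muk : measurable_fun setT (fun x : R => u k * x).
  by apply: measurable_funM.
have mck := measurableT_comp mcos muk.
have msk := measurableT_comp msin muk.
have kcc := key _ _ _ mcos c1 mck (fun x => c1 _) (fun B mB => (ih B mB).1).
have kcs := key _ _ _ mcos c1 msk (fun x => s1 _) (fun B mB => (ih B mB).1).
have ksc := key _ _ _ msin s1 mck (fun x => c1 _) (fun B mB => (ih B mB).2).
have kss := key _ _ _ msin s1 msk (fun x => s1 _) (fun B mB => (ih B mB).2).
have bb (f g : R -> R) : measurable_fun setT f -> measurable_fun setT g ->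
    (forall x, `|f x| <= 1) -> (forall x, `|g x| <= 1) ->
  bdd_meas (fun w => head_indic X k B w * (f (tail_sum X k.+1 u w) * g (X k w))).
  move=> mf mg f1 g1; apply: bdd_measM => //; apply: bdd_measM.
    by apply: bdd_meas_comp => //; exists 1.
  by apply: bdd_meas_comp => //; exists 1.
have bcc := bb _ _ mcos mck c1 (fun x => c1 _).
have bcs := bb _ _ mcos msk c1 (fun x => s1 _).
have bsc := bb _ _ msin mck s1 (fun x => c1 _).
have bss := bb _ _ msin msk s1 (fun x => s1 _).
rewrite /A /D !leq_ord_split -/(A k.+1) -/(D k.+1).
split.
  transitivity (Ex P (fun w => head_indic X k B w * (cos (tail_sum X k.+1 u w) * cos (u k * X k w))
     - head_indic X k B w * (sin (tail_sum X k.+1 u w) * sin (u k * X k w)))).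
    by congr Ex; apply/funext => w; rewrite tail_sumS cosD; ring.
  rewrite (ExB P bcc bss) kcc kss [Ex P (fun w => (cos \o _) _)]hc.
  by rewrite [Ex P (fun w => (sin \o _) _)]hs /= expRD cosD; ring.
transitivity (Ex P (fun w => head_indic X k B w * (cos (tail_sum X k.+1 u w) * sin (u k * X k w))
   + head_indic X k B w * (sin (tail_sum X k.+1 u w) * cos (u k * X k w)))).
  by congr Ex; apply/funext => w; rewrite tail_sumS sinD; ring.
rewrite (ExD P bcs bsc) kcs ksc [Ex P (fun w => (cos \o _) _)]hc.
by rewrite [Ex P (fun w => (sin \o _) _)]hs /= expRD sinD; ring.
Qed.

(** The induction runs opposite to the one for independence: the first coordinates turn from
    trigonometric functions into indicators. [Ex_law_eq] does it with weight [head_indic] times the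
    cosine or sine of the remaining sum. *)
Lemma joint_law_unique (X Y : 'I_n -> Omega -> R) :
  (forall i, measurable_fun setT (X i)) -> (forall i, measurable_fun setT (Y i)) ->
  (forall u : 'I_n -> R,
    Ex P (fun w => cos (\sum_(i < n) u i * X i w)) =
    Ex P (fun w => cos (\sum_(i < n) u i * Y i w))) ->
  (forall u : 'I_n -> R,
    Ex P (fun w => sin (\sum_(i < n) u i * X i w)) =
    Ex P (fun w => sin (\sum_(i < n) u i * Y i w))) ->
  forall B : 'I_n -> set R, (forall i, measurable (B i)) ->
  P (\bigcap_(i in [set: 'I_n]) (X i @^-1` B i)) =
  P (\bigcap_(i in [set: 'I_n]) (Y i @^-1` B i)).
Proof.
move=> mX mY hc hs B mB.
suff H k : (k <= n)%N -> forall u,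
    Ex P (fun w => head_indic X k B w * cos (tail_sum X k u w)) =
      Ex P (fun w => head_indic Y k B w * cos (tail_sum Y k u w)) /\
    Ex P (fun w => head_indic X k B w * sin (tail_sum X k u w)) =
      Ex P (fun w => head_indic Y k B w * sin (tail_sum Y k u w)).
  have mcap (Z : 'I_n -> Omega -> R) : (forall i, measurable_fun setT (Z i)) ->
      measurable (\bigcap_(i in [set: 'I_n]) (Z i @^-1` B i)).
    move=> mZ; apply: fin_bigcap_measurable; first exact: finite_finset.
    by move=> i _; rewrite -[X in measurable X]setTI; exact: mZ.
  have [h _] := H n (leqnn _) (fun=> 0).
  have E (Z : 'I_n -> Omega -> R) : (fun w => head_indic Z n B w * cos (tail_sum Z n (fun=> 0) w)) =
      \1_(\bigcap_(i in [set: 'I_n]) (Z i @^-1` B i)).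
    by apply/funext => w; rewrite tail_sum_last cos0 mulr1 head_indic_last.
  rewrite !E in h.
  by rewrite -(Ex_indic P (mcap _ mX)) -(Ex_indic P (mcap _ mY)) h.
elim: k => [_ u|k ih kn u].
  have E (Z : 'I_n -> Omega -> R) (f : R -> R) :
     (fun w => head_indic Z 0 B w * f (tail_sum Z 0 u w)) =
     (fun w => f (\sum_(i < n) u i * Z i w)).
    by apply/funext => w; rewrite head_indic0 mul1r.
  by rewrite !E.
pose ko := Ordinal kn; rewrite -[k]/(nat_of_ord ko) in ih *.
have {}ih := ih (ltnW kn).
have bh (Z : 'I_n -> Omega -> R) : (forall i, measurable_fun setT (Z i)) ->
   bdd_meas (head_indic Z ko B) by move=> mZ; exact: bdd_meas_head_indic.
have bc (Z : 'I_n -> Omega -> R) v m : (forall i, measurable_fun setT (Z i)) ->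
   bdd_meas (fun w => cos (tail_sum Z m v w)).
  by move=> mZ; apply: bdd_meas_cos; exact: measurable_tail_sum.
have bs (Z : 'I_n -> Omega -> R) v m : (forall i, measurable_fun setT (Z i)) ->
   bdd_meas (fun w => sin (tail_sum Z m v w)).
  by move=> mZ; apply: bdd_meas_sin; exact: measurable_tail_sum.
(* Coefficients [x] and [- x] in slot [ko]: half sums and half differences of the two transforms
   separate the factors [cos (x * Z ko w)] and [sin (x * Z ko w)] from those of the tail. *)
pose v (x : R) i := if i == ko then x else u i.
have tv (Z : 'I_n -> Omega -> R) x w : tail_sum Z ko (v x) w = x * Z ko w + tail_sum Z ko.+1 u w.
  rewrite tail_sumS {1}/v eqxx; congr (_ + _); apply: eq_bigr => i ik.
  by rewrite /v; case: eqP ik => // ->; rewrite ltnn.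
have combine (Z : 'I_n -> Omega -> R) (f g : Omega -> R) (c d : R) (F : Omega -> R) :
    (forall i, measurable_fun setT (Z i)) -> bdd_meas f -> bdd_meas g ->
    (forall w, F w = c * f w + d * g w) ->
    Ex P (fun w => head_indic Z ko B w * F w) =
    c * Ex P (fun w => head_indic Z ko B w * f w) +
    d * Ex P (fun w => head_indic Z ko B w * g w).
  move=> mZ bf bg Fw.
  have b1 := bdd_measM (bh _ mZ) bf; have b2 := bdd_measM (bh _ mZ) bg.
  rewrite -!ExZ// -ExD; [|exact: bdd_measZ|exact: bdd_measZ].
  by congr Ex; apply/funext => w; rewrite Fw; ring.
have TC (Z : 'I_n -> Omega -> R) x : (forall i, measurable_fun setT (Z i)) ->
    Ex P (fun w => head_indic Z ko B w * (cos (tail_sum Z ko.+1 u w) * cos (x * Z ko w))) =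
    2^-1 * Ex P (fun w => head_indic Z ko B w * cos (tail_sum Z ko (v x) w)) +
    2^-1 * Ex P (fun w => head_indic Z ko B w * cos (tail_sum Z ko (v (- x)) w)).
  move=> mZ; apply: combine => //; [exact: bc|exact: bc|] => w.
  by rewrite !tv !mulNr ![cos (_ + tail_sum _ _ _ _)]cosD cosN sinN; field.
have TS (Z : 'I_n -> Omega -> R) x : (forall i, measurable_fun setT (Z i)) ->
    Ex P (fun w => head_indic Z ko B w * (cos (tail_sum Z ko.+1 u w) * sin (x * Z ko w))) =
    2^-1 * Ex P (fun w => head_indic Z ko B w * sin (tail_sum Z ko (v x) w)) +
    (- 2^-1) * Ex P (fun w => head_indic Z ko B w * sin (tail_sum Z ko (v (- x)) w)).
  move=> mZ; apply: combine => //; [exact: bs|exact: bs|] => w.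
  by rewrite !tv !mulNr ![sin (_ + tail_sum _ _ _ _)]sinD cosN sinN; field.
have SC (Z : 'I_n -> Omega -> R) x : (forall i, measurable_fun setT (Z i)) ->
    Ex P (fun w => head_indic Z ko B w * (sin (tail_sum Z ko.+1 u w) * cos (x * Z ko w))) =
    2^-1 * Ex P (fun w => head_indic Z ko B w * sin (tail_sum Z ko (v x) w)) +
    2^-1 * Ex P (fun w => head_indic Z ko B w * sin (tail_sum Z ko (v (- x)) w)).
  move=> mZ; apply: combine => //; [exact: bs|exact: bs|] => w.
  by rewrite !tv !mulNr ![sin (_ + tail_sum _ _ _ _)]sinD cosN sinN; field.
have SS (Z : 'I_n -> Omega -> R) x : (forall i, measurable_fun setT (Z i)) ->
    Ex P (fun w => head_indic Z ko B w * (sin (tail_sum Z ko.+1 u w) * sin (x * Z ko w))) =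
    (- 2^-1) * Ex P (fun w => head_indic Z ko B w * cos (tail_sum Z ko (v x) w)) +
    2^-1 * Ex P (fun w => head_indic Z ko B w * cos (tail_sum Z ko (v (- x)) w)).
  move=> mZ; apply: combine => //; [exact: bc|exact: bc|] => w.
  by rewrite !tv !mulNr ![cos (_ + tail_sum _ _ _ _)]cosD cosN sinN; field.
have ihc x := (ih (v x)).1; have ihs x := (ih (v x)).2.
have E (Z : 'I_n -> Omega -> R) (F : Omega -> R) :
    (fun w => head_indic Z ko.+1 B w * F w) =
    (fun w => head_indic Z ko B w * F w * \1_(B ko) (Z ko w)).
  by apply/funext => w; rewrite head_indicS; ring.
have A (Z : 'I_n -> Omega -> R) (F G : Omega -> R) :
  (fun w => head_indic Z ko B w * F w * G w) =
  (fun w => head_indic Z ko B w * (F w * G w)) by apply/funext => w; rewrite mulrA.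
rewrite !E; split.
  apply: Ex_law_eq => //.
  - by apply: bdd_measM; [exact: bh|exact: bc].
  - by apply: bdd_measM; [exact: bh|exact: bc].
  - by move=> x; rewrite !A (TC _ _ mX) (TC _ _ mY) !ihc.
  - by move=> x; rewrite !A (TS _ _ mX) (TS _ _ mY) !ihs.
apply: Ex_law_eq => //.
- by apply: bdd_measM; [exact: bh|exact: bs].
- by apply: bdd_measM; [exact: bh|exact: bs].
- by move=> x; rewrite !A (SC _ _ mX) (SC _ _ mY) !ihs.
- by move=> x; rewrite !A (SS _ _ mX) (SS _ _ mY) !ihc.
Qed.

End FiniteFamilies.

(** * Convergence in probability *)

Section TruncatedMean.
Context {R : realType} {dO : measure_display} {Omega : measurableType dO}.
Variable P : probability Omega R.
Implicit Types (X Y : Omega -> R).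
Local Notation leb := (@lebesgue_measure R).

(* The metric of convergence in probability. *)
Definition qnorm X : R := Ex P (fun w => Num.min 1 `|X w|).

Lemma bdd_meas_min1 X : measurable_fun setT X -> bdd_meas (fun w => Num.min 1 `|X w|).
Proof.
move=> mX; split.
  by apply: measurable_minr; [exact: measurable_cst|exact: measurableT_comp].
by exists 1 => w; rewrite ger0_norm ?ge_min ?lexx// le_min ler01 normr_ge0.
Qed.

Lemma qnorm_ge0 X : 0 <= qnorm X.
Proof. by apply: Ex_ge0 => w; rewrite le_min ler01 normr_ge0. Qed.

Lemma qnormD X Y : measurable_fun setT X -> measurable_fun setT Y ->
  qnorm (fun w => X w + Y w) <= qnorm X + qnorm Y.
Proof.
move=> mX mY; rewrite /qnorm -ExD; [|exact: bdd_meas_min1|exact: bdd_meas_min1].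
apply: le_Ex.
- by apply: bdd_meas_min1; apply: measurable_funD.
- by apply: bdd_measD; exact: bdd_meas_min1.
- move=> w; have := ler_normD (X w) (Y w).
  have := normr_ge0 (X w); have := normr_ge0 (Y w).
  rewrite /Num.min; case: ifP; case: ifP; case: ifP; lra.
Qed.

Lemma qnormN X : qnorm (fun w => - X w) = qnorm X.
Proof. by congr Ex; apply/funext => w; rewrite normrN. Qed.

Lemma qnormB X Y : measurable_fun setT X -> measurable_fun setT Y ->
  qnorm (fun w => X w - Y w) <= qnorm X + qnorm Y.
Proof.
move=> mX mY; rewrite -(qnormN Y); apply: qnormD => //.
exact: measurableT_comp.
Qed.

Lemma qnorm_eq0 X : measurable_fun setT X -> qnorm X = 0 ->
  {ae P, forall w, X w = 0}.
Proof.
move=> mX q0; have := Ex_eq0_ae (bdd_meas_min1 mX) _ q0.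
have h w : 0 <= Num.min 1 `|X w| by rewrite le_min ler01 normr_ge0.
move=> /(_ h); apply: filterS => w; rewrite /Num.min; case: ifP => _.
  by move/eqP; rewrite oner_eq0.
by move/eqP; rewrite normr_eq0 => /eqP.
Qed.

Lemma qnorm_ae X Y : measurable_fun setT X -> measurable_fun setT Y ->
  {ae P, forall w, X w = Y w} -> qnorm X = qnorm Y.
Proof.
move=> mX mY XY; apply: eq_Ex_ae; [exact: bdd_meas_min1|exact: bdd_meas_min1|].
by apply: filterS XY => w ->.
Qed.

Let mgt X (e : R) : measurable_fun setT X -> measurable [set w | e < `|X w|].
Proof.
move=> mX; have : measurable_fun setT (fun w => e < `|X w|).
  by apply: measurable_fun_ltr; [exact: measurable_cst|exact: measurableT_comp].
by move=> /(_ measurableT [set true] I); rewrite setTI.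
Qed.

Lemma prob_le_qnorm X (e : R) : measurable_fun setT X -> 0 < e ->
  (P [set w | (e < `|X w|)%R] <= (qnorm X / Num.min 1 e)%:E)%E.
Proof.
move=> mX e0.
have m0 : 0 < Num.min 1 e by rewrite lt_min ltr01.
rewrite -(Ex_indic P (mgt e mX)) lee_fin ler_pdivlMr// mulrC -ExZ.
  apply: le_Ex.
  - by apply: bdd_measZ; exact: bdd_meas_indic (mgt e mX).
  - exact: bdd_meas_min1.
  - move=> w; rewrite indic_pred; case: ltP => h; rewrite ?mulr1 ?mulr0.
      by rewrite le_min !ge_min lexx (ltW h) orbT.
    by rewrite le_min ler01 normr_ge0.
exact: bdd_meas_indic (mgt e mX).
Qed.

Lemma qnorm_le_prob X (e : R) : measurable_fun setT X -> 0 <= e ->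
  qnorm X <= e + fine (P [set w | e < `|X w|]).
Proof.
move=> mX e0.
rewrite -(Ex_indic P (mgt e mX))/= -{1}(Ex_cst P e) -ExD.
- apply: le_Ex; first exact: bdd_meas_min1.
    by apply: bdd_measD; [exact: bdd_meas_cst|exact: bdd_meas_indic (mgt e mX)].
  move=> w; rewrite indic_pred; case: ltP => h; rewrite ?addr0 ge_min.
    by rewrite lerDr e0.
  by rewrite h orbT.
- exact: bdd_meas_cst.
- exact: bdd_meas_indic (mgt e mX).
Qed.

Lemma cvg_prob_qnorm (Xn : nat -> Omega -> R) X :
  (forall n, measurable_fun setT (Xn n)) -> measurable_fun setT X ->
  cvg_prob P Xn X <-> qnorm (fun w => Xn n w - X w) @[n --> \oo] --> (0 : R).
Proof.
move=> mXn mX.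
have mD n : measurable_fun setT (fun w => Xn n w - X w) by exact: measurable_funB.
split=> [H|H e e0].
  apply/cvgr0Pnorm_le => e e0.
  have e2 : 0 < e / 2 by rewrite divr_gt0.
  have /fine_cvgP[_ /cvgr0Pnorm_le/(_ _ e2)] := H _ e2.
  apply: filterS => n; rewrite /= ger0_norm ?fine_ge0//= => hn.
  rewrite ger0_norm ?qnorm_ge0// (le_trans (qnorm_le_prob (mD n) (ltW e2)))//.
  by rewrite [leRHS](splitr e) lerD2l.
apply: (@squeeze_cvge _ _ _ _ (cst 0%E) _
  (fun n => (qnorm (fun w => Xn n w - X w) / Num.min 1 e)%:E)).
- by apply: nearW => n; rewrite measure_ge0 prob_le_qnorm.
- exact: cvg_cst.
- apply: cvg_EFin; first exact: nearW.
  by rewrite -[X in _ --> X](mul0r (Num.min 1 e)^-1); apply: cvgMl.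
Qed.

Lemma cos_sub_le (x y : R) : `|cos x - cos y| <= 2 * Num.min 1 `|x - y|.
Proof.
have h1 : `|cos x - cos y| <= 2.
  rewrite (le_trans (ler_normB _ _))// -[2]/(1 + 1) lerD// ler_norml.
    by rewrite cos_geN1 cos_le1.
  by rewrite cos_geN1 cos_le1.
have h2 : `|cos x - cos y| <= `|x - y|.
  wlog xy : x y {h1} / y < x.
    move=> W; have [xy|yx|->] := ltgtP x y; [|exact: W|by rewrite !subrr].
    by rewrite distrC (distrC x); exact: W.
  have [c _ ->] := @MVT R cos (fun c => - sin c) y x xy (fun c _ => is_derive_cos c)
    (continuous_subspaceT (@continuous_cos R)).
  by rewrite normrM normrN ler_piMl// ler_norml sin_geN1 sin_le1.
rewrite /Num.min; case: ifP => _; first by rewrite mulr1.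
by rewrite (le_trans h2)// ler_peMl// ler1n.
Qed.

Lemma sin_sub_le (x y : R) : `|sin x - sin y| <= 2 * Num.min 1 `|x - y|.
Proof.
have := cos_sub_le (x - pi / 2) (y - pi / 2).
rewrite !cosB !cos_pihalf !sin_pihalf !mulr0 !add0r !mulr1.
by rewrite (_ : x - pi / 2 - (y - pi / 2) = x - y)//; ring.
Qed.

Lemma cvg_Ex_cos (Xn : nat -> Omega -> R) X :
  (forall n, measurable_fun setT (Xn n)) -> measurable_fun setT X ->
  qnorm (fun w => Xn n w - X w) @[n --> \oo] --> (0 : R) ->
  Ex P (fun w => cos (Xn n w)) @[n --> \oo] --> Ex P (fun w => cos (X w)) /\
  Ex P (fun w => sin (Xn n w)) @[n --> \oo] --> Ex P (fun w => sin (X w)).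
Proof.
move=> mXn mX H.
have mD n : measurable_fun setT (fun w => Xn n w - X w) by exact: measurable_funB.
have H2 : 2 * qnorm (fun w => Xn n w - X w) @[n --> \oo] --> (0 : R).
  by rewrite -[X in _ --> X](mulr0 2); apply: cvgMr.
have sq (f : nat -> R) (l : R) : (forall n, `|f n - l| <= 2 * qnorm (fun w => Xn n w - X w)) ->
    f n @[n --> \oo] --> l.
  move=> fl; apply/subr_cvg0; apply/norm_cvg0P.
  apply: (@squeeze_cvgr _ _ _ _ (cst 0) (fun n => 2 * qnorm (fun w => Xn n w - X w))) => //.
    by apply: nearW => n; rewrite normr_ge0 fl.
  exact: cvg_cst.
split; apply: sq => n.
  have b1 := bdd_meas_cos (mXn n); have b2 := bdd_meas_cos mX.
  rewrite -(ExB P b1 b2) (le_trans (normr_Ex P (bdd_measB b1 b2)))//.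
  rewrite -ExZ; last exact: bdd_meas_min1.
  apply: le_Ex; first exact: bdd_meas_norm (bdd_measB b1 b2).
    by apply: bdd_measZ; exact: bdd_meas_min1.
  by move=> w; exact: cos_sub_le.
have b1 := bdd_meas_sin (mXn n); have b2 := bdd_meas_sin mX.
rewrite -(ExB P b1 b2) (le_trans (normr_Ex P (bdd_measB b1 b2)))//.
rewrite -ExZ; last exact: bdd_meas_min1.
apply: le_Ex; first exact: bdd_meas_norm (bdd_measB b1 b2).
  by apply: bdd_measZ; exact: bdd_meas_min1.
by move=> w; exact: sin_sub_le.
Qed.

Lemma measurable_Ex_cos X : measurable_fun setT X ->
  measurable_fun setT (fun u : R => Ex P (fun w => cos (u * X w))).
Proof.
move=> mX.
have mcos : measurable_fun setT (@cos R).
  by apply: continuous_measurable_fun; exact: continuous_cos.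
have bc (u : R) : bdd_meas (fun w => cos (u * X w)).
  by apply: bdd_meas_cos; exact: measurable_funM.
(* Adding 1 makes the integrand nonnegative, as Tonelli requires. *)
pose f (z : Omega * R) : \bar R := (1 + cos (z.2 * X z.1))%:E.
have mf : measurable_fun setT f.
  apply/measurable_EFinP; apply: measurable_funD => //.
  apply: (measurableT_comp mcos); apply: measurable_funM.
    exact: measurable_snd.
  exact: (measurableT_comp mX measurable_fst).
have f0 z : (0 <= f z)%E.
  by rewrite lee_fin; have := cos_geN1 (z.2 * X z.1); lra.
have mg := @measurable_fun_fubini_tonelli_G _ _ _ _ _ P f mf f0.
rewrite (_ : (fun u : R => _) = (fun u => fine (\int[P]_w f (w, u))%E - 1)).
  apply: measurable_funB => //.
  by apply: (measurableT_comp _ mg).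
apply/funext => u.
transitivity (Ex P (fun w => 1 + cos (u * X w)) - 1); last by [].
by rewrite (ExD P (bdd_meas_cst 1) (bc u)) Ex_cst; ring.
Qed.

(** [x ^+ 2 / (1 + x ^+ 2)] is 1 minus the Poisson kernel of width 1, an average of cosines with
    density [expR (- u)]. Cutting at [N] loses mass [expR (- N)] in the lower bound and a boundary
    term [2 * expR (- N)] in the upper one, whence the factor 3; [d] has no sign, whence [|d|]. *)
Lemma Ex_resolvent_ge X (N d : R) : measurable_fun setT X -> 0 < N ->
  (forall u, 0 <= u <= N -> 1 - d <= Ex P (fun w => cos (u * X w))) ->
  Ex P (fun w => (X w) ^+ 2 / (1 + (X w) ^+ 2)) <= `|d| + 3 * expR (- N).
Proof.
move=> mX N0 H.
pose K (y : R) := 1 / (1 ^+ 2 + y ^+ 2) +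
    expR (- (1 * N)) * ((y * sin (N * y) - 1 * cos (N * y)) / (1 ^+ 2 + y ^+ 2)).
have Dy y : 0 < (1 : R) ^+ 2 + y ^+ 2 by rewrite ltr_pwDl ?exprn_gt0 ?sqr_ge0.
have D1 y : 0 < 1 + y ^+ 2 :> R by have := Dy y; rewrite expr1n.
have mcos : measurable_fun setT (@cos R).
  by apply: continuous_measurable_fun; exact: continuous_cos.
have c1 (x : R) : `|cos x| <= 1 by rewrite ler_norml cos_geN1 cos_le1.
have en (v : R) : expR (- (1 * `|v|)) <= 1.
  by rewrite mul1r -[leRHS]expR0 ler_expR oppr_le0.
have mex : measurable_fun setT (@expR R).
  by apply: continuous_measurable_fun; exact: continuous_expR.
have eK : Ex P (fun w => 1 * K (X w)) =
    \int[leb]_(u in `[0, N]) Ex P (fun w => 1 * (expR (- (1 * `|u|)) * cos (u * X w))).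
  rewrite -(Ex_Rintegral_swap P (p := fun u x => expR (- (1 * `|u|)) * cos (u * x)) 0 N (M := 1))//.
  - congr Ex; apply/funext => w; apply: (congr1 (fun z => 1 * z)); rewrite /K -(@Rintegral_expR_cos R 1 (X w) N ltr01 N0).
    by apply: eq_Rintegral => u; rewrite inE/= in_itv/= => /andP[u0 _]; rewrite ger0_norm.
  - apply: measurable_funM.
      apply: (measurableT_comp mex).
      apply: measurableT_comp => //; apply: measurable_funM => //.
      by apply: measurableT_comp => //; exact: measurable_fst.
    apply: (measurableT_comp mcos).
    by apply: measurable_funM; [exact: measurable_fst | exact: measurable_snd].
  - move=> u x; rewrite normrM ger0_norm ?expR_ge0// -[leRHS]mul1r.
    rewrite ler_pM ?expR_ge0 ?en ?c1//.
  - exact: bdd_meas_cst.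
have fin : (leb `[0%R, N]%classic < +oo)%E.
  by have /= -> := lebesgue_measure_itv (Interval (BLeft 0) (BRight N)); case: ifP => _; rewrite ltry.
(* The left side is the same truncated integral for the constant [1 - d], written with [cos (u * 0)]
   so that the closed form applies. *)
have low : (1 - d) * (1 - expR (- N)) <= Ex P (fun w => 1 * K (X w)).
  have -> : (1 - d) * (1 - expR (- N)) =
      \int[leb]_(u in `[0, N]) ((1 - d) * (expR (- (1 * `|u|)) * cos (u * 0))).
    rewrite RintegralZl//.
      rewrite (_ : \int[leb]_(x in _) _ = \int[leb]_(u in `[0, N]) (expR (- (1 * u)) * cos (u * 0))).
        rewrite Rintegral_expR_cos// mulr0 cos0 sin0 !mul1r expr0n addr0 expr1n.
        by field.
      by apply: eq_Rintegral => u; rewrite inE/= in_itv/= => /andP[u0 _]; rewrite ger0_norm.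
    apply: measurable_bounded_integrable => //.
      apply: measurable_funTS; apply: measurable_funM.
        by apply: (measurableT_comp mex); apply: measurableT_comp => //; apply: measurable_funM.
      by apply: (measurableT_comp mcos); apply: measurable_funM.
    exists 1; split; [exact: num_real|] => x Mx u _ /=.
    apply: le_trans (ltW Mx); rewrite normrM ger0_norm ?expR_ge0// -[leRHS]mul1r.
    rewrite ler_pM ?expR_ge0 ?en ?c1//.
  have bc (u : R) : bdd_meas (fun w => cos (u * X w)).
    by apply: bdd_meas_cos; exact: measurable_funM.
  have e2 : \int[leb]_(u in `[0, N]) Ex P (fun w => 1 * (expR (- (1 * `|u|)) * cos (u * X w)))
     = \int[leb]_(u in `[0, N]) (expR (- (1 * `|u|)) * Ex P (fun w => cos (u * X w))).
    apply: eq_Rintegral => u _; rewrite -(ExZ P _ (bc u)).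
    by congr Ex; apply/funext => w; rewrite mul1r.
  rewrite eK e2; apply: le_Rintegral => //.
  - apply: measurable_bounded_integrable => //.
      apply: measurable_funTS; apply: measurable_funM => //; apply: measurable_funM.
        by apply: (measurableT_comp mex); apply: measurableT_comp => //; apply: measurable_funM.
      by apply: (measurableT_comp mcos); apply: measurable_funM.
    exists `|1 - d|; split; [exact: num_real|] => x Mx u _ /=.
    apply: le_trans (ltW Mx); rewrite normrM ler_piMr// normrM ger0_norm ?expR_ge0//.
    by rewrite -[leRHS]mul1r ler_pM ?expR_ge0 ?en ?c1.
  - apply: measurable_bounded_integrable => //.
      apply: measurable_funTS; apply: measurable_funM; last exact: measurable_Ex_cos.
      by apply: (measurableT_comp mex); apply: measurableT_comp => //; apply: measurable_funM.
    exists 1; split; [exact: num_real|] => x Mx u _ /=.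
    apply: le_trans (ltW Mx); rewrite normrM ger0_norm ?expR_ge0// -[leRHS]mul1r.
    rewrite ler_pM ?expR_ge0 ?en//.
    by apply: normr_Ex_le.
  - move=> u; rewrite /= in_itv/= => uN.
    rewrite mulr0 cos0 mulr1 mulrC ler_wpM2l ?expR_ge0//; exact: H.
have mK1 : measurable_fun setT (fun y : R => 1 / (1 + y ^+ 2)).
  apply: continuous_measurable_fun => y.
  apply: cvgM; first exact: cvg_cst.
  apply: cvgV; first by rewrite gt_eqF.
  by apply: cvgD; [exact: cvg_cst | apply: cvgM; exact: cvg_id].
have b1 : bdd_meas (fun w => 1 / (1 + X w ^+ 2)).
  split; first exact: (measurableT_comp mK1 mX).
  exists 1 => w; rewrite ger0_norm ?divr_ge0// ?(ltW (D1 _))// ler_pdivrMr// mul1r.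
  by rewrite lerDl sqr_ge0.
have up : Ex P (fun w => 1 * K (X w)) <= Ex P (fun w => 1 / (1 + X w ^+ 2) + 2 * expR (- N)).
  apply: le_Ex.
  - have mr : measurable_fun setT K.
      have cm : continuous (fun y : R => N * y).
        by move=> y; apply: cvgM; [exact: cvg_cst | exact: cvg_id].
      have cD : continuous (fun y : R => (1 ^+ 2 + y ^+ 2)^-1).
        move=> y; apply: cvgV; first by rewrite gt_eqF.
        by apply: cvgD; [exact: cvg_cst | apply: cvgM; exact: cvg_id].
      apply: continuous_measurable_fun => y.
      apply: cvgD; first by apply: cvgM; [exact: cvg_cst | exact: cD].
      apply: cvgM; first exact: cvg_cst.
      apply: cvgM; last exact: cD.
      apply: cvgB.
        apply: cvgM; first exact: cvg_id.
        by apply: continuous_comp; [exact: cm | exact: continuous_sin].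
      apply: cvgM; first exact: cvg_cst.
      by apply: continuous_comp; [exact: cm | exact: continuous_cos].
    apply: bdd_measZ; split; first exact: (measurableT_comp mr mX).
    exists (1 + 1 * (2 / 1)) => w; rewrite /K (le_trans (ler_normD _ _))// lerD//.
      rewrite ger0_norm ?divr_ge0// ?(ltW (Dy _))// ler_pdivrMr// mul1r.
      by rewrite expr1n lerDl sqr_ge0.
    rewrite normrM ler_pM ?normr_ge0//.
      by rewrite ger0_norm ?expR_ge0// mul1r -[leRHS]expR0 ler_expR oppr_le0 ltW.
    exact: poisson_kernel_bound.
  - by apply: bdd_measD => //; exact: bdd_meas_cst.
  - move=> w; rewrite mul1r /K expr1n lerD2l [leLHS]mulrC (mul1r N) ler_wpM2r ?expR_ge0//.
    have := @poisson_kernel_bound R 1 (X w) (N * X w) ltr01.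
    by rewrite expr1n invr1 mulr1; apply: le_trans; exact: ler_norm.
rewrite (ExD P b1 (bdd_meas_cst _)) Ex_cst in up.
have -> : Ex P (fun w => X w ^+ 2 / (1 + X w ^+ 2)) = 1 - Ex P (fun w => 1 / (1 + X w ^+ 2)).
  rewrite -{2}(Ex_cst P 1) -(ExB P (bdd_meas_cst _) b1); congr Ex; apply/funext => w.
  by field; rewrite gt_eqF.
have e0 := expR_ge0 (- N).
have e1 : expR (- N) <= 1 by rewrite -[leRHS]expR0 ler_expR oppr_le0 ltW.
have h1 : 0 <= (`|d| - d) * (1 - expR (- N)).
  by rewrite mulr_ge0 ?subr_ge0 ?ler_norm.
have h2 : 0 <= `|d| * expR (- N) by rewrite mulr_ge0.
have h3 := le_trans low up.
lra.
Qed.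

(** A quantitative form of Lévy's continuity theorem at the constant 0: only the real part of the
    characteristic function on a bounded range of frequencies is involved, uniformly over all
    variables. *)
Lemma qnorm_small_of_cf (e : R) : 0 < e -> exists N d : R, [/\ 0 < N, 0 < d &
  forall X, measurable_fun setT X ->
    (forall u, 0 <= u <= N -> 1 - d <= Ex P (fun w => cos (u * X w))) ->
    qnorm X <= e].
Proof.
move=> e0.
pose t := e / 2; have t0 : 0 < t by rewrite divr_gt0.
(* [c * (x ^+ 2 / (1 + x ^+ 2)) >= 1] as soon as [|x| > t], so [Num.min 1 |x|] is at most [t] plus
   this quantity. *)
pose c := 1 + (t ^+ 2)^-1.
have c0 : 0 < c by rewrite ltr_pwDl// invr_ge0 sqr_ge0.
(* Chosen so that [c * (d + 3 * d) = t], with [expR (- N) <= d]. *)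
pose d := t / (4 * c).
have d0 : 0 < d by rewrite divr_gt0// mulr_gt0.
have [N N0 hN] : exists2 N : R, 0 < N & expR (- N) <= d.
  have := @cvg_expR_decay R 1 ltr01; move/cvgr0Pnorm_le => /(_ _ d0)[n _ /(_ n.+1)].
  rewrite /= leqnSn => /(_ isT); rewrite ger0_norm ?expR_ge0// => h.
  by exists (1 * n.+1%:R); rewrite ?mul1r// -[n.+1%:R]mul1r.
exists N, d; split => // X mX H.
have h := Ex_resolvent_ge mX N0 H.
have D1 y : 0 < 1 + y ^+ 2 :> R by rewrite ltr_pwDl ?sqr_ge0.
have b2 : bdd_meas (fun w => X w ^+ 2 / (1 + X w ^+ 2)).
  split.
    have mK1 : measurable_fun setT (fun y : R => y ^+ 2 / (1 + y ^+ 2)).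
      apply: continuous_measurable_fun => y.
      apply: cvgM; first by apply: cvgM; exact: cvg_id.
      apply: cvgV; first by rewrite gt_eqF.
      by apply: cvgD; [exact: cvg_cst | apply: cvgM; exact: cvg_id].
    exact: (measurableT_comp mK1 mX).
  exists 1 => w; rewrite ger0_norm ?divr_ge0 ?sqr_ge0 ?(ltW (D1 _))// ler_pdivrMr// mul1r.
  by rewrite lerDr.
have le1 : qnorm X <= Ex P (fun w => t + c * (X w ^+ 2 / (1 + X w ^+ 2))).
  apply: le_Ex; first exact: bdd_meas_min1.
    by apply: bdd_measD; [exact: bdd_meas_cst|exact: bdd_measZ].
  move=> w; rewrite ge_min; have [Xt|tX] := leP `|X w| t; apply/orP; [right|left].
    rewrite (le_trans Xt)// lerDl mulr_ge0// ?(ltW c0)//.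
    by rewrite divr_ge0 ?sqr_ge0 ?(ltW (D1 _)).
  rewrite (le_trans (_ : 1 <= c * (X w ^+ 2 / (1 + X w ^+ 2))))//; last by rewrite lerDr ltW.
  rewrite mulrA ler_pdivlMr// mul1r.
  have x2 : t ^+ 2 <= X w ^+ 2.
    rewrite -(real_normK (num_real (X w))) ler_sqr ?nnegrE ?(ltW t0) ?(ltW tX)//.
  rewrite /c mulrDl mul1r addrC lerD2l mulrC ler_pdivlMr ?exprn_gt0//.
  by rewrite mul1r.
rewrite (le_trans le1)// (ExD P (bdd_meas_cst _) (bdd_measZ c b2)) Ex_cst (ExZ P c b2).
rewrite [leRHS](splitr e) lerD2l (le_trans (ler_wpM2l (ltW c0) h))//.
rewrite gtr0_norm// (le_trans (_ : _ <= c * (d + 3 * d)))//.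
  by rewrite ler_wpM2l ?(ltW c0)// lerD2l ler_wpM2l.
rewrite -/t (_ : c * _ = t)// /d; field.
by rewrite gt_eqF.
Qed.

End TruncatedMean.

(** Bounded sums force the terms to 0, so from some index on the truncation at 1 is inactive and the
    series converges absolutely. *)
Lemma cvg_series_min1 (R : realType) (d : nat -> R) (B : R) :
  (forall n, \sum_(0 <= k < n) Num.min 1 `|d k| <= B) -> cvgn (series d).
Proof.
move=> H.
have m0 k : 0 <= Num.min 1 `|d k| by rewrite le_min ler01 normr_ge0.
have cm : cvgn (series (fun k => Num.min 1 `|d k|)).
  apply: nondecreasing_is_cvgn.
    by apply/nondecreasing_seqP => n; rewrite /series/= big_nat_recr//= lerDl.
  by exists B => _ [n _ <-]; exact: H.
have [n0 _ hn0] : \forall k \near \oo, Num.min 1 `|d k| < 1.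
  have /cvgr0Pnorm_lt/(_ _ ltr01) := cvg_series_cvg_0 cm.
  by apply: filterS => k; rewrite ger0_norm.
have dm k : (n0 <= k)%N -> `|d k| <= Num.min 1 `|d k|.
  by move=> /hn0/=; rewrite /Num.min; case: ifP => //; rewrite ltxx.
apply: normed_cvg; rewrite /normed_series_of; apply: nondecreasing_is_cvgn.
  by apply/nondecreasing_seqP => n; rewrite /series/= big_nat_recr//= lerDl.
exists (\sum_(0 <= k < n0) `|d k| + B) => _ [n _ <-]; rewrite /series/=.
rewrite (le_trans _ (lerD (lexx _) (H n)))//.
elim: n => [|n ih]; first by rewrite !big_nil addr0 sumr_ge0.
rewrite big_nat_recr//= [in leRHS]big_nat_recr//= addrA.
have [n0n|nn0] := leqP n0 n; first by rewrite lerD// dm.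
rewrite (le_trans (_ : _ <= \sum_(0 <= k < n0) `|d k|))//; last first.
  by rewrite -addrA lerDl addr_ge0// sumr_ge0.
rewrite -big_nat_recr//= [leRHS](big_cat_nat (n := n.+1))//= lerDl.
exact: sumr_ge0.
Qed.

(** * Completeness for convergence in probability *)

Section Completeness.
Context {R : realType} {dO : measure_display} {Omega : measurableType dO}.
Variable P : probability Omega R.

(** The truncated increments have a sum of expectation at most 1, which is therefore almost surely
    finite, and the sequence converges wherever it is finite. *)
Lemma qnorm_series_cvg (X : nat -> Omega -> R) :
  (forall n, measurable_fun setT (X n)) ->
  (forall n, qnorm P (fun w => X n.+1 w - X n w) <= (2 ^ (n + 1))%:R^-1) ->
  exists Y : Omega -> R, measurable_fun setT Y /\
    qnorm P (fun w => X n w - Y w) @[n --> \oo] --> (0 : R).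
Proof.
move=> mX HX.
have mD n : measurable_fun setT (fun w => X n.+1 w - X n w) by exact: measurable_funB.
pose m k w := Num.min 1 `|X k.+1 w - X k w|.
have bm k : bdd_meas (m k) by exact: bdd_meas_min1.
have m0 k w : 0 <= m k w by rewrite le_min ler01 normr_ge0.
pose S w := (\sum_(0 <= k <oo) (m k w)%:E)%E.
have mS : measurable_fun setT S.
  apply: (@ge0_emeasurable_sum _ _ _ _ (fun k w => (m k w)%:E) xpredT).
    by move=> k w _ _; rewrite lee_fin.
  by move=> k _; apply/measurable_EFinP; case: (bm k).
have S0 w : (0 <= S w)%E by apply: nneseries_ge0 => k _ _; rewrite lee_fin.
have intS : (\int[P]_w S w < +oo)%E.
  have mm k : measurable_fun setT (fun w => (m k w)%:E).
    by apply/measurable_EFinP; case: (bm k).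
  rewrite (integral_nneseries P measurableT mm); last by move=> k w _; rewrite lee_fin.
  rewrite (@le_lt_trans _ _ (1 / 2 ^+ 0)%:E) ?ltry//.
  rewrite -(cvg_lim _ (@cvg_geometric_eseries_half R 1 0))//.
  apply: lee_nneseries => k _; first by rewrite -EFin_Ex// lee_fin Ex_ge0.
  by rewrite -EFin_Ex// lee_fin mul1r; exact: HX.
pose A := [set w | (S w < +oo)%E].
have mA : measurable A.
  by rewrite -[X in measurable X]setTI; exact: emeasurable_fun_infty_o.
have aeA : {ae P, forall w, A w}.
  have iS : P.-integrable setT S.
    apply/integrableP; split => //.
    by under eq_integral do rewrite gee0_abs//.
  have := integrable_ae measurableT iS; apply: filterS => w /(_ I).
  by rewrite ge0_fin_numE.
have cvA w : A w -> cvgn (X ^~ w).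
  move=> Aw.
  have cs : cvgn (series (fun k => X k.+1 w - X k w)).
    apply: (@cvg_series_min1 _ _ (fine (S w))) => n.
    rewrite -lee_fin fineK ?ge0_fin_numE// -sumEFin.
    by apply: nneseries_lim_ge => k _ _; rewrite lee_fin.
  have -> : X ^~ w = (fun n => X 0 w + series (fun k => X k.+1 w - X k w) n).
    by apply/funext => n; rewrite /series/= telescope_sumr//= addrC subrK.
  by apply: is_cvgD => //; exact: is_cvg_cst.
(* Killing the exceptional null set makes the sequence converge everywhere, so the limit is
   measurable. *)
pose Z n w := X n w * \1_A w.
have mZ n : measurable_fun setT (Z n) by apply: measurable_funM.
have cvZ w : cvgn (Z ^~ w).
  rewrite /Z indicE; case: (boolP (w \in A)) => [/set_mem/cvA cw|_].
    by apply: is_cvgM => //; exact: is_cvg_cst.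
  by under eq_fun do rewrite mulr0; exact: is_cvg_cst.
pose Y w := limn (Z ^~ w).
have mY : measurable_fun setT Y.
  by apply: (measurable_fun_cvg (h := Z)) => // w _; exact: cvZ.
exists Y; split => //.
have E n : qnorm P (fun w => X n w - Y w) = qnorm P (fun w => Z n w - Y w).
  apply: qnorm_ae; [exact: measurable_funB|exact: measurable_funB|].
  apply: filterS aeA => w Aw; congr (_ - _).
  by rewrite /Z indicE mem_set// mulr1.
have -> : (fun n => qnorm P (fun w => X n w - Y w)) =
    (fun n => Ex P (fun w => Num.min 1 `|Z n w - Y w|)) by apply/funext.
rewrite -[X in _ --> X](Ex_cst P 0).
apply: (cvg_Ex (M := 1)).
- by move=> n; have [] := bdd_meas_min1 (measurable_funB (mZ n) mY).
- exact: measurable_cst.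
- by move=> n w; rewrite ger0_norm ?ge_min ?lexx// le_min ler01 normr_ge0.
- move=> w; apply: (@squeeze_cvgr _ _ _ _ (cst 0) (fun n => `|Z n w - Y w|)).
  + by apply: nearW => n; rewrite le_min ler01 normr_ge0/= ge_min lexx orbT.
  + exact: cvg_cst.
  + by apply/norm_cvg0P/subr_cvg0; exact: cvZ.
Qed.

(** A subsequence [nk] with geometrically small increments converges, and the Cauchy property
    carries the limit over to the full sequence. *)
Lemma qnorm_complete (X : nat -> Omega -> R) :
  (forall n, measurable_fun setT (X n)) ->
  (forall e, 0 < e -> exists N, forall m n, (N <= m)%N -> (N <= n)%N ->
    qnorm P (fun w => X m w - X n w) <= e) ->
  exists Y : Omega -> R, measurable_fun setT Y /\
    qnorm P (fun w => X n w - Y w) @[n --> \oo] --> (0 : R).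
Proof.
move=> mX cX.
have p2 k : 0 < (2 ^ (k + 1))%:R^-1 :> R by rewrite invr_gt0 ltr0n expn_gt0.
have [N hN] := choice (fun k => cX _ (p2 k)).
pose nk := fix nk k := if k is k'.+1 then maxn (nk k').+1 (N k) else N 0%N.
have Nnk k : (N k <= nk k)%N by case: k => //= k; rewrite leq_maxr.
have nkS k : (nk k < nk k.+1)%N by rewrite /= leq_maxl.
have knk k : (k <= nk k)%N by elim: k => // k ih; exact: leq_ltn_trans ih (nkS k).
have [Y [mY cY]] := @qnorm_series_cvg (fun k => X (nk k)) (fun k => mX _)
  (fun k => hN k _ _ (leq_trans (Nnk k) (ltnW (nkS k))) (Nnk k)).
exists Y; split => //.
apply/cvgr0Pnorm_le => e e0.
have e2 : 0 < e / 2 by rewrite divr_gt0.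
have [M hM] := cX _ e2.
have nkM : exists2 k, (M <= nk k)%N & qnorm P (fun w => X (nk k) w - Y w) <= e / 2.
  have /cvgr0Pnorm_le/(_ _ e2)[k0 _ hk0] := cY.
  exists (maxn k0 M); first exact: leq_trans (leq_maxr _ _) (knk _).
  by have := hk0 (maxn k0 M) (leq_maxl _ _); rewrite /= ger0_norm ?qnorm_ge0.
have [k Mk hk] := nkM.
exists M => // n /= Mn; rewrite ger0_norm ?qnorm_ge0//.
have -> : (fun w => X n w - Y w) = (fun w => (X n w - X (nk k) w) + (X (nk k) w - Y w)).
  by apply/funext => w; rewrite addrA subrK.
rewrite (le_trans (qnormD P _ _))//; [exact: measurable_funB|exact: measurable_funB|].
by rewrite [leRHS](splitr e) lerD// hM.
Qed.

End Completeness.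

(** * Lebesgue measure on tuples *)

Section LebesgueTuple.
Context {R : realType}.
Local Notation leb := (@lebesgue_measure R).

Definition tcons n (z : measurableTypeR R * n.-tuple R) : n.+1.-tuple R := cons_tuple z.1 z.2.

Definition tuncons n (t : n.+1.-tuple R) : measurableTypeR R * n.-tuple R :=
  (thead t, [tuple of behead t]).

Lemma measurable_tcons n : measurable_fun setT (@tcons n).
Proof.
exact: (@measurable_cons _ _ (measurableTypeR R * n.-tuple R)%type R fst n snd).
Qed.

Lemma measurable_tuncons n : measurable_fun setT (@tuncons n).
Proof.
apply/measurable_fun_pair; last exact: measurable_behead.
exact: (@measurable_tnth _ _ _ ord0).
Qed.

Lemma tconsK n : cancel (@tcons n) (@tuncons n).
Proof.
move=> [x t]; rewrite /tcons /tuncons; congr pair; last exact: val_inj.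
Qed.

Section Step.
Variables (n : nat) (m : {sigma_finite_measure set (n.-tuple R) -> \bar R}).

(** Turns the iterated integral [iint] into the integral against a genuine measure, for which
    Tonelli and dominated convergence are available. Sigma-finiteness is carried along because the
    next product needs it. *)
Definition leb_step : set (n.+1.-tuple R) -> \bar R :=
  pushforward (leb \x m)%E (@tcons n).

HB.instance Definition _ := Measure.copy leb_step
  (measure_function_pushforward__canonical__measure_function_Measure
    (leb \x m)%E (@measurable_tcons n)).

Lemma sigma_finite_leb_step : sigma_finite setT leb_step.
Proof.
have /sigma_finiteP[F [TF ndF Foo]] := sigma_finiteT leb.
have /sigma_finiteP[G [TG ndG Goo]] := sigma_finiteT m.
(* Both exhausting sequences are nondecreasing, so a single index, the maximum of two, captures a
   point in both factors. *)
exists (fun k => @tuncons n @^-1` (F k `*` G k)).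
  apply/seteqP; split => // t _.
  have [i _ Fi] : (\bigcup_i F i) (tuncons t).1 by rewrite -TF.
  have [j _ Gj] : (\bigcup_i G i) (tuncons t).2 by rewrite -TG.
  exists (maxn i j) => //; split.
    by move: Fi; apply/subsetPset/ndF/leq_maxl.
  by move: Gj; apply/subsetPset/ndG/leq_maxr.
move=> k; have [mFk Fk] := Foo k; have [mGk Gk] := Goo k.
have mFG : measurable (F k `*` G k) by exact: measurableX.
split.
  by rewrite -[X in measurable X]setTI; exact: measurable_tuncons.
rewrite /leb_step /pushforward -comp_preimage.
have -> : @tuncons n \o @tcons n = id by apply/funext => z; exact: tconsK.
by rewrite preimage_id product_measure1E// lte_mul_pinfty// ge0_fin_numE.
Qed.

HB.instance Definition _ := Measure_isSigmaFinite.Build _ _ _ leb_step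
  sigma_finite_leb_step.

Lemma integral_leb_step (f : n.+1.-tuple R -> \bar R) :
  measurable_fun setT f -> (forall t, 0 <= f t)%E ->
  (\int[leb_step]_t f t =
    \int[leb]_x \int[m]_t f (tcons (x, t)))%E.
Proof.
move=> mf f0.
have h := ge0_integral_pushforward (@measurable_tcons n) (leb \x m)%E measurableT mf (fun y _ => f0 y).
apply: etrans h _; rewrite preimage_setT.
apply: (fubini_tonelli1 (f \o @tcons n)).
  exact: (measurableT_comp mf (@measurable_tcons n)).
by move=> z; exact: f0.
Qed.

End Step.

Fixpoint leb_tuple (n : nat) : {sigma_finite_measure set (n.-tuple R) -> \bar R} :=
  match n return {sigma_finite_measure set (n.-tuple R) -> \bar R} with
  | 0%N => \d_([tuple] : 0.-tuple R)
  | k.+1 => leb_step (leb_tuple k)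
  end.

Lemma iint_integral n (f : n.-tuple R -> \bar R) :
  measurable_fun setT f -> (forall t, 0 <= f t)%E ->
  iint f = (\int[leb_tuple n]_t f t)%E.
Proof.
elim: n f => [|n ih] f mf f0 /=.
  by rewrite integral_dirac// diracT mul1e.
rewrite integral_leb_step//; apply: eq_integral => x _.
rewrite ih//.
apply: (measurableT_comp mf).
exact: (measurableT_comp (@measurable_tcons n) (measurable_pair1 x)).
Qed.

(** The image of Lebesgue measure under the translation agrees with it on the intervals []a, b]],
    and these determine it. *)
Lemma lebesgue_measure_shift (c : R) (f : R -> \bar R) :
  measurable_fun setT f -> (forall x, 0 <= f x)%E ->
  (\int[leb]_x f (x + c)%R = \int[leb]_x f x)%E.
Proof.
move=> mf f0.
pose sh (x : measurableTypeR R) : measurableTypeR R := (x : R) + c.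
have ms : measurable_fun setT sh by exact: measurable_funD.
have := @ge0_integral_pushforward _ _ (measurableTypeR R) (measurableTypeR R) R
  _ ms leb setT f measurableT mf (fun y _ => f0 y).
rewrite preimage_setT => <-.
apply: eq_measure_integral => A mA _.
apply/esym; apply: (@lebesgue_measure_unique _
   (measure_function_pushforward__canonical__measure_function_Measure leb ms)) => // X [[a b] _ <-].
rewrite /= /pushforward.
have -> : sh @^-1` `]a, b] = [set` Interval (BRight (a - c)) (BRight (b - c))].
  by apply/seteqP; split => x /=; rewrite /sh !in_itv/= ltrBlDr lerBrDr.
rewrite !lebesgue_measure_itv/= !lte_fin ltrD2r; case: ifP => // _.
by congr EFin; ring.
Qed.

Definition tshift n (c t : n.-tuple R) : n.-tuple R :=
  [tuple tnth t i + tnth c i | i < n].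

Lemma measurable_tshift n (c : n.-tuple R) : measurable_fun setT (tshift c).
Proof.
apply/measurable_fun_tnthP => i.
rewrite (_ : _ \o _ = (fun t => tnth t i + tnth c i)).
  by apply: measurable_funD => //; exact: measurable_tnth.
by apply/funext => t /=; rewrite tnth_mktuple.
Qed.

Lemma tshift_cons n (x y : R) (c t : n.-tuple R) :
  tshift (cons_tuple y c) (cons_tuple x t) = cons_tuple (x + y) (tshift c t).
Proof.
apply: eq_from_tnth => i; rewrite tnth_mktuple.
case: (unliftP ord0 i) => [j ->|->].
  by rewrite !tnthS tnth_mktuple.
by rewrite !tnth0.
Qed.

Lemma iint_shift n (c : n.-tuple R) (f : n.-tuple R -> \bar R) :
  measurable_fun setT f -> (forall t, 0 <= f t)%E ->
  iint (fun t => f (tshift c t)) = iint f.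
Proof.
elim: n c f => [|n ih] c f mf f0 /=.
  by congr f; rewrite [tshift _ _]tuple0 [in RHS]tuple0.
have mc (x : R) : measurable_fun setT (fun t : n.-tuple R => f (cons_tuple x t)).
  apply: (measurableT_comp mf).
  exact: (measurableT_comp (@measurable_tcons n) (measurable_pair1 x)).
transitivity (\int[leb]_x iint (fun t => f (cons_tuple ((x : R) + thead c)%R t)))%E.
  apply: eq_integral => x _.
  have {1}-> : c = cons_tuple (thead c) [tuple of behead c].
    by rewrite {1}(tuple_eta c); exact: val_inj.
  under eq_fun do rewrite tshift_cons.
  by rewrite (ih _ (fun t => f (cons_tuple (x + thead c) t))).
apply: (@lebesgue_measure_shift (thead c) (fun x => iint (fun t => f (cons_tuple x t)))).
  rewrite (_ : (fun _ => _) = (fun x => \int[leb_tuple n]_t (f \o @tcons n) (x, t))%E).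
    apply: measurable_fun_fubini_tonelli_F; last by move=> z; exact: f0.
    exact: (measurableT_comp mf (@measurable_tcons n)).
  by apply/funext => x; rewrite iint_integral.
by move=> x; rewrite iint_integral//; exact: integral_ge0.
Qed.

Lemma iint_cube n (c : n.-tuple R) (r : R) : 0 < r ->
  iint (fun t : n.-tuple R => (\1_([set t | forall i, `|tnth t i - tnth c i| <= r]) t)%:E)
  = ((r *+ 2) ^+ n)%:E.
Proof.
move=> r0; elim: n c => [|n ih] c /=.
  by rewrite indicE mem_set// => -[].
transitivity (\int[leb]_x ((\1_(`[thead c - r, thead c + r]) x)%:E * ((r *+ 2) ^+ n)%:E))%E.
  apply: eq_integral => x _.
  rewrite -(ih [tuple of behead c]).
  have [xc|xc] := pselect (`|x - thead c| <= r).
    rewrite indicE mem_set ?mul1e; last first.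
      by rewrite /= in_itv/= -ler_distl.
    congr iint; apply/funext => t; congr (EFin _); rewrite !indicE; congr ((nat_of_bool _)%:R).
    apply/idP/idP => /set_mem h; apply/mem_set => i.
      by have := h (lift ord0 i); rewrite /= tnthS tnth_behead; congr (`|_ - tnth c _| <= _); apply/val_inj; rewrite /= inordK// ltnS.
    case: (unliftP ord0 i) => [j ->|->]; last by rewrite tnth0.
    rewrite tnthS; have := h j; rewrite tnth_behead; congr (`|_ - tnth c _| <= _).
    by apply/val_inj; rewrite /= inordK// ltnS.
  rewrite [X in (X%:E * _)%E](_ : _ = 0) ?mul0e; last first.
    by rewrite indicE memNset//= in_itv/= -ler_distl.
  rewrite (_ : (fun _ => _) = cst 0%E).
    by rewrite iint_integral//= integral0.
  apply/funext => t /=; rewrite indicE memNset// => h; apply: xc.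
  by have := h ord0; rewrite tnth0.
rewrite ge0_integralZr//; last 2 first.
  by apply/measurable_EFinP; exact: measurable_indic.
  by rewrite lee_fin exprn_ge0// mulrn_wge0// ltW.
rewrite integral_indic//= setIT.
have /= -> := lebesgue_measure_itv (Interval (BLeft (thead c - r)) (BRight (thead c + r))).
rewrite lte_fin ler_ltD ?gtrN// -EFinM; congr EFin; rewrite exprS.
by rewrite (_ : thead c + r - (thead c - r) = r *+ 2)//; ring.
Qed.

End LebesgueTuple.

(** * Borel sets and Lebesgue measure on row vectors *)

Section RowVectors.
Context {R : realType} {d : nat}.
Local Notation mu := (@leb_tuple R d).
Local Notation rv := (@rv_of_tuple R d).
Implicit Types (x y z : 'rV[R]_d) (A B : set 'rV[R]_d).

Definition tuple_of_rv x : d.-tuple R := [tuple x 0 i | i < d].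

Lemma rv_of_tupleE t i : rv t 0 i = tnth t i.
Proof. by rewrite mxE. Qed.

Lemma tuple_of_rvK : cancel tuple_of_rv rv.
Proof. by move=> x; apply/rowP => i; rewrite mxE tnth_mktuple. Qed.

Lemma measurable_coord i : measurable_fun setT (fun t => rv t 0 i).
Proof.
rewrite (_ : (fun t => _) = @tnth _ R ^~ i); first exact: measurable_tnth.
by apply/funext => t; rewrite rv_of_tupleE.
Qed.

Lemma rv_norm_le x (M : R) : 0 <= M -> (`|x| <= M <-> forall i, `|x 0 i| <= M).
Proof.
move=> M0; rewrite [`|x|]mx_normrE; split.
  by move=> /bigmax_leP[_ h] i; exact: (h (0, i)).
by move=> h; apply/bigmax_leP; split=> // -[i j] _ /=; rewrite (ord1 i).
Qed.

Lemma leb_int_integral (f : 'rV[R]_d -> \bar R) :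
  measurable_fun setT (f \o rv) -> (forall x, 0 <= f x)%E ->
  leb_int f = (\int[mu]_t f (rv t))%E.
Proof. by move=> mf f0; rewrite /leb_int iint_integral. Qed.

Lemma borel_setI A B : borel_set A -> borel_set B -> borel_set (A `&` B).
Proof. by move=> ? ?; exact: measurableI. Qed.

Lemma borel_setC A : borel_set A -> borel_set (~` A).
Proof. by move=> ?; exact: measurableC. Qed.

Lemma borel_setD A B : borel_set A -> borel_set B -> borel_set (A `\` B).
Proof. by move=> ? ?; exact: measurableD. Qed.

Lemma borel_bigcup (F : nat -> set 'rV[R]_d) :
  (forall k, borel_set (F k)) -> borel_set (\bigcup_k F k).
Proof.
by move=> mF; rewrite /borel_set preimage_bigcup; exact: bigcupT_measurable.
Qed.

Lemma borel_bigcap (F : nat -> set 'rV[R]_d) :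
  (forall k, borel_set (F k)) -> borel_set (\bigcap_k F k).
Proof.
by move=> mF; rewrite /borel_set preimage_bigcap; exact: bigcapT_measurable.
Qed.

Lemma borel_setT : borel_set [set: 'rV[R]_d].
Proof. by rewrite /borel_set preimage_setT. Qed.

Lemma borel_set0 : borel_set (set0 : set 'rV[R]_d).
Proof. by rewrite /borel_set preimage_set0. Qed.

Lemma borel_preimage (f : 'rV[R]_d -> R) (C : set R) :
  borel_fun f -> measurable C -> borel_set (f @^-1` C).
Proof.
by move=> mf mC; rewrite /borel_set -[X in measurable X]setTI; exact: mf.
Qed.

Lemma borel_indic A : borel_set A -> borel_fun (\1_A : 'rV[R]_d -> R).
Proof.
move=> mA; rewrite /borel_fun (_ : _ \o _ = \1_(rv @^-1` A)).
  exact: measurable_indic.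
by apply/funext => t; rewrite /= !indicE.
Qed.

Lemma lebdE A : borel_set A -> lebd A = mu (rv @^-1` A).
Proof.
move=> mA; rewrite /lebd leb_int_integral.
- rewrite (_ : (fun t => _) = (fun t => (\1_(rv @^-1` A) t)%:E)).
    by rewrite integral_indic// setIT.
  by apply/funext => t; rewrite !indicE.
- by apply/measurable_EFinP; exact: borel_indic.
- by move=> x; rewrite lee_fin.
Qed.

Definition cube (M : R) : set 'rV[R]_d := [set x | `|x| <= M].

Lemma borel_le (f : 'rV[R]_d -> R) (M : R) : borel_fun f -> borel_set [set x | f x <= M].
Proof.
move=> mf; rewrite (_ : mkset _ = f @^-1` [set` Interval -oo%O (BRight M)]).
  by apply: borel_preimage => //; exact: measurable_itv.
by apply/seteqP; split => x /=; rewrite in_itv.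
Qed.

Lemma borel_cube (M : R) : 0 <= M -> borel_set (cube M).
Proof.
move=> M0; rewrite (_ : cube M = \bigcap_(i in [set: 'I_d]) [set x | `|x 0 i| <= M]).
  rewrite /borel_set preimage_bigcap; apply: fin_bigcap_measurable.
    exact: finite_finset.
  move=> i _; apply: (@borel_le (fun x => `|x 0 i|)).
  apply: (measurableT_comp (f := @Num.norm _ R)) => //.
  exact: measurable_coord.
apply/seteqP; split => x /=.
  by move=> /(rv_norm_le _ M0) h i _; exact: h.
by move=> h; apply/(rv_norm_le _ M0) => i; exact: h.
Qed.

Lemma mu_cube (M : R) : 0 < M -> mu (rv @^-1` cube M) = ((M *+ 2) ^+ d)%:E.
Proof.
move=> M0; rewrite -(iint_cube [tuple 0 | _ < d] M0).
have E : (rv @^-1` cube M) = [set t : d.-tuple R | forall i, `|tnth t i - tnth [tuple 0 | _ < d] i| <= M].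
  apply/seteqP; split => t /=.
    by move=> /(rv_norm_le _ (ltW M0)) h i; have := h i; rewrite rv_of_tupleE tnth_mktuple subr0.
  move=> h; apply/(rv_norm_le _ (ltW M0)) => i; have := h i.
  by rewrite rv_of_tupleE tnth_mktuple subr0.
have mc : measurable (rv @^-1` cube M) by exact: (borel_cube (ltW M0)).
rewrite -E iint_integral.
- by rewrite integral_indic// setIT.
- by apply/measurable_EFinP; exact: measurable_indic.
- by move=> t; rewrite lee_fin.
Qed.

Lemma bdd_borel_cube (M : R) : 0 <= M -> bdd_borel (cube M).
Proof. by move=> M0; split; [exact: borel_cube | exists M]. Qed.

Lemma bdd_borel_sub A B : borel_set A -> bdd_borel B -> A `<=` B -> bdd_borel A.
Proof. by move=> mA [_ [M BM]] AB; split => //; exists M => x /AB /BM. Qed.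

Lemma bdd_borelI A B : borel_set A -> bdd_borel B -> bdd_borel (A `&` B).
Proof.
move=> mA bB; apply: (bdd_borel_sub _ bB); last exact: subIsetr.
by apply: borel_setI => //; case: bB.
Qed.

Lemma bdd_borel_in_cube A : bdd_borel A -> exists2 M, 0 < M & A `<=` cube M.
Proof.
move=> [_ [M AM]]; exists (`|M| + 1); first by rewrite ltr_wpDl.
by move=> x /AM h; rewrite /cube/= (le_trans h)// (le_trans (ler_norm M))// lerDl.
Qed.

Lemma bdd_borel_fin A : bdd_borel A -> (mu (rv @^-1` A) < +oo)%E.
Proof.
move=> bA; have [M M0 AM] := bdd_borel_in_cube bA.
rewrite (@le_lt_trans _ _ (mu (rv @^-1` cube M)))//; last by rewrite mu_cube// ltry.
apply: le_measure; rewrite ?inE.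
- by case: bA.
- exact: (borel_cube (ltW M0)).
- by move=> t; exact: AM.
Qed.

Definition tr (c : 'rV[R]_d) A : set 'rV[R]_d := [set x | A (x - c)].

Lemma rv_shift c t : rv (tshift (tuple_of_rv (- c)) t) = rv t - c.
Proof. by apply/rowP => i; rewrite !mxE tnth_mktuple tnth_mktuple !mxE. Qed.

Lemma borel_fun_shift (f : 'rV[R]_d -> R) c :
  borel_fun f -> borel_fun (fun x => f (x - c)).
Proof.
move=> mf; rewrite /borel_fun.
rewrite (_ : _ \o _ = (f \o rv) \o tshift (tuple_of_rv (- c))).
  exact: (measurableT_comp mf (@measurable_tshift R d _)).
by apply/funext => t; rewrite /= rv_shift.
Qed.

Lemma borel_tr c A : borel_set A -> borel_set (tr c A).
Proof.
move=> mA; rewrite /borel_set (_ : _ @^-1` _ = tshift (tuple_of_rv (- c)) @^-1` (rv @^-1` A)).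
  by rewrite -[X in measurable X]setTI; apply: measurable_tshift.
by apply/funext => t; rewrite /preimage /mkset rv_shift.
Qed.

Lemma bdd_borel_tr c A : bdd_borel A -> bdd_borel (tr c A).
Proof.
move=> [mA [M AM]]; split; first exact: borel_tr.
exists (M + `|c|) => x /AM h.
by rewrite -[x](subrK c) (le_trans (ler_normD _ _))// lerD2r.
Qed.

Lemma leb_int_shift (f : 'rV[R]_d -> \bar R) c :
  measurable_fun setT (f \o rv) -> (forall x, 0 <= f x)%E ->
  leb_int (fun x => f (x - c)) = leb_int f.
Proof.
move=> mf f0; rewrite /leb_int -(@iint_shift _ _ (tuple_of_rv (- c)) (f \o rv))//.
  by congr iint; apply/funext => t; rewrite /= rv_shift.
by move=> t; exact: f0.
Qed.

Lemma lebd_tr c A : borel_set A -> lebd (tr c A) = lebd A.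
Proof.
move=> mA; rewrite /lebd -[RHS](@leb_int_shift _ c).
- by congr leb_int; apply/funext => x; rewrite !indicE.
- by apply/measurable_EFinP; exact: borel_indic.
- by move=> x; rewrite lee_fin.
Qed.

Lemma borel_eball x r : borel_set (eball x r).
Proof.
have m : borel_fun (fun y : 'rV[R]_d => Num.sqrt (\sum_(i < d) (y 0 i - x 0 i) ^+ 2)).
  rewrite /borel_fun; apply: (measurableT_comp (f := @Num.sqrt R)).
    by apply: continuous_measurable_fun; exact: sqrt_continuous.
  rewrite (_ : (fun _ => _) = (fun t => \sum_(i < d) (rv t 0 i - x 0 i) ^+ 2))//.
  apply: measurable_sum => i; apply: measurable_funX; apply: measurable_funB => //.
  exact: measurable_coord.
rewrite (_ : eball x r = (fun y : 'rV[R]_d => Num.sqrt (\sum_(i < d) (y 0 i - x 0 i) ^+ 2))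
  @^-1` [set` Interval -oo%O (BLeft r)]).
  by apply: borel_preimage => //; exact: measurable_itv.
by apply/seteqP; split => y /=; rewrite in_itv.
Qed.

End RowVectors.

(** * Integrals of simple functions *)

Section Leaves.
Context {R : realType} {d : nat}.
Implicit Types (s : seq (R * set 'rV[R]_d)) (D : set 'rV[R]_d).
Local Notation x0 := ((0 : R), (set0 : set 'rV[R]_d)).

(** Unlike [simple_ok], this allows overlapping sets, so that sums and differences of simple
    functions are concatenations of lists. *)
Definition allb s := forall k, (k < size s)%N -> bdd_borel (nth x0 s k).2.

Definition pdisj s := forall k l, (k < size s)%N -> (l < size s)%N -> k <> l ->
  (nth x0 s k).2 `&` (nth x0 s l).2 = set0.

Lemma allb_cons p s : allb (p :: s) <-> bdd_borel p.2 /\ allb s.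
Proof.
split=> [h|[h1 h2] [|k] ks]; [split|by []|exact: h2].
  exact: (h 0%N).
by move=> k ks; exact: (h k.+1).
Qed.

Lemma allb_cat s1 s2 : allb (s1 ++ s2) <-> allb s1 /\ allb s2.
Proof.
elim: s1 => [|p s1 ih] /=; first by split=> // -[].
by rewrite !allb_cons ih; tauto.
Qed.

Lemma allb_map (f : R -> R) (g : set 'rV[R]_d -> set 'rV[R]_d) s :
  (forall A, bdd_borel A -> bdd_borel (g A)) -> allb s ->
  allb [seq (f p.1, g p.2) | p <- s].
Proof.
move=> hg; elim: s => [|p s ih] //= /allb_cons[bp bs].
by apply/allb_cons; split; [exact: hg|exact: ih].
Qed.

(* The binary tree of intersections of the sets in [s]: a disjoint family on
   which both [c + simple_eval s] and the integral become diagonal. *)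
Fixpoint leaves s D (c : R) : seq (R * set 'rV[R]_d) :=
  if s is p :: s' then leaves s' (D `&` p.2) (c + p.1) ++ leaves s' (D `\` p.2) c
  else [:: (c, D)].

Lemma allb_leaves s D c : allb s -> bdd_borel D -> allb (leaves s D c).
Proof.
elim: s D c => [|p s ih] D c /= hs bD; first by apply/allb_cons.
have [bp bs] := (allb_cons _ _).1 hs.
apply/allb_cat; split; apply: ih => //.
  by rewrite setIC; apply: bdd_borelI => //; case: bp.
by apply: (bdd_borel_sub _ bD); [apply: borel_setD; [case: bD|case: bp] | exact: subDsetl].
Qed.

Lemma leaves_sub s D c k : (k < size (leaves s D c))%N ->
  (nth x0 (leaves s D c) k).2 `<=` D.
Proof.
elim: s D c k => [|p s ih] D c k /=; first by rewrite ltnS leqn0 => /eqP ->.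
rewrite size_cat nth_cat => ks; case: ltnP => h.
  exact: subset_trans (ih _ _ _ h) (@subIsetl _ _ _).
apply: subset_trans (ih _ _ _ _) (@subDsetl _ _ _).
by rewrite ltn_subLR.
Qed.

Lemma pdisj_leaves s D c : pdisj (leaves s D c).
Proof.
elim: s D c => [|p s ih] D c /=.
  by move=> k l /=; rewrite !ltnS !leqn0 => /eqP -> /eqP ->.
have disj k l : (k < size (leaves s (D `&` p.2) (c + p.1)))%N ->
    (l < size (leaves s (D `\` p.2) c))%N ->
    (nth x0 (leaves s (D `&` p.2) (c + p.1)) k).2 `&`
    (nth x0 (leaves s (D `\` p.2) c) l).2 = set0.
  move=> kl ll; apply/seteqP; split => // x [/(leaves_sub kl)[_ px] /(leaves_sub ll)[_]].
  exact.
move=> k l; rewrite size_cat !nth_cat => ks ls kl.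
case: ltnP => hk; case: ltnP => hl.
- exact: ih.
- by apply: disj => //; rewrite ltn_subLR.
- by rewrite setIC; apply: disj => //; rewrite ltn_subLR.
- apply: ih; rewrite ?ltn_subLR// => e; apply: kl.
  by rewrite -(subnK hk) e subnK.
Qed.

(** Every point of [D] lies in exactly one leaf, whose value is [c + simple_eval s x]; hence any [F]
    can be applied leaf by leaf. This is what disjointness buys, and [K] is put in place of [F] to
    compute modulars. *)
Lemma sum_leaves (F : R -> R) s D c x :
  \sum_(p <- leaves s D c) F p.1 * \1_(p.2) x =
  \1_D x * F (c + simple_eval s x).
Proof.
elim: s D c => [|p s ih] D c /=.
  by rewrite big_seq1 /simple_eval big_nil addr0 mulrC.
rewrite big_cat/= !ih /simple_eval big_cons !indicE in_setI in_setD.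
case: (x \in D); last by rewrite /= !mul0r addr0.
case: (x \in p.2) => /=; rewrite ?mul0r ?mul1r ?addr0 ?add0r ?mulr0 ?mulr1.
  by rewrite addrA.
by rewrite add0r.
Qed.

Lemma simple_eval_cat s1 s2 x :
  simple_eval (s1 ++ s2) x = simple_eval s1 x + simple_eval s2 x.
Proof. by rewrite /simple_eval big_cat. Qed.

Definition lscale (u : R) s := [seq (u * p.1, p.2) | p <- s].

Lemma simple_eval_scale u s x : simple_eval (lscale u s) x = u * simple_eval s x.
Proof.
rewrite /simple_eval /lscale big_map mulr_sumr.
by apply: eq_bigr => p _; rewrite mulrA.
Qed.

Lemma allb_scale u s : allb s -> allb (lscale u s).
Proof. exact: (@allb_map (fun a => u * a) id). Qed.

Definition lrestr (A : set 'rV[R]_d) s := [seq (p.1, A `&` p.2) | p <- s].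

Lemma simple_eval_restr A s x : simple_eval (lrestr A s) x = \1_A x * simple_eval s x.
Proof.
rewrite /simple_eval /lrestr big_map mulr_sumr.
by apply: eq_bigr => p _; rewrite /= indicI /= mulrCA.
Qed.

Lemma allb_restr A s : borel_set A -> allb s -> allb (lrestr A s).
Proof. by move=> mA; apply: (@allb_map id) => B; exact: bdd_borelI. Qed.

Definition ltr (t : 'rV[R]_d) s := [seq (p.1, tr t p.2) | p <- s].

Lemma simple_eval_tr t s x : simple_eval (ltr t s) x = simple_eval s (x - t).
Proof.
rewrite /simple_eval /ltr big_map.
by apply: eq_bigr => p _; rewrite /= !indicE.
Qed.

Lemma allb_tr t s : allb s -> allb (ltr t s).
Proof. by apply: (@allb_map id) => B; exact: bdd_borel_tr. Qed.

Lemma leaves_tr t s D c : leaves (ltr t s) (tr t D) c = ltr t (leaves s D c).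
Proof.
elim: s D c => [|p s ih] D c //=.
by rewrite /ltr map_cat -!/(ltr _ _) -!ih.
Qed.

Lemma borel_simple_eval s : allb s -> borel_fun (simple_eval s).
Proof.
elim: s => [|p s ih] hs; rewrite /simple_eval /borel_fun.
  rewrite (_ : _ \o _ = cst 0); first exact: measurable_cst.
  by apply/funext => t; rewrite /= big_nil.
have [bp bs] := (allb_cons _ _).1 hs.
rewrite (_ : _ \o _ = (fun t => p.1 * \1_(p.2) (rv_of_tuple t) + simple_eval s (rv_of_tuple t))).
  apply: measurable_funD; last exact: ih.
  by apply: measurable_funM => //; apply: borel_indic; case: bp.
by apply/funext => t; rewrite /= big_cons.
Qed.

Lemma allb_in_cube s : allb s -> exists2 M, 0 < M &
  forall k, (k < size s)%N -> (nth x0 s k).2 `<=` cube M.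
Proof.
elim: s => [|p s ih] hs; first by exists 1.
have [bp /ih[M M0 hM]] := (allb_cons _ _).1 hs.
have [N N0 hN] := bdd_borel_in_cube bp.
exists (M + N); first by rewrite addr_gt0.
move=> [|k] ks x /= h; rewrite /cube/=.
  by have /= h' := hN _ h; rewrite (le_trans h')// lerDr ltW.
by have /= h' := hM _ ks _ h; rewrite (le_trans h')// lerDl ltW.
Qed.

Lemma simple_eval_out s (D : set 'rV[R]_d) x :
  (forall k, (k < size s)%N -> (nth x0 s k).2 `<=` D) -> ~ D x -> simple_eval s x = 0.
Proof.
move=> sD Dx; rewrite /simple_eval (big_nth x0) big_nat big1// => k /andP[_ ks].
by rewrite indicE memNset ?mulr0// => /(sD _ ks).
Qed.

End Leaves.

Lemma iint_ge0 (R : realType) (n : nat) (f : n.-tuple R -> \bar R) :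
  (forall t, 0 <= f t)%E -> (0 <= iint f)%E.
Proof.
elim: n f => [|n ih] f f0 /=; first exact: f0.
by apply: integral_ge0 => x _; apply: ih.
Qed.

Lemma fine_lebd_ge0 (R : realType) (d : nat) (A : set 'rV[R]_d) : 0 <= fine (lebd A).
Proof. by rewrite fine_ge0// iint_ge0// => t; rewrite lee_fin. Qed.

(** * The random measure on simple functions *)

Section Basis.
Context {R : realType} {d : nat} {dO : measure_display} {Omega : measurableType dO}.
Variables (P : probability Omega R) (L : set 'rV[R]_d -> Omega -> R).
Variables (psr psi : R -> R).
Local Notation mu := (@leb_tuple R d).
Local Notation rv := (@rv_of_tuple R d).
Local Notation x0 := ((0 : R), (set0 : set 'rV[R]_d)).
Implicit Types (s : seq (R * set 'rV[R]_d)) (A B D : set 'rV[R]_d).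

Hypothesis mL : forall A, bdd_borel A -> measurable_fun [set: Omega] (L A).
Hypothesis indL : forall (n : nat) (A : 'I_n -> set 'rV[R]_d),
  (forall i, bdd_borel (A i)) -> (forall i j, i != j -> A i `&` A j = set0) ->
  independent P (fun i => L (A i)).
Hypothesis addL : forall A : nat -> set 'rV[R]_d, (forall k, bdd_borel (A k)) ->
  trivIset [set: nat] A -> bdd_borel (\bigcup_k A k) ->
  {ae P, forall w, (fun N => \sum_(k < N) L (A k) w) @ \oo --> L (\bigcup_k A k) w}.
Hypothesis cfL : forall A, bdd_borel A -> forall u : R,
  (\int[P]_w (cos (u * L A w))%:E
     = (expR (fine (lebd A) * psr u) * cos (fine (lebd A) * psi u))%:E)%E /\
  (\int[P]_w (sin (u * L A w))%:E
     = (expR (fine (lebd A) * psr u) * sin (fine (lebd A) * psi u))%:E)%E.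

Definition Lint s (w : Omega) : R := \sum_(p <- s) p.1 * L p.2 w.

Lemma simple_int_restr s A : simple_int L s A = Lint (lrestr A s).
Proof. by apply/funext => w; rewrite /simple_int /Lint /lrestr big_map. Qed.

Lemma Lint_cat s1 s2 w : Lint (s1 ++ s2) w = Lint s1 w + Lint s2 w.
Proof. by rewrite /Lint big_cat. Qed.

Lemma Lint_scale u s w : Lint (lscale u s) w = u * Lint s w.
Proof.
rewrite /Lint /lscale big_map mulr_sumr.
by apply: eq_bigr => p _; rewrite mulrA.
Qed.

Lemma measurable_Lint s : allb s -> measurable_fun setT (Lint s).
Proof.
elim: s => [|p s ih] hs; rewrite /Lint.
  by under eq_fun do rewrite big_nil; exact: measurable_cst.
have [bp bs] := (allb_cons _ _).1 hs.
under eq_fun do rewrite big_cons.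
by apply: measurable_funD; [apply: measurable_funM => //; exact: mL|exact: ih].
Qed.

(** For a sequence of empty sets the partial sums are the multiples of [L set0 w]. They converge
    almost surely, so their constant increment tends to 0. *)
Lemma L_set0_ae : {ae P, forall w, L set0 w = 0}.
Proof.
have b0 : bdd_borel (set0 : set 'rV[R]_d).
  by split; [exact: borel_set0 | exists 0].
have bU : bdd_borel (\bigcup_(k in [set: nat]) (set0 : set 'rV[R]_d)) by rewrite bigcup0.
have tI : trivIset [set: nat] (fun=> set0 : set 'rV[R]_d) by move=> i j _ _ [x []].
have := @addL (fun=> set0) (fun=> b0) tI bU.
rewrite bigcup0//; apply: filterS => w h.
have h1 : \sum_(k < N.+1) L set0 w @[N --> \oo] --> L set0 w.
  by have := h; rewrite -cvg_shiftS.
have h2 : \sum_(k < N.+1) L set0 w - \sum_(k < N) L set0 w @[N --> \oo] --> (0 : R).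
  by rewrite -[X in _ --> X](subrr (L set0 w)); exact: cvgB.
apply: (eq_limits (cvg_cst (L set0 w)) h2) => n.
by rewrite big_ord_recr/= addrAC subrr add0r.
Qed.

Lemma L_add_ae A B : bdd_borel A -> bdd_borel B -> A `&` B = set0 ->
  {ae P, forall w, L (A `|` B) w = L A w + L B w}.
Proof.
move=> bA bB AB.
(* Finite additivity is countable additivity for a sequence padded with empty sets, on which [L]
   vanishes almost surely. *)
pose F k : set 'rV[R]_d := if k is 0%N then A else if k is 1%N then B else set0.
have bF k : bdd_borel (F k).
  case: k => [|[|k]] //=; split; [exact: borel_set0 | by exists 0].
have UF : \bigcup_k F k = A `|` B.
  apply/seteqP; split => [x [[|[|k]] _ //= h]|x [h|h]]; [by left|by right| |].
    by exists 0%N.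
  by exists 1%N.
have bU : bdd_borel (\bigcup_k F k).
  rewrite UF; have [[mA [M AM]] [mB [N BN]]] := (bA, bB); split.
    exact: measurableU.
  exists (Num.max M N) => x [/AM|/BN] h; rewrite le_max h ?orbT//.
have tF : trivIset setT F.
  have AB' x : A x -> B x -> False by move=> Ax Bx; have : (A `&` B) x by []; rewrite AB.
  by move=> [|[|i]] [|[|j]] _ _ [x []] //= h1 h2; case: (AB' x).
have := L_set0_ae; have := addL bF tF bU; rewrite UF; apply: filterS2 => w h h0.
have h2 : \sum_(k < N.+2) L (F k) w @[N --> \oo] --> L (A `|` B) w.
  by have := h; rewrite -cvg_shiftS -cvg_shiftS.
apply: (eq_limits h2) => [|n]; first exact: cvg_cst.
by rewrite 2!big_ord_recl/= big1 ?addr0.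
Qed.

Lemma Lint_split_ae A B s : borel_set A -> borel_set B -> A `&` B = set0 -> allb s ->
  {ae P, forall w, Lint (lrestr (A `|` B) s) w = Lint (lrestr A s) w + Lint (lrestr B s) w}.
Proof.
move=> mA mB AB; elim: s => [|p s ih] hs.
  by apply: aeW => w; rewrite /Lint !big_nil addr0.
have [bp bs] := (allb_cons _ _).1 hs.
have := ih bs.
have h : {ae P, forall w, L ((A `&` p.2) `|` (B `&` p.2)) w = L (A `&` p.2) w + L (B `&` p.2) w}.
  apply: L_add_ae; [exact: bdd_borelI|exact: bdd_borelI|].
  by rewrite setIACA AB set0I.
move: h; apply: filterS2 => w h1 h2.
rewrite /Lint /= !big_cons/= setIUl h1 -!/(Lint _ _) h2; ring.
Qed.

(** Every branching of the tree uses finite additivity once and discards one null set. There are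
    finitely many branchings, so the identity survives almost surely. *)
Lemma Lint_leaves_ae s D c : allb s -> bdd_borel D ->
  {ae P, forall w, Lint (leaves s D c) w = c * L D w + Lint (lrestr D s) w}.
Proof.
elim: s D c => [|p s ih] D c hs bD /=.
  by apply: aeW => w; rewrite /Lint big_seq1 big_nil addr0.
have [bp bs] := (allb_cons _ _).1 hs.
have mD : borel_set D by case: bD.
have mp : borel_set p.2 by case: bp.
have b1 : bdd_borel (D `&` p.2) by exact: bdd_borelI.
have b2 : bdd_borel (D `\` p.2).
  by apply: (bdd_borel_sub _ bD); [exact: borel_setD | exact: subDsetl].
have disj : (D `&` p.2) `&` (D `\` p.2) = set0.
  by apply/seteqP; split => // x [[_ h] [_]].
have U : (D `&` p.2) `|` (D `\` p.2) = D by rewrite setUIDK.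
have h1 := ih _ (c + p.1) bs b1.
have h2 := ih _ c bs b2.
have := L_add_ae b1 b2 disj; rewrite U => h3.
have := Lint_split_ae b1.1 b2.1 disj bs; rewrite U => h4.
apply: filterS2 (filterI h1 h2) (filterI h3 h4) => w [e1 e2] [e3 e4].
rewrite Lint_cat e1 e2 e3 [in RHS]/Lint /= big_cons/= -/(Lint _ _) e4; ring.
Qed.

Lemma Lint_leaves s D : allb s -> bdd_borel D ->
  (forall k, (k < size s)%N -> (nth x0 s k).2 `<=` D) ->
  {ae P, forall w, Lint s w = Lint (leaves s D 0) w}.
Proof.
move=> hs bD sD; have := Lint_leaves_ae 0 hs bD; apply: filterS => w ->.
rewrite mul0r add0r (_ : lrestr D s = s)//.
apply: (@eq_from_nth _ x0); rewrite size_map// => k ks.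
by rewrite (nth_map x0)// setIidr; [case: nth|exact: sD].
Qed.

Lemma Ex_Lint_disjoint l : allb l -> pdisj l ->
  Ex P (fun w => cos (Lint l w)) =
    expR (\sum_(p <- l) fine (lebd p.2) * psr p.1) *
    cos (\sum_(p <- l) fine (lebd p.2) * psi p.1) /\
  Ex P (fun w => sin (Lint l w)) =
    expR (\sum_(p <- l) fine (lebd p.2) * psr p.1) *
    sin (\sum_(p <- l) fine (lebd p.2) * psi p.1).
Proof.
move=> hl dl.
pose A (i : 'I_(size l)) := (nth x0 l i).2.
pose u (i : 'I_(size l)) := (nth x0 l i).1.
have bA i : bdd_borel (A i) by exact: hl.
have [h1 h2] := @independent_Ex_cos_sin _ _ _ P (size l) (fun i => L (A i)) u
  (fun i => fine (lebd (A i)) * psr (u i)) (fun i => fine (lebd (A i)) * psi (u i))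
  (fun i => mL (bA i))
  (indL bA (fun i j ij => dl i j (ltn_ord i) (ltn_ord j) (fun e => negP ij (introT eqP (val_inj e)))))
  (fun i => EFin_inj (etrans (EFin_Ex P (bdd_meas_cos (measurable_funM (measurable_cst _) (mL (bA i))))) (cfL (bA i) (u i)).1))
  (fun i => EFin_inj (etrans (EFin_Ex P (bdd_meas_sin (measurable_funM (measurable_cst _) (mL (bA i))))) (cfL (bA i) (u i)).2)).
have E w : Lint l w = \sum_(i < size l) u i * L (A i) w.
  by rewrite /Lint (big_nth x0) big_mkord.
rewrite !(big_nth x0) !big_mkord.
by under eq_fun do rewrite E; under [X in _ /\ Ex P X = _]eq_fun do rewrite E.
Qed.

Lemma Ex_Lint s D : allb s -> bdd_borel D ->
  (forall k, (k < size s)%N -> (nth x0 s k).2 `<=` D) ->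
  Ex P (fun w => cos (Lint s w)) =
    expR (\sum_(p <- leaves s D 0) fine (lebd p.2) * psr p.1) *
    cos (\sum_(p <- leaves s D 0) fine (lebd p.2) * psi p.1) /\
  Ex P (fun w => sin (Lint s w)) =
    expR (\sum_(p <- leaves s D 0) fine (lebd p.2) * psr p.1) *
    sin (\sum_(p <- leaves s D 0) fine (lebd p.2) * psi p.1).
Proof.
move=> hs bD sD.
have hl := allb_leaves (c := 0) hs bD.
have [<- <-] := Ex_Lint_disjoint hl (@pdisj_leaves _ _ s D 0).
have h := Lint_leaves hs bD sD.
have m1 := measurable_Lint hs; have m2 := measurable_Lint hl.
split.
  apply: eq_Ex_ae; [exact: bdd_meas_cos|exact: bdd_meas_cos|].
  by apply: filterS h => w ->.
apply: eq_Ex_ae; [exact: bdd_meas_sin|exact: bdd_meas_sin|].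
by apply: filterS h => w ->.
Qed.

(** The transforms depend on a list only through the values and volumes of its leaves. Translating
    the sets and the enclosing cube translates the leaves and changes neither. *)
Lemma Ex_Lint_tr s t : allb s ->
  Ex P (fun w => cos (Lint (ltr t s) w)) = Ex P (fun w => cos (Lint s w)) /\
  Ex P (fun w => sin (Lint (ltr t s) w)) = Ex P (fun w => sin (Lint s w)).
Proof.
move=> hs; have [M M0 sM] := allb_in_cube hs.
have bM := @bdd_borel_cube R d M (ltW M0).
have [-> ->] := Ex_Lint hs bM sM.
have sT k : (k < size (ltr t s))%N -> (nth x0 (ltr t s) k).2 `<=` tr t (cube M).
  rewrite size_map => ks; rewrite (nth_map x0)// => x /=.
  exact: (sM _ ks).
have [-> ->] := Ex_Lint (allb_tr (t := t) hs) (bdd_borel_tr t bM) sT.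
have hl := allb_leaves (c := 0) hs bM.
have E (f : R -> R) : \sum_(p <- leaves (ltr t s) (tr t (cube M)) 0) fine (lebd p.2) * f p.1 =
    \sum_(p <- leaves s (cube M) 0) fine (lebd p.2) * f p.1.
  rewrite leaves_tr /ltr big_map !(big_nth x0) big_nat [RHS]big_nat.
  apply: eq_bigr => k /andP[_ ks] /=; rewrite lebd_tr//.
  by case: (hl _ ks).
by rewrite !E.
Qed.

Section Modular.
Variables (K : R -> R) (C : R).
Hypothesis C0 : 0 < C.
Hypothesis K_0 : K 0 = 0.
Hypothesis K_mono : forall x y, `|x| <= `|y| -> K x <= K y.
Hypothesis mK : measurable_fun [set: R] K.
Hypothesis psr_le0 : forall z, psr z <= 0.
Hypothesis psr_le : forall z, `|psr z| <= C * K z.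
Hypothesis psi_le : forall z, `|psi z| <= C * K z.

(** An Orlicz-type modular in the spirit of Rajput and Rosiński, with the exponent replaced by a
    majorant [K] that is monotone in the absolute value. *)
Definition modular (f : 'rV[R]_d -> R) : \bar R := (\int[mu]_t (K (f (rv t)))%:E)%E.

Lemma K_ge0 x : 0 <= K x.
Proof. by rewrite -K_0; apply: K_mono; rewrite normr0. Qed.

Lemma measurable_K_comp (f : 'rV[R]_d -> R) : borel_fun f ->
  measurable_fun setT (fun t => (K (f (rv t)))%:E).
Proof. by move=> mf; apply/measurable_EFinP; exact: (measurableT_comp mK mf). Qed.

Lemma le_modular (f g : 'rV[R]_d -> R) : borel_fun f -> borel_fun g ->
  (forall x, `|f x| <= `|g x|) -> (modular f <= modular g)%E.
Proof.
move=> mf mg fg; apply: ge0_le_integral => //.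
- by move=> t _; rewrite lee_fin K_ge0.
- exact: measurable_K_comp.
- exact: measurable_K_comp.
- by move=> t _; rewrite lee_fin K_mono.
Qed.

Lemma integral_step (F : R -> R) l : (forall x, 0 <= F x) -> allb l ->
  (\int[mu]_t (\sum_(p <- l) F p.1 * \1_(p.2) (rv t))%:E =
   (\sum_(p <- l) fine (lebd p.2) * F p.1)%:E)%E.
Proof.
move=> F0; elim: l => [|p l ih] hl.
  by under eq_integral do rewrite big_nil; rewrite integral0 big_nil.
have [bp bs] := (allb_cons _ _).1 hl.
under eq_integral do rewrite big_cons EFinD.
have mi : measurable_fun setT (fun t => F p.1 * \1_(p.2) (rv t)).
  by apply: measurable_funM => //; apply: borel_indic; case: bp.
have ms : measurable_fun setT (fun t => \sum_(p <- l) F p.1 * \1_(p.2) (rv t)).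
  have bF : allb [seq (F p.1, p.2) | p <- l] by apply: (@allb_map _ _ F id).
  have := borel_simple_eval bF; rewrite /borel_fun /simple_eval.
  by under eq_fun do rewrite /comp big_map.
rewrite ge0_integralD//; last 4 first.
- by move=> t _; rewrite lee_fin mulr_ge0.
- by apply/measurable_EFinP.
- by move=> t _; rewrite lee_fin sumr_ge0// => q _; rewrite mulr_ge0.
- by apply/measurable_EFinP.
rewrite (ih bs) big_cons EFinD; congr (_ + _)%E.
under eq_integral do rewrite EFinM.
rewrite ge0_integralZl_EFin//; last first.
  by apply/measurable_EFinP; apply: borel_indic; case: bp.
rewrite lebdE; last by case: bp.
rewrite EFinM fineK; last by rewrite ge0_fin_numE ?bdd_borel_fin.
rewrite muleC; congr (_ * _)%E.
by rewrite -[in RHS](setIT (rv @^-1` p.2)) -integral_indic//; case: bp.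
Qed.

Lemma modular_leaves s D : allb s -> bdd_borel D ->
  (forall k, (k < size s)%N -> (nth x0 s k).2 `<=` D) ->
  modular (simple_eval s) = (\sum_(p <- leaves s D 0) fine (lebd p.2) * K p.1)%:E.
Proof.
move=> hs bD sD; rewrite -integral_step; [|exact: K_ge0|exact: allb_leaves].
apply: eq_integral => t _; rewrite sum_leaves add0r indicE.
case: (boolP (_ \in _)) => [_|/negP h]; first by rewrite mul1r.
rewrite (simple_eval_out sD) ?K_0 ?mulr0// => Dx; apply: h; exact/mem_set.
Qed.

(** With [a <= 0] and [b] the two parts of the exponent, [1 - expR a * cos b] is at most
    [(1 - expR a) + (1 - cos b)], hence at most [|a| + 2 * |b|]; both parts are bounded by [C] times
    the modular, which gives [3 * C]. *)
Lemma one_sub_Ex_cos_le s : allb s ->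
  ((1 - Ex P (fun w => cos (Lint s w)))%:E <= (3 * C)%:E * modular (simple_eval s))%E.
Proof.
move=> hs; have [M M0 sM] := allb_in_cube hs.
have bM := @bdd_borel_cube R d M (ltW M0).
rewrite (modular_leaves hs bM sM) (Ex_Lint hs bM sM).1 -EFinM lee_fin.
set a := \sum_(p <- _) _ * psr _; set b := \sum_(p <- _) _ * psi _.
set S := \sum_(p <- _) _ * K _.
have aS : `|a| <= C * S.
  rewrite /a /S mulr_sumr (le_trans (ler_norm_sum _ _ _))// ler_sum// => p _.
  by rewrite normrM ger0_norm ?fine_lebd_ge0// mulrCA ler_wpM2l// fine_lebd_ge0.
have bS : `|b| <= C * S.
  rewrite /b /S mulr_sumr (le_trans (ler_norm_sum _ _ _))// ler_sum// => p _.
  by rewrite normrM ger0_norm ?fine_lebd_ge0// mulrCA ler_wpM2l// fine_lebd_ge0.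
have a0 : a <= 0.
  by apply: sumr_le0 => p _; rewrite mulr_ge0_le0// fine_lebd_ge0.
have e1 : expR a <= 1 by rewrite -[leRHS]expR0 ler_expR.
have e2 : 1 + a <= expR a by exact: expR_ge1Dx.
have e0 : 0 <= expR a by exact: expR_ge0.
have c1 : `|cos b - cos 0| <= 2 * `|b|.
  rewrite (le_trans (cos_sub_le _ _))// ler_wpM2l// subr0 ge_min lexx orbT//.
rewrite cos0 ler_norml in c1; case/andP: c1 => c1 _.
have c2 : cos b <= 1 by exact: cos_le1.
rewrite ler0_norm// in aS.
have h : 0 <= (1 - expR a) * (1 - cos b) by rewrite mulr_ge0 ?subr_ge0.
lra.
Qed.

(** [U] is the frequency range of [qnorm_small_of_cf]: as [K] is monotone, the modular at frequency
    [U] controls those at all smaller frequencies. *)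
Lemma qnorm_small_of_modular (e : R) : 0 < e -> exists U dl : R, [/\ 0 < U, 0 < dl &
  forall s, allb s ->
    (modular (fun x => (U * simple_eval s x)%R) <= dl%:E)%E -> qnorm P (Lint s) <= e].
Proof.
move=> e0; have [N [dd [N0 dd0 H]]] := qnorm_small_of_cf P e0.
exists N, (dd / (3 * C)); split=> //; first by rewrite divr_gt0// mulr_gt0.
move=> s hs hm; apply: H; first exact: measurable_Lint.
move=> u /andP[u0 uN].
have hu := allb_scale (u := u) hs.
have -> : (fun w => cos (u * Lint s w)) = (fun w => cos (Lint (lscale u s) w)).
  by apply/funext => w; rewrite Lint_scale.
rewrite lerBlDl -lerBlDr -lee_fin.
apply: (le_trans (one_sub_Ex_cos_le hu)).
have C30 : 0 < 3 * C by rewrite mulr_gt0.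
rewrite (_ : dd%:E = (3 * C)%:E * (dd / (3 * C))%:E)%E; last first.
  by rewrite -EFinM; congr EFin; field; rewrite gt_eqF.
rewrite lee_pmul2l ?lte_fin//; apply: le_trans hm.
apply: le_modular.
- exact: borel_simple_eval.
- by apply: measurable_funM => //; exact: borel_simple_eval.
- move=> x; rewrite simple_eval_scale !normrM ler_wpM2r// !ger0_norm//.
  exact: le_trans uN.
Qed.

End Modular.

End Basis.

(** * Uniqueness of the stochastic integral *)

Section Uniqueness.
Context {R : realType} {d : nat} {dO : measure_display} {Omega : measurableType dO}.
Variables (P : probability Omega R) (L : set 'rV[R]_d -> Omega -> R).
Variable (K : R -> R).
Local Notation mu := (@leb_tuple R d).
Local Notation rv := (@rv_of_tuple R d).
Implicit Types (s : seq (R * set 'rV[R]_d)) (A B D : set 'rV[R]_d).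

Hypothesis mL : forall A, bdd_borel A -> measurable_fun [set: Omega] (L A).
Hypothesis K_0 : K 0 = 0.
Hypothesis K_mono : forall x y, `|x| <= `|y| -> K x <= K y.
Hypothesis mK : measurable_fun [set: R] K.
Hypothesis K_cvg0 : forall u : nat -> R, u n @[n --> \oo] --> (0 : R) ->
  K (u n) @[n --> \oo] --> (0 : R).
Hypothesis q_small : forall e : R, 0 < e -> exists U dl : R, [/\ 0 < U, 0 < dl &
  forall s, allb s ->
    (modular K (fun x : 'rV[R]_d => (U * simple_eval s x)%R) <= dl%:E)%E ->
    qnorm P (Lint L s) <= e].

Let K0 := K_ge0 K_0 K_mono.

Lemma modular_simple_fin s : allb s -> (modular K (simple_eval s) < +oo)%E.
Proof.
move=> hs; have [M M0 sM] := allb_in_cube hs.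
by rewrite (modular_leaves K_0 K_mono hs (bdd_borel_cube (ltW M0)) sM) ltry.
Qed.

Lemma modular_cvg0 (g : nat -> 'rV[R]_d -> R) (b : 'rV[R]_d -> R) :
  (forall n, borel_fun (g n)) -> borel_fun b -> (forall n x, `|g n x| <= `|b x|) ->
  (modular K b < +oo)%E ->
  {ae mu, forall t, g n (rv t) @[n --> \oo] --> (0 : R)} ->
  modular K (g n) @[n --> \oo] --> 0%E.
Proof.
move=> mg mb gb bfin g0.
have [|||||_ _ h] := @dominated_convergence _ _ _ mu setT measurableT
  (fun n t => (K (g n (rv t)))%:E) (cst 0%E) (fun t => (K (b (rv t)))%:E).
- by move=> n; exact: (measurable_K_comp mK (mg n)).
- exact: measurable_cst.
- apply: filterS g0 => t gt _; apply: cvg_EFin; first exact: nearW.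
  exact: K_cvg0.
- apply/integrableP; split; first exact: (measurable_K_comp mK mb).
  by under eq_integral do rewrite gee0_abs ?lee_fin ?K0//.
- by apply: aeW => t n _; rewrite gee0_abs lee_fin ?K0// K_mono.
by move: h; rewrite integral0.
Qed.

Lemma qnorm_Lint0 s : allb s -> (forall x, simple_eval s x = 0) -> qnorm P (Lint L s) = 0.
Proof.
move=> hs s0; apply/eqP; rewrite eq_le qnorm_ge0 andbT; apply/ler_addgt0Pl => e e0.
rewrite addr0; have [U [dl [_ dl0 h]]] := q_small e0; apply: h => //.
rewrite (_ : (fun x => _) = (fun=> 0)); last by apply/funext => x; rewrite s0 mulr0.
by rewrite /modular K_0 integral0 lee_fin ltW.
Qed.

(** The difference of the two lists evaluates to 0, so its modular vanishes and its integral is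
    smaller than every [e]. Representations of one simple function are thus interchangeable. *)
Lemma ae_Lint_eq s1 s2 : allb s1 -> allb s2 -> (forall x, simple_eval s1 x = simple_eval s2 x) ->
  {ae P, forall w, Lint L s1 w = Lint L s2 w}.
Proof.
move=> b1 b2 h.
have b2' := allb_scale (u := -1) b2.
have b := (allb_cat s1 (lscale (-1) s2)).2 (conj b1 b2').
have := qnorm_eq0 (measurable_Lint mL b) (qnorm_Lint0 b _).
have z x : simple_eval (s1 ++ lscale (-1) s2) x = 0.
  by rewrite simple_eval_cat simple_eval_scale h mulN1r subrr.
move=> /(_ z); apply: filterS => w; rewrite Lint_cat Lint_scale mulN1r.
by move/eqP; rewrite subr_eq0 => /eqP.
Qed.

(** The triangle inequality read both ways: the integral over [A] is also the one over the union
    minus the one over [B]. *)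
Lemma qnorm_restrU s A B : allb s -> borel_set A -> borel_set B -> A `&` B = set0 ->
  qnorm P (Lint L (lrestr (A `|` B) s)) <=
    qnorm P (Lint L (lrestr A s)) + qnorm P (Lint L (lrestr B s)) /\
  qnorm P (Lint L (lrestr A s)) <=
    qnorm P (Lint L (lrestr (A `|` B) s)) + qnorm P (Lint L (lrestr B s)).
Proof.
move=> hs mA mB AB.
have mU : borel_set (A `|` B) by exact: measurableU.
have hA := allb_restr mA hs; have hB := allb_restr mB hs; have hU := allb_restr mU hs.
have m1 := measurable_Lint mL hA; have m2 := measurable_Lint mL hB.
have m3 := measurable_Lint mL hU.
have e : {ae P, forall w, Lint L (lrestr (A `|` B) s) w = Lint L (lrestr A s) w + Lint L (lrestr B s) w}.
  have := ae_Lint_eq hU ((allb_cat _ _).2 (conj hA hB)) _.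
  have z x : simple_eval (lrestr (A `|` B) s) x = simple_eval (lrestr A s ++ lrestr B s) x.
    rewrite simple_eval_cat !simple_eval_restr -mulrDl; congr (_ * _).
    rewrite !indicE in_setU; case: (boolP (x \in A)) => [/set_mem xA|_] /=; last by rewrite add0r.
    by rewrite memNset ?addr0// => xB; have : (A `&` B) x by []; rewrite AB.
  by move=> /(_ z); apply: filterS => w ->; rewrite Lint_cat.
split.
  rewrite (qnorm_ae m3 (measurable_funD m1 m2) e).
  exact: qnormD.
have e' : {ae P, forall w, Lint L (lrestr A s) w = Lint L (lrestr (A `|` B) s) w - Lint L (lrestr B s) w}.
  by apply: filterS e => w ->; rewrite addrK.
rewrite (qnorm_ae m1 (measurable_funB m3 m2) e').
exact: qnormB.
Qed.

(* Sliding hump: the sets [E j] exhaust the space and [h n] tends to [0]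
   boundedly on each of them; if the integrals over the whole space did not
   vanish, infinitely many humps would live on disjoint shells
   [E (j k.+1) \ E (j k)], and the integral over the union of every other
   shell could not converge. *)
Lemma qnorm_Lint_cvg0 (h : nat -> seq (R * set 'rV[R]_d)) :
  (forall n, allb (h n)) ->
  {ae mu, forall t, simple_eval (h n) (rv t) @[n --> \oo] --> (0 : R)} ->
  (forall A, borel_set A -> exists Y : Omega -> R, measurable_fun setT Y /\
     qnorm P (fun w => Lint L (lrestr A (h n)) w - Y w) @[n --> \oo] --> (0 : R)) ->
  qnorm P (Lint L (h n)) @[n --> \oo] --> (0 : R).
Proof.
move=> bh h0 hY.
have mh n : borel_fun (simple_eval (h n)) by exact: borel_simple_eval.
(* On [E j] all the [h n] are bounded by [j] at once. A convergent real sequence is bounded, so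
   almost every point lies in some [E j]. *)
pose E j := cube j.+1%:R `&` \bigcap_n [set x : 'rV[R]_d | `|simple_eval (h n) x| <= j%:R].
have mE j : borel_set (E j).
  apply: borel_setI; first by apply: borel_cube.
  apply: borel_bigcap => n; apply: (@borel_le _ _ (fun x => `|simple_eval (h n) x|)).
  exact: (measurableT_comp (f := @Num.norm _ R) _ (mh n)).
have EE i j : (i <= j)%N -> E i `<=` E j.
  move=> ij x [xi hx]; split.
    by rewrite /cube /= (le_trans xi)// ler_nat.
  by move=> n _; rewrite /= (le_trans (hx n I))// ler_nat.
have aeE : {ae mu, forall t, exists j, E j (rv t)}.
  apply: filterS h0 => t ht.
  have [M [Mr hM]] := cvg_seq_bounded (cvgP _ ht).
  have hM' n : `|simple_eval (h n) (rv t)| <= M + 1 by apply: (hM (M + 1)) => //; rewrite ltrDl.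
  pose N := Num.max (M + 1) `|rv t|.
  have N0 : 0 <= N by rewrite le_max normr_ge0 orbT.
  have hN := truncnS_gt N.
  exists (Num.truncn N).+1; split.
    rewrite /cube /= (le_trans (_ : _ <= N)) ?le_max ?lexx ?orbT// (le_trans (ltW hN))// ler_nat leqW//.
  move=> n _; rewrite /= (le_trans (hM' n))// (le_trans _ (ltW hN))// le_max lexx//.
pose X n A := Lint L (lrestr A (h n)).
have mX n A : borel_set A -> measurable_fun setT (X n A).
  by move=> mA; apply: measurable_Lint => //; exact: allb_restr.
(* [j] fixed, [n] large: dominated convergence on [E j], with a multiple of the indicator of a cube
   as majorant. Monotonicity of [K] makes the estimate uniform over the Borel subsets of [E j]. *)
have F1 j (e : R) : 0 < e -> \forall n \near \oo, forall A, borel_set A -> A `<=` E j -> qnorm P (X n A) <= e.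
  move=> e0; have [U [dl [U0 dl0 hq]]] := q_small e0.
  pose g n x := U * simple_eval (lrestr (E j) (h n)) x.
  pose c := [:: (U * j%:R, cube j.+1%:R : set 'rV[R]_d)].
  have bc : allb c by apply/allb_cons; split => //; exact: bdd_borel_cube.
  have mg n : borel_fun (g n).
    by apply: measurable_funM => //; apply: borel_simple_eval; exact: allb_restr.
  have gb n x : `|g n x| <= `|simple_eval c x|.
    rewrite /g simple_eval_restr /simple_eval big_seq1/= !indicE.
    case: (boolP (x \in E j)) => [/set_mem[xj xh]|_]; last by rewrite mul0r mulr0 normr0.
    rewrite mem_set// mul1r mulr1 !normrM ler_wpM2l// [leRHS]ger0_norm//.
    exact: (xh n I).
  have := modular_cvg0 mg (borel_simple_eval bc) gb (modular_simple_fin bc) _.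
  have gz : {ae mu, forall t, g n (rv t) @[n --> \oo] --> (0 : R)}.
    apply: filterS h0 => t ht; rewrite -[X in _ --> X](mulr0 U); apply: cvgMr.
    have -> : (fun n => simple_eval (lrestr (E j) (h n)) (rv t)) =
        (fun n => \1_(E j) (rv t) * simple_eval (h n) (rv t)).
      by apply/funext => n; rewrite simple_eval_restr.
    by rewrite -[X in _ --> X](mulr0 (\1_(E j) (rv t))); apply: cvgMr.
  move=> /(_ gz)/fine_cvgP[gfin /cvgr0Pnorm_le/(_ _ dl0) hg].
  apply: filterS2 gfin hg => n nfin hn A mA AE.
  apply: hq; first exact: allb_restr.
  apply: (@le_trans _ _ (modular K (g n))).
    apply: (le_modular K_0 K_mono mK).
    - by apply: measurable_funM => //; apply: borel_simple_eval; exact: allb_restr.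
    - exact: mg.
    - move=> x; rewrite /g !simple_eval_restr !normrM ler_wpM2l// ler_wpM2r//.
      rewrite !indicE; case: (boolP (x \in A)) => [/set_mem/AE xE|_]; last by rewrite normr0.
      by rewrite (mem_set xE).
  rewrite -(fineK nfin) lee_fin; apply: le_trans hn.
  exact: ler_norm.
(* [n] fixed, [j] large: the modular of a single simple function is finite, and the complements of
   the [E j] shrink to a null set. *)
have F2 n (e : R) : 0 < e -> \forall j \near \oo, forall A, borel_set A -> A `&` E j = set0 -> qnorm P (X n A) <= e.
  move=> e0; have [U [dl [U0 dl0 hq]]] := q_small e0.
  pose g j x := U * simple_eval (lrestr (~` E j) (h n)) x.
  have mCE j : borel_set (~` E j) by exact: borel_setC.
  have mg j : borel_fun (g j).
    by apply: measurable_funM => //; apply: borel_simple_eval; exact: allb_restr.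
  have bU : allb (lscale U (h n)) by exact: allb_scale.
  have gb j x : `|g j x| <= `|simple_eval (lscale U (h n)) x|.
    rewrite /g simple_eval_restr simple_eval_scale !normrM ler_wpM2l//.
    by rewrite ler_piMl// indicE; case: (_ \in _); rewrite ?normr1 ?normr0.
  have := modular_cvg0 mg (borel_simple_eval bU) gb (modular_simple_fin bU) _.
  have gz : {ae mu, forall t, g j (rv t) @[j --> \oo] --> (0 : R)}.
    apply: filterS aeE => t [j0 Ej0]; apply: cvg_near_cst; exists j0 => // j /= j0j.
    rewrite /g simple_eval_restr indicE memNset ?mul0r ?mulr0//= => nE; apply: nE.
    exact: EE Ej0.
  move=> /(_ gz)/fine_cvgP[gfin /cvgr0Pnorm_le/(_ _ dl0) hg].
  apply: filterS2 gfin hg => j nfin hn A mA AE.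
  apply: hq; first exact: allb_restr.
  apply: (@le_trans _ _ (modular K (g j))).
    apply: (le_modular K_0 K_mono mK).
    - by apply: measurable_funM => //; apply: borel_simple_eval; exact: allb_restr.
    - exact: mg.
    - move=> x; rewrite /g !simple_eval_restr !normrM ler_wpM2l// ler_wpM2r//.
      rewrite !indicE; case: (boolP (x \in A)) => [/set_mem xA|_]; last by rewrite normr0.
      rewrite (_ : x \in ~` E j)//; apply/mem_set => xE.
      by have : (A `&` E j) x by []; rewrite AE.
  rewrite -(fineK nfin) lee_fin; apply: le_trans hn.
  exact: ler_norm.
have XT n : qnorm P (Lint L (h n)) = qnorm P (X n setT).
  apply: qnorm_ae; [exact: measurable_Lint|exact: mX borel_setT|].
  apply: ae_Lint_eq => //; first exact: allb_restr borel_setT _.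
  by move=> x; rewrite simple_eval_restr indicT mul1r.
apply/cvgr0Pnorm_le => eps eps0.
apply: contrapT => ncv.
have often N : exists2 n, (N <= n)%N & eps < qnorm P (X n setT).
  apply: contrapT => H; apply: ncv; exists N => // n /= Nn.
  rewrite ger0_norm ?qnorm_ge0// leNgt XT; apply/negP => hn; apply: H.
  by exists n.
(* The errors below add up to [8 * e]: four in [even_big], two in [odd_small], and two for the
   comparisons with [Y]. *)
pose e := eps / 10.
have e0 : 0 < e by rewrite divr_gt0.
(* Choose [p.1] late enough for the integral to be small inside [E j] though large in total, then
   [p.2] so that it is small outside [E p.2]: the hump lives on the shell in between. [j <= p.1]
   makes the chosen indices tend to infinity. *)
have step j : exists p : nat * nat, [/\ (j <= p.1)%N, (j < p.2)%N, eps < qnorm P (X p.1 setT),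
    forall A, borel_set A -> A `<=` E j -> qnorm P (X p.1 A) <= e &
    forall A, borel_set A -> A `&` E p.2 = set0 -> qnorm P (X p.1 A) <= e].
  have [N _ hN] := F1 j e e0.
  have [n Nn hn] := often (maxn N j).
  have [J _ hJ] := F2 n e e0.
  exists (n, maxn J j.+1); split => //=.
  - by rewrite (leq_trans _ Nn)// leq_maxr.
  - by rewrite leq_maxr.
  - by apply: hN; rewrite /= (leq_trans _ Nn)// leq_maxl.
  - by apply: hJ; rewrite /= leq_maxl.
have [f hf] := choice step.
pose js k := iter k (fun j => (f j).2) 0%N.
pose nk k := (f (js k)).1.
have jsS k : (js k < js k.+1)%N by have [] := hf (js k).
have js_mono i k : (i <= k)%N -> (js i <= js k)%N.
  by elim: k => [|k ih]; [rewrite leqn0 => /eqP ->|rewrite leq_eqVlt => /predU1P[->//|/ih h1];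
     exact: leq_trans h1 (ltnW (jsS k))].
have kjs k : (k <= js k)%N by elim: k => // k ih; exact: leq_ltn_trans ih (jsS k).
have knk k : (k <= nk k)%N by apply: leq_trans (kjs k) _; have [] := hf (js k).
pose Dk k := E (js k.+1) `\` E (js k).
have mDk k : borel_set (Dk k) by exact: borel_setD.
(* The even shells only. Along [nk] the integrals over [A] are large at even [k] and small at odd
   [k], so they have no limit. *)
pose A := \bigcup_k Dk k.*2.
have mA : borel_set A by apply: borel_bigcup.
have mAE k : borel_set (A `&` E (js k)) by exact: borel_setI.
have mAN k : borel_set (A `\` E (js k.+1)) by exact: borel_setD.
have small k : qnorm P (X (nk k) (A `\` Dk k)) <= e + e.
  have U : A `\` Dk k = (A `&` E (js k)) `|` (A `\` E (js k.+1)).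
    apply/seteqP; split => x.
      move=> [Ax nD]; have [xE|xE] := pselect (E (js k) x); [by left|right; split => //].
      by move=> xE'; apply: nD.
    move=> [[Ax xE]|[Ax xE]]; split => //.
      by move=> [_]; apply.
    by move=> [].
  have disj : (A `&` E (js k)) `&` (A `\` E (js k.+1)) = set0.
    by apply/seteqP; split => // x [[_ h1] [_]]; apply; exact: EE (ltnW (jsS k)) _ h1.
  rewrite U; apply: le_trans (qnorm_restrU (bh _) (mAE k) (mAN k) disj).1 _.
  have [_ _ _ s1 s2] := hf (js k).
  apply: lerD; [apply: s1 => //; exact: subIsetr|apply: s2 => //].
  by apply/seteqP; split => // x [[_ h1]].
have [Y [mY cY]] := hY A mA.
have [M _ hM] : \forall n \near \oo, qnorm P (fun w => X n A w - Y w) <= e.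
  move/cvgr0Pnorm_le : cY => /(_ _ e0); apply: filterS => n.
  by rewrite ger0_norm ?qnorm_ge0.
have qY k : (M <= k)%N -> qnorm P (X (nk k) A) <= qnorm P Y + e /\ qnorm P Y <= qnorm P (X (nk k) A) + e.
  move=> Mk; have hk := hM (nk k) (leq_trans Mk (knk k)).
  have mXA := mX (nk k) A mA; have mB := measurable_funB mXA mY.
  split.
    have -> : X (nk k) A = (fun w => Y w + (X (nk k) A w - Y w)).
      by apply/funext => w; rewrite addrC subrK.
    by apply: le_trans (qnormD P mY mB) _; rewrite lerD2l.
  have -> : Y = (fun w => X (nk k) A w - (X (nk k) A w - Y w)).
    by apply/funext => w; rewrite opprB addrC subrK.
  by apply: le_trans (qnormB P mXA mB) _; rewrite lerD2l.
(* An odd shell is disjoint from [A], so removing it changes nothing and [small] bounds the whole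
   integral. *)
have odd_small : qnorm P (X (nk M.*2.+1) A) <= e + e.
  have := small M.*2.+1; rewrite (_ : A `\` Dk M.*2.+1 = A)//.
  apply/seteqP; split => x; first by case.
  move=> Ax; split => // -[x1 x2]; have [i _ [xi xi']] := Ax.
  have [iM|Mi] := leqP i.*2 M.*2.
    by apply: x2; apply: EE xi; apply: js_mono; rewrite ltnS.
  apply: xi'; apply: EE x1; apply: js_mono.
  by rewrite ltn_neqAle Mi andbT; apply/eqP => /(congr1 odd); rewrite /= !odd_double.
(* Two errors [e] separate the whole space from the shell [Dk k], and two more separate the shell
   from [A]. *)
have even_big : eps - 4 * e <= qnorm P (X (nk M.*2) A).
  set k := M.*2.
  have DA : Dk k `<=` A by move=> x xD; exists M.
  have mAD : borel_set (A `\` Dk k) by exact: borel_setD.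
  have d0 : Dk k `&` (A `\` Dk k) = set0 by apply/seteqP; split => // x [? []].
  have h1 := (qnorm_restrU (bh (nk k)) (mDk k) mAD d0).2.
  rewrite setDUK// -!/(X _ _) in h1.
  have [_ _ hT s1 s2] := hf (js k); rewrite -/(nk k) in hT s1 s2.
  have mCE : borel_set (~` E (js k.+1)) by exact: borel_setC.
  have U : E (js k) `|` Dk k = E (js k.+1).
    apply/seteqP; split => x; first by move=> [|[]//]; exact: EE (ltnW (jsS k)) x.
    by move=> xE; have [?|?] := pselect (E (js k) x); [left|right].
  have d1 : E (js k) `&` Dk k = set0 by apply/seteqP; split => // x [? []].
  have h2 := (qnorm_restrU (bh (nk k)) (mE (js k)) (mDk k) d1).1.
  have h3 := (qnorm_restrU (bh (nk k)) (mE (js k.+1)) mCE (setICr _)).1.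
  rewrite U in h2; rewrite setUCr in h3; rewrite -!/(X _ _) in h2 h3.
  have e1 := s1 _ (mE (js k)) (@subset_refl _ _).
  have e2 : qnorm P (X (nk k) (~` E (js k.+1))) <= e.
    by apply: s2 => //; rewrite setICl.
  have e3 := small k.
  lra.
have M2 : (M <= M.*2)%N by rewrite -addnn leq_addr.
have q1 := (qY M.*2 M2).1.
have q2 := (qY M.*2.+1 (leqW M2)).2.
rewrite /e in e0 odd_small even_big q1 q2 *; lra.
Qed.

End Uniqueness.

(** * Dominated approximation by simple functions *)

Section RoundToZero.
Context {R : realType}.

(* [Num.truncn] vanishes on negative reals, so [rz] rounds towards zero. *)
Definition rz (y : R) : R := (Num.truncn y)%:R - (Num.truncn (- y))%:R.

Lemma nondecreasing_measurable_fun (g : R -> R) : {homo g : x y / x <= y} ->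
  measurable_fun setT g.
Proof.
move=> hg; apply: (measurability _ (RGenOInfty.measurableE R)) => //.
move=> _ [_ [x ->] <-]; rewrite setTI; apply: is_interval_measurable.
move=> a b /=; rewrite !in_itv/= !andbT => xa xb c /andP[ac cb].
by rewrite in_itv/= andbT (lt_le_trans xa)// hg.
Qed.

Lemma measurable_rz : measurable_fun setT rz.
Proof.
have ht : {homo (fun y : R => (Num.truncn y)%:R : R) : x y / x <= y}.
  by move=> x y xy; rewrite ler_nat le_truncn.
have mt := nondecreasing_measurable_fun ht.
have mo : measurable_fun setT (fun y : R => - y) by exact: measurable_funN.
by apply: measurable_funB => //; exact: (measurableT_comp mt mo).
Qed.

Lemma rz_bounds (y : R) : `|rz y| <= `|y| /\ `|rz y - y| <= 1.
Proof.
rewrite /rz; have [y0|y0] := leP 0 y.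
  rewrite [Num.truncn (- y)](_ : _ = 0%N) ?subr0; last first.
    by apply/truncn0Pn; rewrite -ltNge; lra.
  have /andP[h1 h2] := truncn_itv y0.
  split; first by rewrite !ger0_norm.
  rewrite distrC ger0_norm ?subr_ge0//.
  by rewrite lerBlDr addrC natr1 ltW.
rewrite [Num.truncn y](_ : _ = 0%N) ?sub0r; last by apply/truncn0Pn; rewrite -ltNge; lra.
have y0' : 0 <= - y by rewrite oppr_ge0 ltW.
have /andP[h1 h2] := truncn_itv y0'.
split; first by rewrite normrN ger0_norm// ltr0_norm.
rewrite -opprD normrN ler_norml; apply/andP; split; first lra.
move: h2; rewrite -natr1; lra.
Qed.

Lemma rz_nat (y : R) (N : nat) : `|rz y| <= N%:R -> exists2 k, (k < N + N.+1)%N & rz y = k%:R - N%:R.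
Proof.
rewrite /rz => h; have [y0|y0] := leP 0 y.
  move: h; rewrite [Num.truncn (- y)](_ : _ = 0%N) ?subr0; last first.
    by apply/truncn0Pn; rewrite -ltNge; lra.
  rewrite ger0_norm// ler_nat => h; exists (Num.truncn y + N)%N.
    by rewrite addnC ltn_add2l ltnS.
  by rewrite natrD addrK.
move: h; rewrite [Num.truncn y](_ : _ = 0%N) ?sub0r; last by apply/truncn0Pn; rewrite -ltNge; lra.
rewrite normrN ger0_norm// ler_nat => h; exists (N - Num.truncn (- y))%N.
  by rewrite (leq_ltn_trans (leq_subr _ _))// ltn_addl.
by rewrite natrB// addrAC subrr add0r.
Qed.

End RoundToZero.

Section SimpleApprox.
Context {R : realType} {d : nat}.
Variable f : 'rV[R]_d -> R.
Hypothesis mf : borel_fun f.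
Local Notation x0 := ((0 : R), (set0 : set 'rV[R]_d)).

Definition approx_set (n k : nat) : set 'rV[R]_d :=
  cube n.+1%:R `&` [set x | rz (f x * n.+1%:R) = k%:R - (n.+1 ^ 2)%:R].

(** [f] is rounded towards zero to multiples of [n.+1%:R^-1] inside a cube; the multiples run from
    [- n.+1 ^ 2] to [n.+1 ^ 2], which explains the length of the list. Rounding towards zero makes
    [f] itself a majorant of all the approximations. *)
Definition simple_approx (n : nat) : seq (R * set 'rV[R]_d) :=
  [seq ((k%:R - (n.+1 ^ 2)%:R) / n.+1%:R, approx_set n k) | k <- iota 0 (n.+1 ^ 2 + (n.+1 ^ 2).+1)].

Lemma bdd_borel_approx_set n k : bdd_borel (approx_set n k).
Proof.
rewrite /approx_set setIC; apply: bdd_borelI; last exact: bdd_borel_cube.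
apply: (@borel_preimage _ _ (fun x => rz (f x * n.+1%:R)) [set (k%:R - (n.+1 ^ 2)%:R)]) => //.
apply: (measurableT_comp measurable_rz (f := rz) (g := fun t => f (rv_of_tuple t) * n.+1%:R)).
by apply: measurable_funM.
Qed.

Lemma nth_simple_approx n k : (k < n.+1 ^ 2 + (n.+1 ^ 2).+1)%N ->
  (nth x0 (simple_approx n) k).2 = approx_set n k.
Proof. by move=> kN; rewrite (nth_map 0%N) ?size_iota// nth_iota. Qed.

Lemma simple_approx_ok n : simple_ok (simple_approx n).
Proof.
rewrite /simple_ok size_map size_iota; split=> [k kN|k l /andP[kl lN]].
  by rewrite nth_simple_approx//; exact: bdd_borel_approx_set.
have kN := ltn_trans kl lN.
rewrite !nth_simple_approx//.
apply/seteqP; split => // x [[_ /= h1] [_ /= h2]].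
move: h2; rewrite h1 => /addIr/eqP; rewrite eqr_nat => /eqP e.
by move: kl; rewrite e ltnn.
Qed.

Lemma simple_approx_eval n x : simple_eval (simple_approx n) x =
  if (`|x| <= n.+1%:R) && (`|rz (f x * n.+1%:R)| <= (n.+1 ^ 2)%:R)
  then rz (f x * n.+1%:R) / n.+1%:R else 0.
Proof.
rewrite /simple_eval /simple_approx big_map; case: ifPn => [/andP[xn hr]|h].
  have [k kN rk] := rz_nat hr.
  rewrite (bigD1_seq k) ?iota_uniq ?mem_iota//= big1 ?addr0.
    by rewrite rk indicE mem_set ?mulr1.
  move=> l lk; rewrite indicE memNset ?mulr0// => -[_ /=].
  rewrite rk => /addIr/eqP; rewrite eqr_nat => /eqP e.
  by move: lk; rewrite e eqxx.
rewrite big_seq big1// => k; rewrite mem_iota add0n => /andP[_ kN].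
rewrite indicE memNset ?mulr0// => -[xn /= hr]; move/negP: h; apply.
apply/andP; split; [exact: xn|rewrite hr ler_norml].
have : k%:R <= (n.+1 ^ 2)%:R + (n.+1 ^ 2)%:R :> R.
  by rewrite -natrD ler_nat -ltnS -addnS.
have : 0 <= k%:R :> R by [].
move: (n.+1 ^ 2)%:R k%:R => a b; lra.
Qed.

Lemma simple_approx_le n x : `|simple_eval (simple_approx n) x| <= `|f x|.
Proof.
rewrite simple_approx_eval; case: ifP => _; last by rewrite normr0.
rewrite normrM normfV ler_pdivrMr ?normr_gt0// -normrM.
by have [] := rz_bounds (f x * n.+1%:R).
Qed.

Lemma simple_approx_cvg x : simple_eval (simple_approx n) x @[n --> \oo] --> f x.
Proof.
apply/subr_cvg0; apply/norm_cvg0P.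
pose M := Num.max `|x| `|f x|.
have cv : (n.+1%:R : R) @[n --> \oo] --> +oo.
  by have := @cvgr_idn R; rewrite -cvg_shiftS.
have hM : \forall n \near \oo, M <= n.+1%:R by have /cvgryPge := cv; apply.
apply: (@squeeze_cvgr _ _ _ _ (cst 0) (fun n => n.+1%:R^-1)).
- apply: filterS hM => n; rewrite ge_max => /andP[h1 h2].
  have m0 : 0 < n.+1%:R :> R by [].
  have [r1 r2] := rz_bounds (f x * n.+1%:R).
  have hr : `|rz (f x * n.+1%:R)| <= (n.+1 ^ 2)%:R.
    rewrite (le_trans r1)// normrM (gtr0_norm m0) natrX expr2.
    by rewrite ler_wpM2r// ltW.
  rewrite normr_ge0/= simple_approx_eval h1 hr/=.
  have -> : rz (f x * n.+1%:R) / n.+1%:R - f x =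
      (rz (f x * n.+1%:R) - f x * n.+1%:R) / n.+1%:R.
    by rewrite [RHS]mulrBl mulfK ?gt_eqF.
  by rewrite normrM normfV (gtr0_norm m0) ler_piMl// invr_ge0 ltW.
- exact: cvg_cst.
- exact: cvg_harmonic.
Qed.

End SimpleApprox.

(** * Algebra of limits in probability *)

Section QnormLimits.
Context {R : realType} {dO : measure_display} {Omega : measurableType dO}.
Variable P : probability Omega R.
Implicit Types (X Y : Omega -> R) (Xn Yn : nat -> Omega -> R).

Lemma qnormZ (c : R) X : measurable_fun setT X ->
  qnorm P (fun w => c * X w) <= (1 + `|c|) * qnorm P X.
Proof.
move=> mX; rewrite /qnorm -ExZ; last exact: bdd_meas_min1.
apply: le_Ex.
- by apply: bdd_meas_min1; exact: measurable_funM.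
- by apply: bdd_measZ; exact: bdd_meas_min1.
- move=> w; rewrite normrM; have c0 := normr_ge0 c; have x0 := normr_ge0 (X w).
  have h : 0 <= `|c| * `|X w| by rewrite mulr_ge0.
  rewrite {2}/Num.min; case: ifP => x1.
    by rewrite mulr1 ge_min lerDl c0.
  by rewrite mulrDl mul1r ge_min lerDr x0 orbT.
Qed.

Definition qcvg Xn X := qnorm P (fun w => Xn n w - X w) @[n --> \oo] --> (0 : R).

Lemma qcvgD Xn Yn X Y :
  (forall n, measurable_fun setT (Xn n)) -> (forall n, measurable_fun setT (Yn n)) ->
  measurable_fun setT X -> measurable_fun setT Y ->
  qcvg Xn X -> qcvg Yn Y -> qcvg (fun n w => Xn n w + Yn n w) (fun w => X w + Y w).
Proof.
move=> mXn mYn mX mY hX hY.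
apply: (@squeeze_cvgr _ _ _ _ (cst 0) (fun n => qnorm P (fun w => Xn n w - X w) + qnorm P (fun w => Yn n w - Y w))).
- apply: nearW => n; rewrite qnorm_ge0/=.
  rewrite (_ : (fun w => _) = (fun w => (Xn n w - X w) + (Yn n w - Y w))).
    by apply: qnormD; exact: measurable_funB.
  by apply/funext => w; ring.
- exact: cvg_cst.
- by rewrite -[X in _ --> X]addr0; exact: cvgD.
Qed.

Lemma qcvgZ c Xn X : (forall n, measurable_fun setT (Xn n)) -> measurable_fun setT X ->
  qcvg Xn X -> qcvg (fun n w => c * Xn n w) (fun w => c * X w).
Proof.
move=> mXn mX hX.
apply: (@squeeze_cvgr _ _ _ _ (cst 0) (fun n => (1 + `|c|) * qnorm P (fun w => Xn n w - X w))).
- apply: nearW => n; rewrite qnorm_ge0/=.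
  rewrite (_ : (fun w => _) = (fun w => c * (Xn n w - X w))).
    by apply: qnormZ; exact: measurable_funB.
  by apply/funext => w; ring.
- exact: cvg_cst.
- by rewrite -[X in _ --> X](mulr0 (1 + `|c|)); exact: cvgMr.
Qed.

Lemma qcvg_unique Xn X Y : (forall n, measurable_fun setT (Xn n)) ->
  measurable_fun setT X -> measurable_fun setT Y ->
  qcvg Xn X -> qcvg Xn Y -> {ae P, forall w, X w = Y w}.
Proof.
move=> mXn mX mY hX hY.
have mD : measurable_fun setT (fun w => X w - Y w) by exact: measurable_funB.
suff /(qnorm_eq0 mD) : qnorm P (fun w => X w - Y w) = 0.
  by apply: filterS => w /eqP; rewrite subr_eq0 => /eqP.
have h : qnorm P (fun w => Xn n w - X w) + qnorm P (fun w => Xn n w - Y w) @[n --> \oo] --> (0 : R).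
  by rewrite -[X in _ --> X]addr0; exact: cvgD.
apply/eqP; rewrite eq_le qnorm_ge0 andbT -(cvg_lim _ h)//.
apply: limr_ge; first by apply/cvg_ex; exists 0.
apply: nearW => n; rewrite addrC.
rewrite (_ : (fun w => X w - Y w) = (fun w => (Xn n w - Y w) - (Xn n w - X w))).
  by apply: qnormB; exact: measurable_funB.
by apply/funext => w; ring.
Qed.

End QnormLimits.

(** * Stochastic integrals of functions with finite modular *)

Section Integration.
Context {R : realType} {d : nat} {dO : measure_display} {Omega : measurableType dO}.
Variables (P : probability Omega R) (L : set 'rV[R]_d -> Omega -> R).
Variable (K : R -> R).
Local Notation mu := (@leb_tuple R d).
Local Notation rv := (@rv_of_tuple R d).
Implicit Types (s : seq (R * set 'rV[R]_d)) (A B D : set 'rV[R]_d) (f g : 'rV[R]_d -> R).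

Hypothesis mL : forall A, bdd_borel A -> measurable_fun [set: Omega] (L A).
Hypothesis K_0 : K 0 = 0.
Hypothesis K_mono : forall x y, `|x| <= `|y| -> K x <= K y.
Hypothesis mK : measurable_fun [set: R] K.
Hypothesis K_cvg0 : forall u : nat -> R, u n @[n --> \oo] --> (0 : R) ->
  K (u n) @[n --> \oo] --> (0 : R).
Hypothesis q_small : forall e : R, 0 < e -> exists U dl : R, [/\ 0 < U, 0 < dl &
  forall s, allb s ->
    (modular K (fun x : 'rV[R]_d => (U * simple_eval s x)%R) <= dl%:E)%E ->
    qnorm P (Lint L s) <= e].

(** Every dilation [c] is included because the factor [U] of [q_small] depends on the tolerance
    [e]. *)
Definition mod_integrable f := borel_fun f /\
  forall c : R, (modular K (fun x => (c * f x)%R) < +oo)%E.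

(** [RR_approx] freed from disjointness and expressed with [qcvg], so that approximations of
    different functions can be concatenated. *)
Definition lists_for f (fs : nat -> seq (R * set 'rV[R]_d)) :=
  [/\ forall k, allb (fs k),
      {ae mu, forall t, simple_eval (fs k) (rv t) @[k --> \oo] --> f (rv t)} &
      forall A, borel_set A -> exists Y : Omega -> R, measurable_fun setT Y /\
        qcvg P (fun k => Lint L (lrestr A (fs k))) Y].

Lemma Lint_restrT s : Lint L (lrestr setT s) = Lint L s.
Proof.
rewrite /lrestr (_ : map _ s = s)//; elim: s => //= p s ->.
by rewrite setTI; case: p.
Qed.

Lemma mLint_restr s A : allb s -> borel_set A -> measurable_fun setT (Lint L (lrestr A s)).
Proof. by move=> hs mA; apply: (measurable_Lint mL); exact: allb_restr. Qed.

Lemma RR_approx_lists f fs : RR_approx P L f fs -> lists_for f fs.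
Proof.
move=> [ok [[N [mN [N0 sN]]] cv]].
have bfs k : allb (fs k) by move=> i ik; exact: (ok k).1.
split => //.
- exists (rv @^-1` N); split => //; first by rewrite -lebdE.
  by move=> t /= h; apply: sN.
- move=> A mA; have [Y [mY hY]] := cv A mA; exists Y; split => //.
  have := (cvg_prob_qnorm P (fun k => mLint_restr (bfs k) mA) mY).1; apply.
  rewrite (_ : (fun k => Lint L (lrestr A (fs k))) = (fun k => simple_int L (fs k) A))//.
  by apply/funext => k; rewrite simple_int_restr.
Qed.

Lemma RR_integral_lists f X : RR_integral P L f X ->
  measurable_fun setT X /\ exists2 fs, lists_for f fs & qcvg P (fun k => Lint L (fs k)) X.
Proof.
move=> [mf [mX [fs [ap cX]]]]; have fl := RR_approx_lists ap.
split=> //; exists fs => //; have [bfs _ _] := fl.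
have := (cvg_prob_qnorm P (fun k => measurable_Lint mL (bfs k)) mX).1; apply.
rewrite (_ : (fun k => Lint L (fs k)) = (fun k => simple_int L (fs k) setT))//.
by apply/funext => k; rewrite simple_int_restr Lint_restrT.
Qed.

(** The combined lists [h k] tend to 0 almost everywhere and their integrals over every Borel set
    converge, so the sliding hump lemma makes their total integrals tend to 0. Linearity and
    independence of the approximating sequence are both instances. *)
Lemma lists_linear (f1 f2 f3 : 'rV[R]_d -> R) fs1 fs2 fs3 (X1 X2 X3 : Omega -> R) (a b : R) :
  (forall x, f1 x = a * f2 x + b * f3 x) ->
  lists_for f1 fs1 -> lists_for f2 fs2 -> lists_for f3 fs3 ->
  measurable_fun setT X1 -> measurable_fun setT X2 -> measurable_fun setT X3 ->
  qcvg P (fun k => Lint L (fs1 k)) X1 -> qcvg P (fun k => Lint L (fs2 k)) X2 ->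
  qcvg P (fun k => Lint L (fs3 k)) X3 ->
  {ae P, forall w, X1 w = a * X2 w + b * X3 w}.
Proof.
move=> ff [b1 c1 l1] [b2 c2 l2] [b3 c3 l3] m1 m2 m3 q1 q2 q3.
pose h k := fs1 k ++ (lscale (- a) (fs2 k) ++ lscale (- b) (fs3 k)).
have bh k : allb (h k).
  apply/allb_cat; split => //; apply/allb_cat; split; exact: allb_scale.
have hE k x : simple_eval (h k) x = simple_eval (fs1 k) x +
    (- a * simple_eval (fs2 k) x + - b * simple_eval (fs3 k) x).
  by rewrite !simple_eval_cat !simple_eval_scale.
have restr_cat A s1 s2 : lrestr A (s1 ++ s2) = lrestr A s1 ++ lrestr A s2.
  by rewrite /lrestr map_cat.
have restr_scale A c s : lrestr A (lscale c s) = lscale c (lrestr A s).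
  by rewrite /lrestr /lscale -!map_comp.
have h0 : {ae mu, forall t, simple_eval (h k) (rv t) @[k --> \oo] --> (0 : R)}.
  apply: filterS3 c1 c2 c3 => t h1 h2 h3.
  rewrite (_ : 0 = f1 (rv t) + (- a * f2 (rv t) + - b * f3 (rv t))); last by rewrite ff; ring.
  rewrite (_ : (fun k => simple_eval (h k) (rv t)) = (fun k => simple_eval (fs1 k) (rv t) +
    (- a * simple_eval (fs2 k) (rv t) + - b * simple_eval (fs3 k) (rv t)))).
    by apply: cvgD => //; apply: cvgD; apply: cvgMr.
  by apply/funext => k; rewrite hE.
have LhE A k : Lint L (lrestr A (h k)) = (fun w => Lint L (lrestr A (fs1 k)) w +
    (- a * Lint L (lrestr A (fs2 k)) w + - b * Lint L (lrestr A (fs3 k)) w)).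
  by apply/funext => w; rewrite !restr_cat !restr_scale !Lint_cat !Lint_scale.
have comb (U1 U2 U3 : nat -> Omega -> R) (Y1 Y2 Y3 : Omega -> R) :
    (forall k, measurable_fun setT (U1 k)) -> (forall k, measurable_fun setT (U2 k)) ->
    (forall k, measurable_fun setT (U3 k)) ->
    measurable_fun setT Y1 -> measurable_fun setT Y2 -> measurable_fun setT Y3 ->
    qcvg P U1 Y1 -> qcvg P U2 Y2 -> qcvg P U3 Y3 ->
    qcvg P (fun k w => U1 k w + (- a * U2 k w + - b * U3 k w))
           (fun w => Y1 w + (- a * Y2 w + - b * Y3 w)).
  move=> n1 n2 n3 k1 k2 k3 p1 p2 p3.
  have z2 := qcvgZ (- a) n2 k2 p2; have z3 := qcvgZ (- b) n3 k3 p3.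
  have nn2 k : measurable_fun setT (fun w => - a * U2 k w) by exact: measurable_funM.
  have nn3 k : measurable_fun setT (fun w => - b * U3 k w) by exact: measurable_funM.
  have kk2 : measurable_fun setT (fun w => - a * Y2 w) by exact: measurable_funM.
  have kk3 : measurable_fun setT (fun w => - b * Y3 w) by exact: measurable_funM.
  have z23 := qcvgD nn2 nn3 kk2 kk3 z2 z3.
  exact: (qcvgD n1 (fun k => measurable_funD (nn2 k) (nn3 k)) k1 (measurable_funD kk2 kk3) p1 z23).
have lim := qnorm_Lint_cvg0 mL K_0 K_mono mK K_cvg0 q_small bh h0 _.
have {}lim : qnorm P (Lint L (h k)) @[k --> \oo] --> (0 : R).
  apply: lim => A mA.
  have [Y1 [n1 p1]] := l1 A mA; have [Y2 [n2 p2]] := l2 A mA; have [Y3 [n3 p3]] := l3 A mA.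
  exists (fun w => Y1 w + (- a * Y2 w + - b * Y3 w)); split.
    by apply: measurable_funD => //; apply: measurable_funD; apply: measurable_funM.
  have c := comb _ _ _ _ _ _ (fun k => mLint_restr (b1 k) mA) (fun k => mLint_restr (b2 k) mA)
    (fun k => mLint_restr (b3 k) mA) n1 n2 n3 p1 p2 p3.
  rewrite -/(qcvg P (fun k => Lint L (lrestr A (h k))) _).
  rewrite (_ : (fun k => Lint L (lrestr A (h k))) = (fun k w => Lint L (lrestr A (fs1 k)) w +
    (- a * Lint L (lrestr A (fs2 k)) w + - b * Lint L (lrestr A (fs3 k)) w)))//.
  by apply/funext => k; exact: LhE.
have mh k := measurable_Lint mL (bh k).
have LhE' k : Lint L (h k) = (fun w => Lint L (fs1 k) w +
    (- a * Lint L (fs2 k) w + - b * Lint L (fs3 k) w)).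
  by apply/funext => w; rewrite !Lint_cat !Lint_scale.
have lim2 := comb _ _ _ _ _ _ (fun k => measurable_Lint mL (b1 k)) (fun k => measurable_Lint mL (b2 k))
    (fun k => measurable_Lint mL (b3 k)) m1 m2 m3 q1 q2 q3.
have mY : measurable_fun setT (fun w => X1 w + (- a * X2 w + - b * X3 w)).
  by apply: measurable_funD => //; apply: measurable_funD; apply: measurable_funM.
have lim3 : qcvg P (fun k => Lint L (h k)) (fun w => X1 w + (- a * X2 w + - b * X3 w)).
  rewrite (_ : (fun k => Lint L (h k)) = (fun k w => Lint L (fs1 k) w +
    (- a * Lint L (fs2 k) w + - b * Lint L (fs3 k) w)))//.
  by apply/funext => k; exact: LhE'.
have lim0 : qcvg P (fun k => Lint L (h k)) (fun=> 0).
  rewrite /qcvg; apply: cvg_trans lim; rewrite (_ : (fun k => _) = (fun k => qnorm P (Lint L (h k))))//.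
  by apply/funext => k; congr qnorm; apply/funext => w; rewrite subr0.
have := qcvg_unique mh mY (measurable_cst _) lim3 lim0.
apply: filterS => w h'; apply/eqP; rewrite -subr_eq0; apply/eqP; rewrite -[RHS]h'; ring.
Qed.

(** Dominated convergence makes the modular of the approximation error small, so the integrals over
    each Borel set are Cauchy, and completeness supplies the limit. *)
Lemma simple_approx_lists f : mod_integrable f -> lists_for f (simple_approx f).
Proof.
move=> [mf fin].
have bfs k : allb (simple_approx f k) by have [] := simple_approx_ok mf k.
split => //; first by apply: aeW => t; exact: simple_approx_cvg.
move=> A mA; apply: qnorm_complete; first by move=> n; exact: mLint_restr.
move=> e e0; have [U [dl [U0 dl0 hq]]] := q_small e0.
(* The factor 2 replaces subadditivity of [K]: [U * |p - q|] is at most the larger of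
   [2 * U * |p - f x|] and [2 * U * |q - f x|], and [K] of a maximum is at most the sum of the two
   values. *)
pose g k x := 2 * U * (simple_eval (simple_approx f k) x - f x).
have mg k : borel_fun (g k).
  apply: measurable_funM => //; apply: measurable_funB => //; exact: borel_simple_eval.
have mb : borel_fun (fun x => 4 * U * f x) by apply: measurable_funM.
have gb k x : `|g k x| <= `|4 * U * f x|.
  rewrite /g !normrM !normr_nat (gtr0_norm U0).
  have := simple_approx_le f k x; have := ler_normB (simple_eval (simple_approx f k) x) (f x).
  move=> h1 h2.
  have h3 : U * `|simple_eval (simple_approx f k) x - f x| <= U * (2 * `|f x|).
    by rewrite ler_wpM2l ?(ltW U0)//; lra.
  lra.
have := modular_cvg0 K_0 K_mono mK K_cvg0 mg mb gb (fin _) _.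
have gz : {ae mu, forall t, g k (rv t) @[k --> \oo] --> (0 : R)}.
  apply: aeW => t; rewrite -[X in _ --> X](mulr0 (2 * U)); apply: cvgMr.
  by apply/subr_cvg0; exact: simple_approx_cvg.
have dl2 : 0 < dl / 2 by rewrite divr_gt0.
move=> /(_ gz)/fine_cvgP[gfin /cvgr0Pnorm_le/(_ _ dl2) hg].
have [N _ hN] := filterI gfin hg.
exists N => m n Nm Nn.
have [fm hm] := hN m Nm; have [fn hn] := hN n Nn.
pose l := lrestr A (simple_approx f m) ++ lscale (-1) (lrestr A (simple_approx f n)).
have bl : allb l.
  by apply/allb_cat; split; [exact: allb_restr | apply: allb_scale; exact: allb_restr].
rewrite (_ : (fun w => _) = Lint L l); last first.
  by apply/funext => w; rewrite Lint_cat Lint_scale mulN1r.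
apply: hq => //.
have K0 := K_ge0 K_0 K_mono.
apply: (@le_trans _ _ (modular K (g m) + modular K (g n))%E).
  rewrite /modular -ge0_integralD//; last 4 first.
  - by move=> t _; rewrite lee_fin K0.
  - exact: (measurable_K_comp mK (mg m)).
  - by move=> t _; rewrite lee_fin K0.
  - exact: (measurable_K_comp mK (mg n)).
  apply: ge0_le_integral => //.
  - by move=> t _; rewrite lee_fin K0.
  - apply: (measurable_K_comp mK (f := fun x => U * simple_eval l x)).
    by apply: measurable_funM => //; exact: borel_simple_eval.
  - by apply: emeasurable_funD; exact: (measurable_K_comp mK (mg _)).
  - move=> t _; rewrite -EFinD lee_fin.
    set x := rv t; rewrite simple_eval_cat simple_eval_scale !simple_eval_restr.
    have bnd : `|U * (\1_A x * simple_eval (simple_approx f m) x +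
        -1 * (\1_A x * simple_eval (simple_approx f n) x))| <= Num.max `|g m x| `|g n x|.
      rewrite mulN1r -mulrBr mulrCA normrM.
      apply: (@le_trans _ _ `|U * (simple_eval (simple_approx f m) x - simple_eval (simple_approx f n) x)|).
        by rewrite ler_piMl// indicE; case: (_ \in _); rewrite ?normr1 ?normr0.
      rewrite /g !normrM !normr_nat (gtr0_norm U0).
      set p := simple_eval _ x; set q := simple_eval _ x.
      have h1 : `|p - q| <= `|p - f x| + `|q - f x|.
        by rewrite (distrC q) (le_trans _ (ler_normD _ _))// addrA subrK.
      have h2 : U * `|p - q| <= U * (`|p - f x| + `|q - f x|) by rewrite ler_wpM2l ?(ltW U0).
      rewrite le_max; have [h|h] := leP `|p - f x| `|q - f x|; apply/orP; [right|left].
        have h3 : U * `|p - f x| <= U * `|q - f x| by rewrite ler_wpM2l ?(ltW U0).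
        lra.
      have h3 : U * `|q - f x| <= U * `|p - f x| by rewrite ler_wpM2l ?(ltW U0) ?(ltW h).
      lra.
    move: bnd; rewrite le_max => /orP[] /K_mono h; apply: (le_trans h).
      by rewrite lerDl K0.
    by rewrite lerDr K0.
rewrite [dl]splitr EFinD; apply: leeD.
  by rewrite -(fineK fm) lee_fin (le_trans _ hm)// ler_norm.
by rewrite -(fineK fn) lee_fin (le_trans _ hn)// ler_norm.
Qed.

Lemma mod_integrable_RR f : mod_integrable f -> RR_integrable P L f.
Proof.
move=> hf; have [mf _] := hf; have [bfs _ lim] := simple_approx_lists hf.
split => //; exists (simple_approx f); split; first by move=> k; exact: simple_approx_ok.
split.
  exists set0; split; first exact: borel_set0.
  split; first by rewrite lebdE ?preimage_set0 ?measure0//; exact: borel_set0.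
  by move=> x /= h; apply: h; exact: simple_approx_cvg.
move=> A mA; have [Y [mY hY]] := lim A mA; exists Y; split => //.
rewrite (_ : (fun k => simple_int L (simple_approx f k) A) =
  (fun k => Lint L (lrestr A (simple_approx f k)))); last first.
  by apply/funext => k; rewrite simple_int_restr.
by apply/(cvg_prob_qnorm P (fun k => mLint_restr (bfs k) mA) mY).
Qed.

(** Any version [X], whatever sequence it came from, is the limit along the canonical
    approximations; later arguments can thus use those, which are dominated by [f]. *)
Lemma RR_integral_approx f X : mod_integrable f -> RR_integral P L f X ->
  qcvg P (fun k => Lint L (simple_approx f k)) X.
Proof.
move=> hf hX; have [mX [fs fl qX]] := RR_integral_lists hX.
have sl := simple_approx_lists hf; have [bs _ lim] := sl.
have [Y [mY]] := lim _ borel_setT.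
rewrite (_ : (fun k => _) = (fun k => Lint L (simple_approx f k))); last first.
  by apply/funext => k; rewrite Lint_restrT.
move=> qY.
(* Uniqueness as the instance [a = 1], [b = 0] of linearity. *)
have ff x : f x = 1 * f x + 0 * f x by rewrite mul1r mul0r addr0.
have e := lists_linear ff fl sl sl mX mY mY qX qY qY.
rewrite /qcvg; apply: cvg_trans qY.
rewrite (_ : (fun k => qnorm P (fun w => Lint L (simple_approx f k) w - X w)) =
  (fun k => qnorm P (fun w => Lint L (simple_approx f k) w - Y w)))//.
apply/funext => k; have mk := measurable_Lint mL (bs k).
apply: qnorm_ae; [exact: measurable_funB|exact: measurable_funB|].
by apply: filterS e => w ->; rewrite mul1r mul0r addr0.
Qed.

Lemma RR_integral_linear f1 f2 f3 X1 X2 X3 (a b : R) :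
  (forall x, f1 x = a * f2 x + b * f3 x) ->
  RR_integral P L f1 X1 -> RR_integral P L f2 X2 -> RR_integral P L f3 X3 ->
  {ae P, forall w, X1 w = a * X2 w + b * X3 w}.
Proof.
move=> ff /RR_integral_lists[m1 [s1 l1 q1]] /RR_integral_lists[m2 [s2 l2 q2]].
move=> /RR_integral_lists[m3 [s3 l3 q3]].
exact: (lists_linear ff l1 l2 l3 m1 m2 m3 q1 q2 q3).
Qed.

(** The approximations lie below [f] in absolute value, so they satisfy the same modular bound; half
    of [e] pays for the passage to the limit. *)
Lemma qnorm_integral_small (e : R) : 0 < e -> exists U dl : R, [/\ 0 < U, 0 < dl &
  forall f X, mod_integrable f -> RR_integral P L f X ->
    (modular K (fun x => (U * f x)%R) <= dl%:E)%E -> qnorm P X <= e].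
Proof.
move=> e0; have e2 : 0 < e / 2 by rewrite divr_gt0.
have [U [dl [U0 dl0 hq]]] := q_small e2.
exists U, dl; split => // f X hf hX hm.
have qX := RR_integral_approx hf hX.
have [bs _ _] := simple_approx_lists hf.
have mX : measurable_fun setT X by case: hX => _ [].
have /cvgr0Pnorm_le/(_ _ e2)[N _ hN] := qX.
have := hN N (leqnn N); rewrite /= ger0_norm ?qnorm_ge0// => h.
have mN := measurable_Lint mL (bs N).
rewrite (_ : X = (fun w => Lint L (simple_approx f N) w - (Lint L (simple_approx f N) w - X w))).
  apply: (le_trans (qnormB P mN (measurable_funB mN mX))).
  rewrite [leRHS]splitr lerD//; apply: hq; first exact: bs.
  apply: le_trans hm; apply: (le_modular K_0 K_mono mK).
  - by apply: measurable_funM => //; exact: borel_simple_eval.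
  - by apply: measurable_funM => //; case: hf.
  - by move=> x; rewrite !normrM ler_wpM2l// simple_approx_le.
by apply/funext => w; rewrite opprB addrC subrK.
Qed.

End Integration.

(** * Bounds on the characteristic exponent *)

Section Exponent.
Context {R : realType}.
Variables (a gamma : R) (nu : {measure set R -> \bar R}).
Hypothesis triplet : levy_triplet a nu.

Let a0 : 0 <= a. Proof. by case: triplet. Qed.

Definition big_jumps : set R := [set r | 1 < `|r|].

Lemma measurable_big_jumps : measurable big_jumps.
Proof.
have : measurable_fun [set: R] (fun r => 1 < `|r|).
  apply: measurable_fun_ltr; first exact: measurable_cst.
  exact: normr_measurable.
by move=> /(_ measurableT [set true] I); rewrite setTI.
Qed.

Let int_1 : (\int[nu]_(x in big_jumps) 1 = nu big_jumps)%E.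
Proof. by rewrite (integral_cst nu measurable_big_jumps 1) mul1e. Qed.

Let mm : measurable_fun setT (fun x : R => (Num.min 1 (x ^+ 2))%:E).
Proof.
apply/measurable_EFinP; apply: measurable_minr; first exact: measurable_cst.
exact: measurable_funX.
Qed.

Let m0 (x : R) : 0 <= Num.min 1 (x ^+ 2).
Proof. by rewrite le_min ler01 sqr_ge0. Qed.

Definition min1_mass : R := fine (\int[nu]_x (Num.min 1 (x ^+ 2))%:E)%E.

Lemma min1_massE : (\int[nu]_x (Num.min 1 (x ^+ 2))%:E)%E = min1_mass%:E.
Proof.
rewrite /min1_mass fineK// ge0_fin_numE; first by case: triplet => _ [].
by apply: integral_ge0 => x _; rewrite lee_fin.
Qed.

Lemma big_jumps_fin : (nu big_jumps < +oo)%E.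
Proof.
have mB := measurable_big_jumps.
rewrite -int_1.
apply: (@le_lt_trans _ _ (\int[nu]_(x in big_jumps) (Num.min 1 (x ^+ 2))%:E)%E).
  apply: ge0_le_integral => //.
  - exact: measurable_funTS.
  - move=> x /= x1; rewrite lee_fin le_min lexx/=.
    by rewrite -(real_normK (num_real x)) exprn_ege1// ltW.
rewrite (@le_lt_trans _ _ (\int[nu]_x (Num.min 1 (x ^+ 2))%:E)%E)//.
  by apply: ge0_subset_integral => // x _; rewrite lee_fin.
by rewrite min1_massE ltry.
Qed.

Let f (z r : R) : R := Num.min 1 `|r * z|.

Let f0 z r : 0 <= f z r. Proof. by rewrite le_min ler01 normr_ge0. Qed.

Let f1 z r : f z r <= 1. Proof. by rewrite ge_min lexx. Qed.

Let mf z : measurable_fun big_jumps (fun r => (f z r)%:E).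
Proof.
apply: measurable_funTS; apply/measurable_EFinP; apply: measurable_minr; first exact: measurable_cst.
by apply: measurableT_comp => //; exact: measurable_funM.
Qed.

Definition kap_int (z : R) : \bar R := (\int[nu]_(r in big_jumps) (f z r)%:E)%E.

Definition kap (z : R) : R := fine (kap_int z).

Definition Kmod (z : R) : R := `|z| + z ^+ 2 + kap z.

Lemma kapE z : kap_int z = (kap z)%:E.
Proof.
rewrite /kap fineK// ge0_fin_numE; last by apply: integral_ge0 => r _; rewrite lee_fin.
apply: le_lt_trans big_jumps_fin; rewrite -int_1.
apply: ge0_le_integral => //; first exact: measurable_big_jumps.
  by move=> x _; rewrite lee_fin.
by move=> x _; rewrite lee_fin.
Qed.

Lemma kap_mono x y : `|x| <= `|y| -> kap x <= kap y.
Proof.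
move=> xy; rewrite -lee_fin -!kapE; apply: ge0_le_integral => //.
- exact: measurable_big_jumps.
- by move=> r _; rewrite lee_fin.
- move=> r _; rewrite lee_fin /f le_min ge_min lexx/= ge_min !normrM.
  by rewrite ler_wpM2l ?orbT.
Qed.

Lemma kap0 : kap 0 = 0.
Proof.
rewrite /kap /kap_int; under eq_integral do rewrite /f mulr0 normr0 minElt ltr10.
by rewrite integral0.
Qed.

Lemma Kmod_0 : Kmod 0 = 0.
Proof. by rewrite /Kmod kap0 normr0 expr0n/= !addr0. Qed.

Lemma Kmod_mono x y : `|x| <= `|y| -> Kmod x <= Kmod y.
Proof.
move=> xy; rewrite /Kmod lerD ?kap_mono// lerD//.
by rewrite -(real_normK (num_real x)) -(real_normK (num_real y)) lerXn2r ?nnegrE.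
Qed.

(** [kap] is even and nondecreasing on the nonnegative reals, hence a monotone function of the
    absolute value. *)
Lemma measurable_kap : measurable_fun setT kap.
Proof.
rewrite (_ : kap = (fun y => kap (Num.max y 0)) \o (fun x => `|x|)); last first.
  apply/funext => x /=; rewrite max_l//.
  by apply/eqP; rewrite eq_le !kap_mono ?normr_id.
apply: measurableT_comp => //; apply: nondecreasing_measurable_fun => x y xy.
apply: kap_mono; rewrite !ger0_norm ?le_max ?lexx ?orbT//.
by rewrite !ge_max xy lexx; case: (leP 0 y) => //= /ltW/(le_trans xy) ->.
Qed.

Lemma measurable_Kmod : measurable_fun setT Kmod.
Proof.
apply: measurable_funD; last exact: measurable_kap.
apply: measurable_funD; last exact: measurable_funX.
exact: normr_measurable.
Qed.

(** For the jump part, dominated convergence with majorant 1, integrable since the jumps larger than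
    1 have finite mass. *)
Lemma Kmod_cvg0 (u : nat -> R) : u n @[n --> \oo] --> (0 : R) ->
  Kmod (u n) @[n --> \oo] --> (0 : R).
Proof.
move=> u0.
have e : 0 = `|(0 : R)| + 0 * 0 + 0 :> R by rewrite normr0 mulr0 !addr0.
have -> : (fun n => Kmod (u n)) = (fun n => `|u n| + u n * u n + kap (u n)) by [].
rewrite [X in _ --> X]e; apply: cvgD.
  by apply: cvgD; [exact: cvg_norm|exact: cvgM].
have mB := measurable_big_jumps.
have [|||||_ _ h] := @dominated_convergence _ _ _ nu big_jumps mB
  (fun n r => (f (u n) r)%:E) (cst 0%E) (cst 1%E).
- by move=> n; exact: mf.
- exact: measurable_cst.
- apply: aeW => r _; apply: cvg_EFin; first exact: nearW.
  apply: (@squeeze_cvgr _ _ _ _ (cst 0) (fun n => `|r| * `|u n|)).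
  + by apply: nearW => n; rewrite f0/= /f ge_min normrM lexx orbT.
  + exact: cvg_cst.
  + rewrite -[X in _ --> X](mulr0 `|r|) -(normr0 R); apply: cvgMr; exact: cvg_norm.
- apply/integrableP; split; first exact: measurable_cst.
  under eq_integral do rewrite /= normr1.
  by rewrite int_1 big_jumps_fin.
- by apply: aeW => r n _; rewrite gee0_abs lee_fin.
have -> : (fun n => kap (u n)) = fine \o (fun n => kap_int (u n)) by [].
by apply: fine_cvg; move: h; rewrite integral0.
Qed.

Lemma cos_sub1_le (t : R) : `|cos t - 1| <= 2 * t ^+ 2.
Proof.
wlog t0 : t / 0 < t.
  move=> W; have [t0|t0|->] := ltgtP t 0; last by rewrite cos0 subrr normr0 expr0n mulr0.
    by have := W (- t); rewrite oppr_gt0 cosN sqrrN; exact.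
  exact: W.
have [c ct cE] := @MVT R cos (fun c => - sin c) 0 t t0 (fun c _ => is_derive_cos c)
    (continuous_subspaceT (@continuous_cos R)).
rewrite cos0 subr0 in cE; rewrite cE normrM normrN (gtr0_norm t0) expr2 mulrA ler_wpM2r ?(ltW t0)//.
have := sin_sub_le c 0; rewrite sin0 !subr0 => h; rewrite (le_trans h)//.
move: ct; rewrite in_itv/= => /andP[c0 ct].
by rewrite ler_wpM2l// ge_min gtr0_norm// (ltW ct) orbT.
Qed.

Lemma sin_sub_id_le (t : R) : `|sin t - t| <= 2 * t ^+ 2.
Proof.
wlog t0 : t / 0 < t.
  move=> W; have [t0|t0|->] := ltgtP t 0; last by rewrite sin0 subrr normr0 expr0n mulr0.
    have := W (- t); rewrite oppr_gt0 sinN sqrrN -opprD normrN; exact.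
  exact: W.
have cf : continuous (fun x : R => sin x - x).
  by move=> x; apply: cvgB; [exact: continuous_sin|exact: cvg_id].
have dF (x : R) : is_derive x 1 (fun x : R => sin x - x) (cos x - 1).
  by have [d1 e1] := is_derive_sin x; have [d2 e2] := is_derive_id x (1 : R); apply: is_deriveB.
have [c ct cE] := @MVT R (fun x => sin x - x) (fun c => cos c - 1) 0 t t0 (fun c _ => dF c)
    (continuous_subspaceT cf).
rewrite sin0 !subr0 in cE; rewrite cE normrM (gtr0_norm t0) expr2 mulrA ler_wpM2r ?(ltW t0)//.
have := cos_sub_le c 0; rewrite cos0 !subr0 => h; rewrite (le_trans h)//.
move: ct; rewrite in_itv/= => /andP[c0 ct].
by rewrite ler_wpM2l// ge_min gtr0_norm// (ltW ct) orbT.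
Qed.

(** A common majorant for the real and imaginary integrands: quadratic for small jumps, where the
    compensator cancels the linear term, and truncated at 1 for large jumps, where it is absent. *)
Let dom (z x : R) : R := 2 * z ^+ 2 * Num.min 1 (x ^+ 2) + 2 * (\1_big_jumps x * f z x).

Let int_dom z : (\int[nu]_x (dom z x)%:E = (2 * z ^+ 2 * min1_mass + 2 * kap z)%:E)%E.
Proof.
have mB := measurable_big_jumps.
have mfT : measurable_fun setT (fun r => (f z r)).
  apply: measurable_minr; first exact: measurable_cst.
  by apply: measurableT_comp => //; exact: measurable_funM.
under eq_integral do rewrite EFinD.
have mif : measurable_fun setT (fun x => (\1_big_jumps x * f z x)%:E).
  by apply/measurable_EFinP; apply: measurable_funM.
rewrite ge0_integralD//; last 4 first.
- by move=> x _; rewrite lee_fin mulr_ge0// mulr_ge0// sqr_ge0.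
- by apply/measurable_EFinP; apply: measurable_funM => //; apply/measurable_EFinP.
- by move=> x _; rewrite lee_fin mulr_ge0// mulr_ge0.
- by apply/measurable_EFinP; apply: measurable_funM => //; apply/measurable_EFinP.
under eq_integral do rewrite EFinM.
under [X in (_ + X)%E]eq_integral do rewrite EFinM.
rewrite ge0_integralZl_EFin//; last 2 first.
- by move=> x _; rewrite lee_fin.
- by rewrite mulr_ge0// sqr_ge0.
rewrite ge0_integralZl_EFin//; last by move=> x _; rewrite lee_fin mulr_ge0.
rewrite min1_massE [RHS]EFinD; apply: (f_equal2 (fun x y => x + y)%E); first by rewrite EFinM.
rewrite [RHS]EFinM; apply: (f_equal (fun x => 2%:E * x)%E).
rewrite -kapE /kap_int [RHS]integral_mkcond; apply: eq_integral => x _.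
by rewrite patchE indicE; case: ifPn => _; rewrite ?mul1r ?mul0r.
Qed.

Let integral_le_dom (F : R -> R) z : measurable_fun setT F ->
  (forall x, `|F x| <= dom z x) ->
  `|fine (\int[nu]_x (F x)%:E)%E| <= 2 * z ^+ 2 * min1_mass + 2 * kap z.
Proof.
move=> mF Fd.
have h : (`|\int[nu]_x (F x)%:E| <= (2 * z ^+ 2 * min1_mass + 2 * kap z)%:E)%E.
  rewrite -int_dom; apply: le_trans (le_abse_integral nu measurableT _) _.
    exact/measurable_EFinP.
  have mfT : measurable_fun setT (fun r => (f z r)).
    apply: measurable_minr; first exact: measurable_cst.
    by apply: measurableT_comp => //; exact: measurable_funM.
  apply: ge0_le_integral => //.
  - by apply: measurableT_comp => //; exact/measurable_EFinP.
  - apply/measurable_EFinP; apply: measurable_funD.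
      by apply: measurable_funM => //; apply/measurable_EFinP.
    apply: measurable_funM => //; apply: measurable_funM => //.
    by apply: measurable_indic; exact: measurable_big_jumps.
  - by move=> x _; rewrite /= lee_fin.
move: h; case: (\int[nu]_x _)%E => [r| |] //=; rewrite ?normr0 -?lee_fin//.
Qed.

Let dom_small z x : `|x| <= 1 -> 2 * (x * z) ^+ 2 <= dom z x.
Proof.
move=> x1; rewrite /dom (_ : Num.min 1 (x ^+ 2) = x ^+ 2).
  rewrite (_ : 2 * (x * z) ^+ 2 = 2 * z ^+ 2 * x ^+ 2); last by ring.
  by rewrite lerDl mulr_ge0// mulr_ge0.
by rewrite min_r// -(real_normK (num_real x)) exprn_ile1//.
Qed.

Let dom_big z x : 1 < `|x| -> 2 * Num.min 1 `|x * z - 0| <= dom z x.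
Proof.
move=> x1; rewrite /dom indicE mem_set// mul1r subr0 -/(f z x) lerDr.
by rewrite mulr_ge0// mulr_ge0// sqr_ge0.
Qed.

Lemma psiRe_le0 z : psiRe a nu z <= 0.
Proof.
rewrite /psiRe; have h : fine (\int[nu]_x (cos (x * z) - 1)%:E)%E <= 0.
  apply: fine_le0.
  under eq_integral do rewrite -opprB EFinN.
  rewrite integral_ge0N ?oppe_le0 => [|x _]; last by rewrite lee_fin subr_ge0 cos_le1.
  by apply: integral_ge0 => x _; rewrite lee_fin subr_ge0 cos_le1.
have : 0 <= a * z ^+ 2 by rewrite mulr_ge0 ?sqr_ge0.
lra.
Qed.

(** The coefficients in turn: drift times [|z|], Gaussian part times [z ^+ 2], small jumps times
    [z ^+ 2], large jumps times [kap z]. Their sum bounds both parts of the exponent. *)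
Definition Kconst : R := `|gamma| + a + 2 * min1_mass + 2.

Let M0 : 0 <= min1_mass.
Proof. by rewrite fine_ge0// integral_ge0// => x _; rewrite lee_fin. Qed.

Lemma Kconst_gt0 : 0 < Kconst.
Proof. have g0 := normr_ge0 gamma; have h1 := M0; have h2 := a0; rewrite /Kconst; lra. Qed.

Let kap_ge0 z : 0 <= kap z.
Proof. by rewrite -kap0; apply: kap_mono; rewrite normr0. Qed.

Lemma psiRe_le z : `|psiRe a nu z| <= Kconst * Kmod z.
Proof.
have h : `|fine (\int[nu]_x (cos (x * z) - 1)%:E)%E| <= 2 * z ^+ 2 * min1_mass + 2 * kap z.
  apply: integral_le_dom.
    apply: continuous_measurable_fun => x; apply: cvgB; last exact: cvg_cst.
    apply: continuous_comp; last exact: continuous_cos.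
    by apply: cvgM; [exact: cvg_id|exact: cvg_cst].
  move=> x; have [x1|x1] := leP `|x| 1.
    exact: le_trans (cos_sub1_le _) (dom_small _ x1).
  by apply: le_trans (dom_big _ x1); have := cos_sub_le (x * z) 0; rewrite cos0.
rewrite /psiRe (le_trans (ler_normD _ _))// /Kconst /Kmod.
have z0 := normr_ge0 z; have z2 := sqr_ge0 z; have g0 := normr_ge0 gamma; have k0 := kap_ge0 z.
have az : 0 <= a * z ^+ 2 by rewrite mulr_ge0.
rewrite mulNr normrN [X in X + _ <= _]ger0_norm ?divr_ge0//.
have p1 : 0 <= `|gamma| * (`|z| + z ^+ 2 + kap z) by rewrite mulr_ge0// !addr_ge0.
have p2 : 0 <= a * (`|z| + kap z) by rewrite mulr_ge0// addr_ge0.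
have p3 : 0 <= min1_mass * (`|z| + kap z) by rewrite mulr_ge0// addr_ge0.
lra.
Qed.

Lemma psiIm_le z : `|psiIm gamma nu z| <= Kconst * Kmod z.
Proof.
have h : `|fine (\int[nu]_x (psiIm_integrand z x)%:E)%E| <= 2 * z ^+ 2 * min1_mass + 2 * kap z.
  apply: integral_le_dom.
    rewrite /psiIm_integrand; apply: measurable_funB.
      apply: continuous_measurable_fun => x.
      apply: continuous_comp; last exact: continuous_sin.
      by apply: cvgM; [exact: cvg_id|exact: cvg_cst].
    apply: measurable_funM; first exact: measurable_funM.
    rewrite (_ : (fun x : R => _) = \1_(~` big_jumps)).
      by apply: measurable_indic; apply: measurableC; exact: measurable_big_jumps.
    apply/funext => x; rewrite indicE; case: (leP `|x| 1) => x1.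
      by rewrite mem_set//= => /lt_geF; rewrite x1.
    by rewrite memNset//=.
  move=> x; rewrite /psiIm_integrand; have [x1|x1] := leP `|x| 1.
    by rewrite mulr1; exact: le_trans (sin_sub_id_le _) (dom_small _ x1).
  rewrite mulr0 subr0; apply: le_trans (dom_big _ x1).
  by have := sin_sub_le (x * z) 0; rewrite sin0 subr0.
rewrite /psiIm (le_trans (ler_normD _ _))// normrM /Kconst /Kmod.
have z0 := normr_ge0 z; have z2 := sqr_ge0 z; have g0 := normr_ge0 gamma; have k0 := kap_ge0 z.
have p1 : 0 <= `|gamma| * (z ^+ 2 + kap z) by rewrite mulr_ge0// addr_ge0.
have p2 : 0 <= a * (`|z| + z ^+ 2 + kap z) by rewrite mulr_ge0// !addr_ge0.
have p3 : 0 <= min1_mass * (`|z| + kap z) by rewrite mulr_ge0// addr_ge0.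
lra.
Qed.

End Exponent.

(** * Convolutions and the local averages [G_R] *)

Section Convolution.
Context {R : realType} {d : nat}.
Local Notation mu := (@leb_tuple R d).
Local Notation rv := (@rv_of_tuple R d).
Implicit Types (f g h : 'rV[R]_d -> R).

Lemma leb_intR_integral f : borel_fun f -> leb_intR f = \int[mu]_t f (rv t).
Proof.
move=> mf; rewrite /leb_intR /Rintegral integralE; congr (fine (_ - _)%E).
- rewrite leb_int_integral.
  + by apply: eq_integral => t _; rewrite funeposE/= EFin_max.
  + by apply/measurable_EFinP; apply: measurable_maxr.
  + by move=> x; rewrite lee_fin le_max lexx orbT.
- rewrite leb_int_integral.
  + by apply: eq_integral => t _; rewrite funenegE/= EFin_max.
  + apply/measurable_EFinP; apply: measurable_maxr => //.
    exact: measurable_funN.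
  + by move=> x; rewrite lee_fin le_max lexx orbT.
Qed.

Lemma borel_fun_sub_joint h : borel_fun h ->
  measurable_fun setT (fun z : d.-tuple R * d.-tuple R => h (rv z.1 - rv z.2)).
Proof.
move=> mh.
pose S (z : d.-tuple R * d.-tuple R) := [tuple tnth z.1 i - tnth z.2 i | i < d].
have mS : measurable_fun setT S.
  apply/measurable_fun_tnthP => i.
  rewrite (_ : _ \o _ = (fun z : d.-tuple R * d.-tuple R => tnth z.1 i - tnth z.2 i)).
    apply: measurable_funB.
      exact: (measurableT_comp (@measurable_tnth _ _ d i)).
    exact: (measurableT_comp (@measurable_tnth _ _ d i)).
  by apply/funext => z; rewrite /= tnth_mktuple.
rewrite (_ : (fun z => _) = (h \o rv) \o S); first exact: measurableT_comp.
apply/funext => z /=; congr h; apply/rowP => i.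
by rewrite !mxE tnth_mktuple.
Qed.

Lemma borel_fun_subl h x : borel_fun h -> borel_fun (fun y => h (x - y)).
Proof.
move=> mh; rewrite /borel_fun.
rewrite (_ : _ \o _ = (fun z => h (rv z.1 - rv z.2)) \o pair (tuple_of_rv x)).
  exact: (measurableT_comp (borel_fun_sub_joint mh) (pair1_measurable _)).
by apply/funext => t /=; rewrite tuple_of_rvK.
Qed.

Lemma measurable_conv_joint g h : borel_fun g -> borel_fun h ->
  measurable_fun setT (fun z : d.-tuple R * d.-tuple R => g (rv z.2) * h (rv z.1 - rv z.2)).
Proof.
move=> mg mh; apply: measurable_funM; last exact: borel_fun_sub_joint.
exact: (measurableT_comp (f := g \o rv) (g := snd)).
Qed.

(** [leb_intR] is a difference of two nonnegative integrals, and Tonelli gives the measurability of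
    each of them in the parameter. *)
Lemma borel_convol g h : borel_fun g -> borel_fun h -> borel_fun (convol g h).
Proof.
move=> mg mh; rewrite /borel_fun.
have mF := measurable_conv_joint mg mh.
have pos (F : d.-tuple R * d.-tuple R -> R) : measurable_fun setT F ->
    measurable_fun setT (fun s => \int[mu]_t (Num.max (F (s, t)) 0)%:E)%E.
  move=> mF'; apply: (measurable_fun_fubini_tonelli_F (fun z => (Num.max (F z) 0)%:E)).
    by apply/measurable_EFinP; apply: measurable_maxr.
  by move=> z; rewrite lee_fin le_max lexx orbT.
have -> : convol g h \o rv = (fun s =>
    fine (\int[mu]_t (Num.max (g (rv t) * h (rv s - rv t)) 0)%:E -
          \int[mu]_t (Num.max (- (g (rv t) * h (rv s - rv t))) 0)%:E)%E).
  apply/funext => s /=; have ms := borel_fun_subl (rv s) mh.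
  have mm : borel_fun (fun y => g y * h (rv s - y)) by exact: measurable_funM.
  rewrite /convol /leb_intR leb_int_integral.
  - rewrite leb_int_integral//.
    + apply/measurable_EFinP; apply: measurable_maxr => //.
      exact: measurable_funN.
    + by move=> x; rewrite lee_fin le_max lexx orbT.
  - by apply/measurable_EFinP; apply: measurable_maxr.
  - by move=> x; rewrite lee_fin le_max lexx orbT.
apply: measurableT_comp => //; apply: emeasurable_funB; first exact: (pos _ mF).
apply: (pos (fun z => - (g (rv z.2) * h (rv z.1 - rv z.2)))).
exact: measurable_funN.
Qed.

Lemma integral_sub h (s : d.-tuple R) : borel_fun h -> (forall x, 0 <= h x) ->
  (\int[mu]_t (h (rv t - rv s))%:E = \int[mu]_t (h (rv t))%:E)%E.
Proof.
move=> mh h0; have m1 : measurable_fun setT (fun t => (h (rv t))%:E) by exact/measurable_EFinP.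
have h0' x : (0 <= (h x)%:E)%E by rewrite lee_fin.
have := leb_int_shift (rv s) m1 h0'; rewrite !leb_int_integral//.
by apply/measurable_EFinP; exact: borel_fun_shift.
Qed.

Lemma integral_convol g h : borel_fun g -> borel_fun h ->
  (forall x, 0 <= g x) -> (forall x, 0 <= h x) ->
  (\int[mu]_s \int[mu]_t (g (rv t) * h (rv s - rv t))%:E =
   \int[mu]_t (g (rv t))%:E * \int[mu]_t (h (rv t))%:E)%E.
Proof.
move=> mg mh g0 h0; have mF := measurable_conv_joint mg mh.
rewrite (fubini_tonelli (fun z => (g (rv z.2) * h (rv z.1 - rv z.2))%:E)) /=; last 2 first.
- exact/measurable_EFinP.
- by move=> z; rewrite lee_fin mulr_ge0.
under eq_integral => t _.
  under eq_integral do rewrite EFinM.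
  rewrite ge0_integralZl_EFin//; last 2 first.
  - by move=> s _; rewrite lee_fin.
  - by apply/measurable_EFinP; exact: borel_fun_shift.
  rewrite integral_sub//.
  over.
rewrite ge0_integralZr//.
- exact/measurable_EFinP.
- by move=> t _; rewrite lee_fin.
- by apply: integral_ge0 => t _; rewrite lee_fin.
Qed.

End Convolution.

(** * The layer cake formula behind [h_R] *)

Section LayerCake.
Context {R : realType} {dT : measure_display} {T : measurableType dT}.
Variable mu : {sigma_finite_measure set T -> \bar R}.

(** [Num.min 1 (rho * g t)] is [rho * Num.min rho^-1 (g t)], and this last minimum is the length of
    the slice at [t] of the region [S]; the other slices are level sets of [g]. Tonelli compares the
    two ways of measuring [S]. *)
Lemma layer_cake_min (g : T -> R) (rho : R) : measurable_fun setT g ->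
  (forall t, 0 <= g t) -> 0 < rho ->
  (\int[mu]_t (Num.min 1 (rho * g t))%:E =
   rho%:E * \int[@lebesgue_measure R]_(al in [set al : R | (0 < al < rho^-1)%R])
      mu [set t | (al < g t)%R])%E.
Proof.
move=> mg g0 r0; have ri0 : 0 < rho^-1 by rewrite invr_gt0.
pose S := [set z : measurableTypeR R * T | (0 < z.1 < Num.min rho^-1 (g z.2))%R].
have mS : measurable S.
  have h1 : measurable_fun setT (fun z : measurableTypeR R * T => 0 < z.1).
    by apply: measurable_fun_ltr; [exact: measurable_cst|exact: measurable_fst].
  have h2 : measurable_fun setT (fun z : measurableTypeR R * T => z.1 < Num.min rho^-1 (g z.2)).
    apply: measurable_fun_ltr; first exact: measurable_fst.
    apply: measurable_minr; first exact: measurable_cst.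
    exact: (measurableT_comp mg (@measurable_snd _ _ _ _)).
  have : measurable_fun setT (fun z : measurableTypeR R * T => (0 < z.1) && (z.1 < Num.min rho^-1 (g z.2))).
    exact: measurable_and.
  by move=> /(_ measurableT [set true] I); rewrite setTI.
have e1 t : (\int[@lebesgue_measure R]_al (\1_S (al, t))%:E = (Num.min rho^-1 (g t))%:E)%E.
  rewrite (_ : (fun al => _) = (fun al => (\1_([set` Interval (BRight 0) (BLeft (Num.min rho^-1 (g t)))]) al)%:E)).
    rewrite integral_indic//= setIT.
    have /= -> := lebesgue_measure_itv (Interval (BRight 0) (BLeft (Num.min rho^-1 (g t)))).
    rewrite lte_fin; case: ifPn => h; first by rewrite oppr0 adde0.
    by congr EFin; apply/eqP; rewrite eq_le [X in _ && X]leNgt h le_min (ltW ri0) g0.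
  by apply/funext => al; rewrite !indicE; congr (_ _)%:E; rewrite /S; apply/idP/idP; rewrite !inE/= in_itv.
have e2 al : (\int[mu]_t (\1_S (al, t))%:E =
    ((fun al => mu [set t | (al < g t)%R]) \_ [set al : R | (0 < al < rho^-1)%R]) al)%E.
  rewrite patchE; case: ifPn; rewrite (inE, notin_setE)/= => h.
    rewrite (_ : (fun t => _) = (fun t => (\1_([set t | al < g t]) t)%:E)).
      rewrite integral_indic//= ?setIT//.
      have : measurable_fun setT (fun t => al < g t) by exact: measurable_fun_ltr.
      by move=> /(_ measurableT [set true] I); rewrite setTI.
    move/andP: h => [h1 h2].
    apply/funext => t; rewrite !indicE (_ : ((al, t) \in S) = (t \in [set t0 | al < g t0]))//.
    apply/idP/idP; rewrite !inE/= /S/= lt_min; first by case/and3P.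
    by move=> h; apply/and3P.
  rewrite integral0_eq// => t _; rewrite indicE memNset// /S/= lt_min => /and3P[h1 h2 _].
  by apply: h; rewrite h1.
rewrite [in RHS]integral_mkcond.
under [in RHS]eq_integral do rewrite -e2.
rewrite (fubini_tonelli (fun z => (\1_S z)%:E)) //; last first.
  by apply/measurable_EFinP; exact: measurable_indic.
under [in RHS]eq_integral do rewrite e1.
rewrite -ge0_integralZl_EFin ?(ltW r0)//; last 2 first.
- by move=> t _; rewrite lee_fin le_min (ltW ri0) g0.
- by apply/measurable_EFinP; apply: measurable_minr.
apply: eq_integral => t _; rewrite -EFinM; congr EFin.
by rewrite minr_pMr ?(ltW r0)// mulfV// gt_eqF.
Qed.

End LayerCake.

(** * Integrability of the local averages *)

Section LocalAverage.
Context {R : realType} {d : nat}.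
Local Notation mu := (@leb_tuple R d).
Local Notation rv := (@rv_of_tuple R d).
Variables (G : 'rV[R]_d -> R) (rad : R).
Hypothesis L1G : L1 G.

Let k : 'rV[R]_d -> R := \1_(eball 0 rad).
Let aG x := `|G x|.

Let mk : borel_fun k. Proof. by apply: borel_indic; exact: borel_eball. Qed.

Let mG : borel_fun aG.
Proof. by apply: (measurableT_comp (normr_measurable (D := setT))); case: L1G. Qed.

Let k0 x : 0 <= k x. Proof. by rewrite /k indicE. Qed.

Let k1 x : k x <= 1. Proof. by rewrite /k indicE; case: (_ \in _). Qed.

Let aG0 x : 0 <= aG x. Proof. by rewrite /aG. Qed.

Definition L1_norm : R := fine (leb_int (fun x => `|G x|%:E)).

Lemma L1_normE : (\int[mu]_t `|G (rv t)|%:E = L1_norm%:E)%E.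
Proof.
have [_ fin] := L1G.
have <- : leb_int (fun x => (aG x)%:E) = (\int[mu]_t `|G (rv t)|%:E)%E.
  by rewrite leb_int_integral//; exact/measurable_EFinP.
by rewrite /L1_norm fineK// ge0_fin_numE//; exact: iint_ge0.
Qed.

(** By symmetry of the ball the local average is a convolution of [|G|] with an indicator, which
    yields its measurability and, through Tonelli, its integrability. *)
Lemma G_R_convol x : G_R G rad x = convol aG k x.
Proof.
rewrite /G_R /convol; congr leb_intR; apply/funext => y; rewrite mulrC; congr (_ * _).
have e : \sum_(i < d) ((x - y) 0 i - (0 : 'rV[R]_d) 0 i) ^+ 2 = \sum_(i < d) (y 0 i - x 0 i) ^+ 2.
  by apply: eq_bigr => i _; rewrite !mxE subr0 -sqrrN opprB.
by rewrite /k !indicE (_ : (y \in eball x rad) = (x - y \in eball 0 rad))//;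
  apply/idP/idP; rewrite !inE /eball/= e.
Qed.

Lemma borel_G_R : borel_fun (G_R G rad).
Proof. by rewrite (_ : G_R G rad = convol aG k); [exact: borel_convol|apply/funext => x; rewrite G_R_convol]. Qed.

Lemma G_R_integral x :
  ((G_R G rad x)%:E = \int[mu]_t (`|G (rv t)| * \1_(eball 0 rad) (x - rv t))%:E)%E.
Proof.
have mm : borel_fun (fun y => aG y * k (x - y)).
  by apply: measurable_funM => //; exact: borel_fun_subl.
rewrite G_R_convol /convol leb_intR_integral// /Rintegral fineK// ge0_fin_numE.
  apply: (@le_lt_trans _ _ L1_norm%:E); last exact: ltry.
  rewrite -L1_normE; apply: ge0_le_integral => //.
  - by move=> t _; rewrite lee_fin mulr_ge0.
  - exact/measurable_EFinP.
  - exact/measurable_EFinP.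
  - by move=> t _; rewrite lee_fin ler_piMr.
by apply: integral_ge0 => t _; rewrite lee_fin mulr_ge0.
Qed.

Lemma G_R_ge0 x : 0 <= G_R G rad x.
Proof. by rewrite -lee_fin G_R_integral integral_ge0// => t _; rewrite lee_fin mulr_ge0. Qed.

Lemma G_R_le x : G_R G rad x <= L1_norm.
Proof.
have mm : borel_fun (fun y => aG y * k (x - y)).
  by apply: measurable_funM => //; exact: borel_fun_subl.
rewrite -lee_fin G_R_integral -L1_normE; apply: ge0_le_integral => //.
- exact/measurable_EFinP.
- exact/measurable_EFinP.
- by move=> t _; rewrite lee_fin ler_piMr.
Qed.

Lemma integral_G_R : 0 < rad -> (\int[mu]_t (G_R G rad (rv t))%:E < +oo)%E.
Proof.
move=> rad0; under eq_integral do rewrite G_R_integral.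
rewrite (integral_convol mG mk)// L1_normE.
apply: (@le_lt_trans _ _ (L1_norm%:E * ((rad *+ 2) ^+ d)%:E)%E); last by rewrite -EFinM ltry.
(* The ball is enclosed in the cube of the same half-side, whose volume is explicit. *)
have <- : lebd (cube (d := d) rad) = ((rad *+ 2) ^+ d)%:E.
  by rewrite lebdE ?mu_cube//; exact: (borel_cube (ltW rad0)).
have bc := borel_cube (d := d) (ltW rad0).
rewrite lebdE// (_ : mu (rv @^-1` cube rad) = \int[mu]_t (\1_(rv @^-1` cube rad) t)%:E)%E; last first.
  by rewrite integral_indic// setIT.
apply: lee_wpmul2l; first by rewrite lee_fin fine_ge0// iint_ge0// => t; rewrite lee_fin.
apply: ge0_le_integral => //.
- by move=> t _; rewrite lee_fin.
- exact/measurable_EFinP.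
- by apply/measurable_EFinP; exact: measurable_indic.
- move=> t _; rewrite lee_fin /k !indicE.
  suff h : rv t \in eball 0 rad -> t \in rv @^-1` cube rad by case: (_ \in _) h => // ->.
  rewrite !inE/= => h; apply/(rv_norm_le _ (ltW rad0)) => i.
  apply: le_trans (ltW h); rewrite -sqrtr_sqr ler_wsqrtr//.
  under eq_bigr do rewrite !mxE subr0.
  rewrite (bigD1 i)//= !mxE lerDl; apply: sumr_ge0 => j _; exact: sqr_ge0.
Qed.

Section Modular.
Variables (a : R) (nu : {measure set R -> \bar R}).
Hypothesis triplet : levy_triplet a nu.
Hypothesis h_fin : (\int[nu]_(r in [set r : R | (1 < `|r|)%R]) h_R G rad `|r| < +oo)%E.

Let g t := G_R G rad (rv t).
Let mg : measurable_fun setT g. Proof. exact: borel_G_R. Qed.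
Let g0 t : 0 <= g t. Proof. exact: G_R_ge0. Qed.
Let big : set R := big_jumps.
Let mbig : measurable big. Proof. exact: measurable_big_jumps. Qed.
(** The finite restriction of [nu] to the large jumps, so that Tonelli applies to its product with
    Lebesgue measure. *)
Let nub : {finite_measure set R -> \bar R} := mfrestr mbig (big_jumps_fin triplet).

Let int_nub (f : R -> \bar R) :
  (\int[nub]_(r in big) f r = \int[nu]_(r in big) f r)%E.
Proof.
by apply: eq_measure_integral => A mA AB; rewrite /= /mfrestr /mrestr setIidl.
Qed.

Let h_R_min r : 1 < `|r| -> h_R G rad `|r| = (\int[mu]_t (Num.min 1 `|r * g t|)%:E)%E.
Proof.
move=> r1; have r0 : 0 < `|r| by apply: lt_trans r1.
under eq_integral => t _ do rewrite normrM (ger0_norm (g0 t)).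
rewrite layer_cake_min// /h_R; congr (_ * _)%E; apply: eq_integral => al _.
rewrite /distrib lebdE; last first.
  rewrite (_ : mkset _ = ~` [set x | `|G_R G rad x| <= al]).
    apply: borel_setC; apply: borel_le.
    exact: (measurableT_comp (normr_measurable (D := setT)) mg).
  by apply/seteqP; split => x /=; rewrite ltNge => /negP.
by congr (mu _); apply/seteqP; split => t /=; rewrite (ger0_norm (g0 t)).
Qed.

(** Tonelli puts the space integral inside; by [h_R_min] it is then [h_R] at [|r|], and the
    assumption on [h_R] applies. *)
Lemma integral_kap_G_R : (\int[mu]_t (kap nu (G_R G rad (rv t)))%:E < +oo)%E.
Proof.
pose F (z : d.-tuple R * R) : \bar R := (\1_big z.2 * Num.min 1 `|z.2 * g z.1|)%:E.
have F0 z : (0 <= F z)%E by rewrite lee_fin mulr_ge0// le_min ler01/=.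
have mF : measurable_fun setT F.
  apply/measurable_EFinP; apply: measurable_funM.
    have m1 : measurable_fun setT (\1_big : R -> R) by exact: measurable_indic.
    exact: (measurableT_comp m1 (@measurable_snd _ _ _ _)).
  apply: measurable_minr; first exact: measurable_cst.
  apply: (measurableT_comp (normr_measurable (D := setT))).
  apply: measurable_funM; first exact: measurable_snd.
  exact: (measurableT_comp mg (@measurable_fst _ _ _ _)).
have e1 t : (kap nu (G_R G rad (rv t)))%:E = (\int[nub]_r F (t, r))%E.
  rewrite -(kapE triplet) /kap_int -int_nub integral_mkcond; apply: eq_integral => r _.
  by rewrite patchE /F indicE/=; case: ifPn => _; rewrite ?mul1r ?mul0r.
under eq_integral do rewrite e1.
rewrite (fubini_tonelli F)//.
rewrite (_ : (\int[nub]_y _)%E = (\int[nu]_(r in big) h_R G rad `|r|)%E)//.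
rewrite -int_nub [RHS]integral_mkcond; apply: eq_integral => r _.
rewrite patchE /F/= indicE; case: ifPn => rb.
  by rewrite h_R_min; [under eq_integral do rewrite mul1r|move: rb; rewrite inE].
by rewrite integral0_eq// => t _; rewrite mul0r.
Qed.

(** From [Num.min 1 (|c| * y) <= (1 + |c|) * Num.min 1 y]; it extends integrability of [kap] along
    [G_R] to all dilations. *)
Lemma kapZ c z : kap nu (c * z) <= (1 + `|c|) * kap nu z.
Proof.
rewrite -lee_fin EFinM -!(kapE triplet) /kap_int.
have mh (w : R) : measurable_fun big (fun r => (Num.min 1 `|r * w|)%:E).
  apply: measurable_funTS; apply/measurable_EFinP; apply: measurable_minr; first exact: measurable_cst.
  by apply: measurableT_comp => //; exact: measurable_funM.
have h0 (x : R) : (0 <= (Num.min 1 `|x|)%:E)%E by rewrite lee_fin le_min ler01/=.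
rewrite -ge0_integralZl_EFin//.
apply: ge0_le_integral => //.
- by apply: measurable_funeM.
- move=> r _; rewrite -EFinM lee_fin mulrCA normrM.
  have c0 := normr_ge0 c; have x0 := normr_ge0 (r * z).
  have h : 0 <= `|c| * `|r * z| by rewrite mulr_ge0.
  rewrite {2}/Num.min; case: ifP => x1.
    by rewrite mulr1 ge_min lerDl c0.
  by rewrite mulrDl mul1r ge_min lerDr x0 orbT.
Qed.

Lemma modular_G_R c : 0 < rad -> (modular (Kmod nu) (fun x => (c * G_R G rad x)%R) < +oo)%E.
Proof.
move=> rad0.
(* The quadratic term is linearized by the bound [L1_norm] on [G_R], so the first two terms of
   [Kmod] are at most [M * g t]. *)
pose M := `|c| + c ^+ 2 * L1_norm.
have M0 : 0 <= M by rewrite addr_ge0// mulr_ge0 ?sqr_ge0// fine_ge0// iint_ge0// => t; rewrite lee_fin.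
have kap0' z : 0 <= kap nu z by rewrite -(kap0 nu); apply: (kap_mono triplet); rewrite normr0.
have mk' : measurable_fun setT (fun t => kap nu (g t)).
  exact: (measurableT_comp (measurable_kap triplet)).
apply: (@le_lt_trans _ _ (\int[mu]_t (M * g t)%:E + \int[mu]_t ((1 + `|c|) * kap nu (g t))%:E)%E).
  rewrite -ge0_integralD//; last 4 first.
  - by move=> t _; rewrite lee_fin mulr_ge0.
  - by apply/measurable_EFinP; exact: measurable_funM.
  - by move=> t _; rewrite lee_fin mulr_ge0// addr_ge0.
  - by apply/measurable_EFinP; exact: measurable_funM.
  apply: ge0_le_integral => //.
  - by move=> t _; rewrite lee_fin !addr_ge0 ?sqr_ge0.
  - apply/measurable_EFinP; apply: (measurableT_comp (measurable_Kmod triplet)).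
    exact: measurable_funM.
  - by apply: emeasurable_funD; apply/measurable_EFinP; exact: measurable_funM.
  - move=> t _; rewrite -EFinD lee_fin lerD ?kapZ// normrM (ger0_norm (g0 t)) mulrDl lerD2l.
    by rewrite exprMn -[leRHS]mulrA ler_wpM2l ?sqr_ge0// expr2 ler_wpM2r ?g0// G_R_le.
under eq_integral do rewrite EFinM.
rewrite ge0_integralZl_EFin//; last 2 first.
- by move=> t _; rewrite lee_fin.
- exact/measurable_EFinP.
under [X in (_ + X)%E]eq_integral do rewrite EFinM.
rewrite ge0_integralZl_EFin//; last 2 first.
- by move=> t _; rewrite lee_fin.
- exact/measurable_EFinP.
by rewrite lte_add_pinfty// lte_mul_pinfty// ?lee_fin ?addr_ge0// ?integral_G_R ?integral_kap_G_R.
Qed.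

End Modular.

End LocalAverage.

(** * Test functions *)

Section TestFunctions.
Context {R : realType} {d : nat}.
Local Notation mu := (@leb_tuple R d).
Local Notation rv := (@rv_of_tuple R d).
Implicit Types (f g phi psi : 'rV[R]_d -> R).

(** An open set is the union of the half-open grid cells of mesh [n.+1%:R^-1] that it contains; the
    cells are indexed by the countable set of pairs in [nat * 'rV[int]_d], enumerated by
    [pickle]. *)
Lemma borel_open (O : set 'rV[R]_d) : open O -> borel_set O.
Proof.
move=> oO.
pose C (p : nat * 'rV[int]_d) := [set x : 'rV[R]_d |
  forall i, (p.2 0 i)%:~R <= x 0 i * p.1.+1%:R < (p.2 0 i + 1)%:~R].
have mC p : borel_set (C p).
  rewrite (_ : C p = \bigcap_(i in [set: 'I_d]) ((fun x : 'rV[R]_d => x 0 i * p.1.+1%:R)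
    @^-1` [set` Interval (BLeft (p.2 0 i)%:~R) (BLeft (p.2 0 i + 1)%:~R)])).
    rewrite /borel_set preimage_bigcap; apply: fin_bigcap_measurable; first exact: finite_finset.
    move=> i _; apply: (@borel_preimage _ _ (fun x : 'rV[R]_d => x 0 i * p.1.+1%:R)) => //.
    by apply: measurable_funM => //; exact: measurable_coord.
  apply/seteqP; split=> x /=; first by move=> h i _; rewrite /= in_itv/=.
  by move=> h i; have := h i I; rewrite /= in_itv.
pose F n := if unpickle n is Some p then (if `[<C p `<=` O>] then C p else set0) else set0.
rewrite (_ : O = \bigcup_n F n).
  apply: borel_bigcup => n; rewrite /F; case: (unpickle n) => [p|]; last exact: borel_set0.
  by case: asboolP => _ //; exact: borel_set0.
apply/seteqP; split=> x; last first.
  move=> [n _]; rewrite /F; case: (unpickle n) => [p|]//.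
  by case: asboolP => // sO /sO.
move=> Ox; have /nbhs_ballP[e /= e0 xe] : nbhs x O by exact: open_nbhs_nbhs.
have [n ne] : exists n : nat, n.+1%:R^-1 < e.
  have [n _ /(_ n (leqnn n))] := near_infty_natSinv_lt (PosNum e0).
  by exists n.
pose p : nat * 'rV[int]_d := (n, \row_i Num.floor (x 0 i * n.+1%:R)).
have Cx : C p x by move=> i; rewrite /= !mxE floor_itv.
exists (pickle p) => //; rewrite /F pickleK; case: asboolP => // nO; exfalso; apply: nO.
move=> y Cy; apply: xe; rewrite -ball_normE/=.
apply: le_lt_trans ne; apply/rv_norm_le => // i.
have := Cx i; have := Cy i; rewrite /= !mxE.
set k := Num.floor _; rewrite intrD.
have n0 : 0 < n.+1%:R :> R by [].
move=> /andP[y1 y2] /andP[x1 x2].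
rewrite -(ler_pM2r n0) mulVf ?gt_eqF// -(gtr0_norm n0) -normrM mulrBl ler_norml.
by lra.
Qed.

Lemma continuous_borel phi : continuous phi -> borel_fun phi.
Proof.
move=> cp; apply: (measurability _ (RGenOInfty.measurableE R)) => //.
move=> _ [_ [a ->] <-]; rewrite setTI comp_preimage; apply: borel_open.
move/continuousP: cp; apply.
by have -> : `]a, +oo[%classic = [set x : R | a < x] by apply/seteqP; split => x /=; rewrite in_itv/= andbT.
Qed.

Lemma compact_in_cube (K : set 'rV[R]_d) : compact K -> exists2 M, 0 < M & K `<=` cube M.
Proof.
move=> /compact_bounded[M [Mr hM]]; exists (Num.max 1 (M + 1)); first by rewrite lt_max ltr01.
by move=> x Kx; apply: (hM _ _ x Kx); rewrite lt_max ltrDl ltr01 orbT.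
Qed.

Lemma test_fn_borel phi : test_fn phi -> borel_fun phi.
Proof. by move=> [sm _]; apply: continuous_borel; have [] := sm [::]. Qed.

Lemma test_fn_bounded phi : test_fn phi -> exists2 C, 0 < C & forall x, `|phi x| <= C.
Proof.
move=> [sm [K [cK K0]]].
have cp : continuous phi by have [] := sm [::].
have /compact_bounded[M [Mr hM]] : compact [set phi x | x in K].
  by apply: continuous_compact => //; exact: continuous_subspaceT.
exists (Num.max 1 (M + 1)); first by rewrite lt_max ltr01.
move=> x; have [Kx|nKx] := pselect (K x).
  apply: (hM (Num.max 1 (M + 1))); last by exists x.
  by rewrite lt_max ltrDl ltr01 orbT.
by rewrite K0// normr0 le_max ler01.
Qed.

Lemma Dpart_linear (l : seq 'I_d) phi psi (a b : R) : smooth phi -> smooth psi ->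
  Dpart l (fun x => a * phi x + b * psi x) = (fun x => a * Dpart l phi x + b * Dpart l psi x).
Proof.
move=> sp sq; elim: l => [//|i l ih] /=; rewrite ih; apply/funext => x.
have [_ dp] := sp l; have [_ dq] := sq l.
have := deriveD (derivableZ (k := a) (dp i x)) (derivableZ (k := b) (dq i x)).
by rewrite !deriveZ.
Qed.

Lemma test_fn_linear phi psi (a b : R) : test_fn phi -> test_fn psi ->
  test_fn (fun x => a * phi x + b * psi x).
Proof.
move=> [sp [K1 [c1 z1]]] [sq [K2 [c2 z2]]]; split.
  move=> l; rewrite Dpart_linear//; have [cp dp] := sp l; have [cq dq] := sq l; split.
    have ca c (h : 'rV[R]_d -> R) : continuous h -> continuous (fun y => c * h y).
      by move=> ch x; apply: (@continuousM _ _ (cst c) h); [exact: cst_continuous|exact: ch].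
    by move=> x; exact: (continuousD (ca a _ cp x) (ca b _ cq x)).
  by move=> i x; exact: (derivableD (derivableZ (k := a) (dp i x)) (derivableZ (k := b) (dq i x))).
exists (K1 `|` K2); split; first exact: compactU.
move=> x nK; rewrite z1 ?z2 ?mulr0 ?addr0// => h; apply: nK; [by right|by left].
Qed.

(** The quotients agree as functions of [h], so the derivative and its existence transfer
    together. *)
Lemma diffquot_translate phi (t x v : 'rV[R]_d) :
  (fun h : R => h^-1 *: ((translate phi t \o shift x) (h *: v) - translate phi t x)) =
  (fun h : R => h^-1 *: ((phi \o shift (x - t)) (h *: v) - phi (x - t))).
Proof. by apply/funext => h; rewrite /translate/= addrA. Qed.

Lemma Dpart_translate (l : seq 'I_d) phi (t : 'rV[R]_d) :
  Dpart l (translate phi t) = translate (Dpart l phi) t.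
Proof.
elim: l => [//|i l ih] /=; rewrite ih; apply/funext => x.
exact: (congr1 (fun F : R -> R => lim (F h @[h --> 0^'])) (diffquot_translate _ t x 'e_i)).
Qed.

Lemma test_fn_translate phi (t : 'rV[R]_d) : test_fn phi -> test_fn (translate phi t).
Proof.
have ct (s : 'rV[R]_d) : continuous (fun x : 'rV[R]_d => x - s).
  by move=> x; apply: (@continuousB _ _ _ id (cst s)); [exact: cvg_id|exact: cst_continuous].
move=> [sp [K [cK z]]]; split.
  move=> l; rewrite Dpart_translate; have [cp dp] := sp l; split.
    by move=> x; apply: (continuous_comp (ct t x)); exact: cp.
  by move=> i x; rewrite /derivable diffquot_translate; exact: dp.
exists [set x - (- t) | x in K]; split.
  by apply: continuous_compact => //; apply: continuous_subspaceT; exact: ct.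
by move=> x nK; apply: z => Kx; apply: nK; exists (x - t) => //; rewrite opprK subrK.
Qed.

End TestFunctions.

(** * Convolution of an integrable kernel with test functions *)

Section ConvolL1.
Context {R : realType} {d : nat}.
Local Notation mu := (@leb_tuple R d).
Local Notation rv := (@rv_of_tuple R d).
Variable G : 'rV[R]_d -> R.
Hypothesis L1G : L1 G.
Implicit Types (phi psi : 'rV[R]_d -> R).

Let mG : borel_fun G. Proof. by case: L1G. Qed.

Lemma convol_integrable phi (C : R) x : borel_fun phi -> (forall y, `|phi y| <= C) ->
  mu.-integrable setT (EFin \o (fun t => G (rv t) * phi (x - rv t))).
Proof.
move=> mphi pC.
have iG : mu.-integrable setT (EFin \o (fun t => C * G (rv t))).
  apply/integrableP; split; first by apply/measurable_EFinP; exact: measurable_funM.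
  under eq_integral do rewrite /= normrM EFinM.
  rewrite ge0_integralZl_EFin//.
    by rewrite L1_normE// -EFinM ltry.
  by apply/measurable_EFinP; exact: (measurableT_comp (normr_measurable (D := setT)) mG).
apply: (le_integrable _ _ _ iG) => //.
  by apply/measurable_EFinP; apply: measurable_funM => //; exact: borel_fun_subl.
move=> t _; rewrite lee_fin !normrM mulrC ler_wpM2r//.
by rewrite (le_trans (pC _))// ler_norm.
Qed.

Lemma convol_linear phi psi (C a b : R) x : borel_fun phi -> borel_fun psi ->
  (forall y, `|phi y| <= C) -> (forall y, `|psi y| <= C) ->
  convol G (fun y => a * phi y + b * psi y) x = a * convol G phi x + b * convol G psi x.
Proof.
move=> m1 m2 b1 b2.
have i1 := convol_integrable x m1 b1; have i2 := convol_integrable x m2 b2.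
have n1 : borel_fun (fun y => G y * phi (x - y)) by apply: measurable_funM => //; exact: borel_fun_subl.
have n2 : borel_fun (fun y => G y * psi (x - y)) by apply: measurable_funM => //; exact: borel_fun_subl.
rewrite /convol (leb_intR_integral n1) (leb_intR_integral n2).
have e : (fun y => G y * (a * phi (x - y) + b * psi (x - y))) =
    (fun y => a * (G y * phi (x - y)) + b * (G y * psi (x - y))).
  by apply/funext => y; ring.
rewrite e leb_intR_integral; last by apply: measurable_funD; exact: measurable_funM.
rewrite RintegralD//; last 2 first.
- exact: (integrableZl measurableT a i1).
- exact: (integrableZl measurableT b i2).
by rewrite !RintegralZl.
Qed.

Lemma convol_translate phi t x : convol G (translate phi t) x = convol G phi (x - t).
Proof.
rewrite /convol; congr leb_intR; apply/funext => y.
by rewrite /translate addrAC.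
Qed.

(** The Euclidean norm of a corner of the cube, plus 1 to make the ball open around the closed cube
    and the radius positive. *)
Definition cube_radius (M : R) : R := Num.sqrt (M ^+ 2 *+ d) + 1.

Lemma cube_radius_gt0 M : 0 < cube_radius M.
Proof. by rewrite ltr_wpDl// sqrtr_ge0. Qed.

Lemma cube_sub_eball M : 0 <= M -> cube M `<=` eball (0 : 'rV[R]_d) (cube_radius M).
Proof.
move=> M0 x /(rv_norm_le _ M0) xM; rewrite /eball/=.
apply: (@le_lt_trans _ _ (Num.sqrt (M ^+ 2 *+ d))); last by rewrite ltrDl.
apply: ler_wsqrtr; rewrite -[X in _ *+ X](card_ord d) -sumr_const.
apply: ler_sum => i _; rewrite mxE subr0 -(real_normK (num_real _)).
by rewrite lerXn2r ?nnegrE.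
Qed.

Lemma convol_le phi (C M : R) x : borel_fun phi -> 0 <= C -> 0 <= M ->
  (forall y, `|phi y| <= C) -> (forall y, ~ cube M y -> phi y = 0) ->
  `|convol G phi x| <= C * G_R G (cube_radius M) x.
Proof.
move=> mphi C0 M0 bC z.
have n1 : borel_fun (fun y => G y * phi (x - y)) by apply: measurable_funM => //; exact: borel_fun_subl.
have mk : borel_fun (\1_(eball 0 (cube_radius M)) : 'rV[R]_d -> R).
  by apply: borel_indic; exact: borel_eball.
have mb : measurable_fun setT (fun t => `|G (rv t)| * \1_(eball 0 (cube_radius M)) (x - rv t)).
  apply: measurable_funM; last exact: borel_fun_subl.
  exact: (measurableT_comp (normr_measurable (D := setT)) mG).
rewrite /convol leb_intR_integral// -lee_fin EFinM (G_R_integral _ L1G).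
rewrite (EFin_normr_Rintegral measurableT (convol_integrable x mphi bC)).
rewrite -ge0_integralZl_EFin//; last exact/measurable_EFinP.
apply: (le_trans (le_abse_integral _ _ _)) => //; first exact/measurable_EFinP.
apply: ge0_le_integral => //.
- by apply: measurableT_comp => //; exact/measurable_EFinP.
- by apply: measurable_funeM; exact/measurable_EFinP.
- move=> t _; rewrite /= -EFinM lee_fin normrM mulrCA ler_wpM2l//.
  have [h|h] := pselect (cube M (x - rv t)).
    by rewrite indicE mem_set ?mulr1//; exact: cube_sub_eball.
  by rewrite z// normr0 mulr_ge0.
Qed.

Lemma test_fn_convol_le phi : test_fn phi ->
  exists C M : R, [/\ 0 < C, 0 < M & forall x, `|convol G phi x| <= C * G_R G (cube_radius M) x].
Proof.
move=> tphi; have [C C0 bC] := test_fn_bounded tphi.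
have [_ [K [cK z]]] := tphi; have [M M0 KM] := compact_in_cube cK.
exists C, M; split=> // x; apply: convol_le => //; first exact: test_fn_borel.
- exact: ltW.
- exact: ltW.
- by move=> y nM; apply: z => Ky; apply: nM; exact: KM.
Qed.

Lemma test_fn_convol_linear phi psi (a b : R) x : test_fn phi -> test_fn psi ->
  convol G (fun y => a * phi y + b * psi y) x = a * convol G phi x + b * convol G psi x.
Proof.
move=> t1 t2; have [C1 _ b1] := test_fn_bounded t1; have [C2 _ b2] := test_fn_bounded t2.
apply: (@convol_linear _ _ (Num.max C1 C2)); [exact: test_fn_borel|exact: test_fn_borel| |].
  by move=> y; rewrite le_max b1.
by move=> y; rewrite le_max b2 orbT.
Qed.

Section Modular.
Variables (a : R) (nu : {measure set R -> \bar R}).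
Hypothesis triplet : levy_triplet a nu.
Hypothesis h_fin : forall rad : R, 0 < rad ->
  (\int[nu]_(r in [set r : R | (1 < `|r|)%R]) h_R G rad `|r| < +oo)%E.

Lemma mod_integrable_convol phi : test_fn phi -> mod_integrable (Kmod nu) (convol G phi).
Proof.
move=> tphi; have mc := borel_convol mG (test_fn_borel tphi); split => // c.
have [C [M [C0 M0 le]]] := test_fn_convol_le tphi.
have r0 := cube_radius_gt0 M.
apply: le_lt_trans (modular_G_R L1G triplet (h_fin r0) (c * C) r0).
apply: (le_modular (Kmod_0 _) (Kmod_mono triplet) (measurable_Kmod triplet)).
- exact: measurable_funM.
- by apply: measurable_funM => //; exact: borel_G_R.
- move=> x; rewrite -mulrA !normrM ler_wpM2l// (gtr0_norm C0).
  by rewrite (ger0_norm (G_R_ge0 _ L1G _)).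
Qed.

End Modular.

End ConvolL1.

(** * Stationarity *)

Section LinearCombinations.
Context {R : realType} {d : nat} {dO : measure_display} {Omega : measurableType dO}.
Variables (P : probability Omega R) (L : set 'rV[R]_d -> Omega -> R).
Variables (I : eqType) (u : I -> R).
Implicit Types (fs : I -> seq (R * set 'rV[R]_d)) (r : seq I).

(** Encodes a linear combination of simple functions as one list, so that joint transforms reduce to
    the transform of a single integral. *)
Definition lcomb r fs : seq (R * set 'rV[R]_d) := flatten [seq lscale (u i) (fs i) | i <- r].

Lemma Lint_lcomb r fs w : Lint L (lcomb r fs) w = \sum_(i <- r) u i * Lint L (fs i) w.
Proof.
elim: r => [|i r ih]; first by rewrite /Lint !big_nil.
by rewrite /lcomb /= Lint_cat Lint_scale big_cons -ih.
Qed.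

Lemma ltr_lcomb t r fs : ltr t (lcomb r fs) = lcomb r (fun i => ltr t (fs i)).
Proof.
elim: r => [//|i r ih]; rewrite /lcomb /= -[in RHS]/(lcomb r _) -ih /ltr map_cat; congr cat.
by rewrite /lscale -!map_comp.
Qed.

Lemma allb_lcomb r fs : (forall i, allb (fs i)) -> allb (lcomb r fs).
Proof.
move=> b; elim: r => [|i r ih]; first by move=> k.
by apply/allb_cat; split; [exact: allb_scale|exact: ih].
Qed.

Lemma measurable_lcomb r (X : I -> Omega -> R) : (forall i, measurable_fun setT (X i)) ->
  measurable_fun setT (fun w => \sum_(i <- r) u i * X i w).
Proof.
move=> mX; elim: r => [|i r ih].
  by under eq_fun do rewrite big_nil; exact: measurable_cst.
under eq_fun do rewrite big_cons.
by apply: measurable_funD => //; exact: measurable_funM.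
Qed.

Lemma qcvg_lcomb r (Xn : I -> nat -> Omega -> R) (X : I -> Omega -> R) :
  (forall i n, measurable_fun setT (Xn i n)) -> (forall i, measurable_fun setT (X i)) ->
  (forall i, qcvg P (Xn i) (X i)) ->
  qcvg P (fun n w => \sum_(i <- r) u i * Xn i n w) (fun w => \sum_(i <- r) u i * X i w).
Proof.
move=> mXn mX cX; elim: r => [|i r ih].
  rewrite /qcvg; under eq_fun => n do under eq_fun do rewrite !big_nil subrr.
  have -> : qnorm P (fun=> 0) = 0 by rewrite /qnorm normr0 minElt ltr10 Ex_cst.
  exact: cvg_cst.
have h := qcvgD (fun n => measurable_funM (measurable_cst (u i)) (mXn i n))
  (fun n => measurable_lcomb r (mXn^~ n)) (measurable_funM (measurable_cst (u i)) (mX i))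
  (measurable_lcomb r mX) (qcvgZ (u i) (mXn i) (mX i) (cX i)) ih.
rewrite (_ : (fun n w => _) = (fun n w => u i * Xn i n w + \sum_(j <- r) u j * Xn j n w)).
  by rewrite (_ : (fun w => \sum_(j <- i :: r) _) = (fun w => u i * X i w + \sum_(j <- r) u j * X j w))//;
    apply/funext => w; rewrite big_cons.
by apply/funext => n; apply/funext => w; rewrite big_cons.
Qed.

End LinearCombinations.

Section Integrals.
Context {R : realType} {d : nat} {dO : measure_display} {Omega : measurableType dO}.
Variables (P : probability Omega R) (L : set 'rV[R]_d -> Omega -> R).
Variable (K : R -> R).
Local Notation mu := (@leb_tuple R d).
Local Notation rv := (@rv_of_tuple R d).

Hypothesis mL : forall A, bdd_borel A -> measurable_fun [set: Omega] (L A).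
Hypothesis K_0 : K 0 = 0.
Hypothesis K_mono : forall x y, `|x| <= `|y| -> K x <= K y.
Hypothesis mK : measurable_fun [set: R] K.
Hypothesis K_cvg0 : forall u : nat -> R, u n @[n --> \oo] --> (0 : R) ->
  K (u n) @[n --> \oo] --> (0 : R).
Hypothesis q_small : forall e : R, 0 < e -> exists U dl : R, [/\ 0 < U, 0 < dl &
  forall s, allb s ->
    (modular K (fun x : 'rV[R]_d => (U * simple_eval s x)%R) <= dl%:E)%E ->
    qnorm P (Lint L s) <= e].

(** The translated approximations of [f] differ from the canonical ones of [g], since the cutting
    cube moves too. Both lie below [|g|] and converge to [g], so the modular of their difference
    tends to 0. *)
Lemma qcvg_translate f g X (t : 'rV[R]_d) : mod_integrable K f -> mod_integrable K g ->
  (forall x, g x = f (x - t)) -> RR_integral P L g X ->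
  qcvg P (fun k => Lint L (ltr t (simple_approx f k))) X.
Proof.
move=> [mf _] hg gf gX; have [mg fing] := hg.
have mX : measurable_fun setT X by case: gX => _ [].
have gc := RR_integral_approx mL K_0 K_mono mK K_cvg0 q_small hg gX.
have bf k : allb (ltr t (simple_approx f k)).
  by apply: allb_tr; have [] := simple_approx_ok mf k.
have bg k : allb (simple_approx g k) by have [] := simple_approx_ok mg k.
pose h k := ltr t (simple_approx f k) ++ lscale (-1) (simple_approx g k).
have bh k : allb (h k) by apply/allb_cat; split => //; exact: allb_scale.
have hE k x : simple_eval (h k) x =
    simple_eval (simple_approx f k) (x - t) - simple_eval (simple_approx g k) x.
  by rewrite simple_eval_cat simple_eval_tr simple_eval_scale mulN1r.
have h0 : qnorm P (Lint L (h k)) @[k --> \oo] --> (0 : R).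
  apply/cvgr0Pnorm_le => e e0; have [U [dl [U0 dl0 hq]]] := q_small e0.
  have mb : borel_fun (fun x => 2 * U * g x) by exact: measurable_funM.
  have mh k : borel_fun (fun x => U * simple_eval (h k) x).
    by apply: measurable_funM => //; exact: borel_simple_eval.
  have hb k x : `|U * simple_eval (h k) x| <= `|2 * U * g x|.
    rewrite hE !normrM (gtr0_norm U0) normr_nat.
    have h1 := ler_normB (simple_eval (simple_approx f k) (x - t)) (simple_eval (simple_approx g k) x).
    have h2 := simple_approx_le f k (x - t); have h3 := simple_approx_le g k x.
    rewrite -gf in h2; rewrite -mulrA mulrCA ler_wpM2l ?(ltW U0)//; lra.
  have hz : {ae mu, forall t, U * simple_eval (h k) (rv t) @[k --> \oo] --> (0 : R)}.
    apply: aeW => z; rewrite -[X in _ --> X](mulr0 U); apply: cvgMr.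
    under eq_fun do rewrite hE.
    rewrite -(subrr (g (rv z))); apply: cvgB; last exact: simple_approx_cvg.
    by rewrite gf; exact: simple_approx_cvg.
  have := modular_cvg0 K_0 K_mono mK K_cvg0 mh mb hb (fing _) hz.
  move=> /fine_cvgP[hfin /cvgr0Pnorm_le/(_ _ dl0) hs].
  apply: filterS2 hfin hs => k kfin ks; rewrite ger0_norm ?qnorm_ge0//; apply: hq => //.
  by rewrite -(fineK kfin) lee_fin (le_trans _ ks)// ler_norm.
apply: (@squeeze_cvgr _ _ _ _ (cst 0) (fun k => qnorm P (Lint L (h k)) +
  qnorm P (fun w => Lint L (simple_approx g k) w - X w))).
- apply: nearW => k; rewrite qnorm_ge0/=.
  rewrite (_ : (fun w => _) = (fun w => Lint L (h k) w + (Lint L (simple_approx g k) w - X w))).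
    apply: qnormD; first exact: measurable_Lint.
    by apply: measurable_funB => //; exact: measurable_Lint.
  by apply/funext => w; rewrite Lint_cat Lint_scale mulN1r addrA subrK.
- exact: cvg_cst.
- by rewrite -[X in _ --> X]addr0; exact: cvgD.
Qed.

End Integrals.

(** * The generalized process and its stationarity *)

Section Main.
Context {R : realType} {d : nat} {dO : measure_display} {Omega : measurableType dO}.
Variables (P : probability Omega R) (a gamma : R) (nu : {measure set R -> \bar R}).
Variables (Ld : ('rV[R]_d -> R) -> Omega -> R) (L : set 'rV[R]_d -> Omega -> R).
Variable (G : 'rV[R]_d -> R).
Hypothesis triplet : levy_triplet a nu.
Hypothesis basis : levy_basis_of P a gamma nu Ld L.
Hypothesis L1G : L1 G.
Hypothesis h_fin : forall rad : R, 0 < rad ->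
  (\int[nu]_(r in [set r : R | (1 < `|r|)%R]) h_R G rad `|r| < +oo)%E.

Let mL A : bdd_borel A -> measurable_fun [set: Omega] (L A).
Proof. by case: basis => h _; exact: h. Qed.

Let K := Kmod nu.
Let K_0 : K 0 = 0 := Kmod_0 nu.
Let K_mono := Kmod_mono triplet.
Let mK := measurable_Kmod triplet.
Let K_cvg0 := Kmod_cvg0 triplet.

Let q_small (e : R) : 0 < e -> exists U dl : R, [/\ 0 < U, 0 < dl &
  forall s, allb s ->
    (modular K (fun x : 'rV[R]_d => (U * simple_eval s x)%R) <= dl%:E)%E ->
    qnorm P (Lint L s) <= e].
Proof.
have [_ [ind [add [cf _]]]] := basis.
exact: (qnorm_small_of_modular mL ind add cf (Kconst_gt0 gamma triplet) K_0 K_mono mK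
  (psiRe_le0 triplet) (psiRe_le gamma triplet) (psiIm_le gamma triplet)).
Qed.

Let conv_mod phi := @mod_integrable_convol R d G L1G a nu triplet h_fin phi.

Lemma convol_RR_integrable phi : test_fn phi -> RR_integrable P L (convol G phi).
Proof.
by move=> tphi; exact: (mod_integrable_RR mL K_0 K_mono mK K_cvg0 q_small (conv_mod tphi)).
Qed.

Variable s : ('rV[R]_d -> R) -> Omega -> R.
Hypothesis s_int : forall phi, test_fn phi -> RR_integral P L (convol G phi) (s phi).

Let ms phi : test_fn phi -> measurable_fun [set: Omega] (s phi).
Proof. by move=> /s_int[_ []]. Qed.

Lemma convol_gen_process : gen_process P s.
Proof.
have lin phi psi (b c : R) : test_fn phi -> test_fn psi ->
    {ae P, forall w, s (fun x => b * phi x + c * psi x) w = b * s phi w + c * s psi w}.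
  move=> t1 t2; apply: (RR_integral_linear mL K_0 K_mono mK K_cvg0 q_small _
    (s_int (test_fn_linear b c t1 t2)) (s_int t1) (s_int t2)).
  by move=> x; exact: test_fn_convol_linear.
split; first exact: ms.
split=> // phin phi tn tphi [[C [cC z]] cv].
apply/cvg_prob_qnorm; [by move=> n; exact: ms|exact: ms|].
have [M M0 CM] := compact_in_cube cC.
have r0 := cube_radius_gt0 (d := d) M.
pose chi n x := 1 * phin n x + -1 * phi x.
have tchi n : test_fn (chi n) by exact: test_fn_linear.
apply/cvgr0Pnorm_le => e e0.
have [U [dl [U0 dl0 hq]]] := qnorm_integral_small mL K_0 K_mono mK K_cvg0 q_small e0.
(* First [k] is fixed so that the modular of [g k] is at most [dl]; then [n] is taken so large that
   [|chi n| <= k.+1%:R^-1], which puts [U] times the convolution below [g k]. *)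
pose g k x := U * k.+1%:R^-1 * G_R G (cube_radius (d := d) M) x.
have mg k : borel_fun (g k) by apply: measurable_funM => //; exact: borel_G_R.
have gz : {ae (@leb_tuple R d), forall t, g k (rv_of_tuple t) @[k --> \oo] --> (0 : R)}.
  apply: aeW => t; rewrite -(mul0r (G_R G (cube_radius (d := d) M) (rv_of_tuple t))).
  apply: cvgMl; rewrite -[X in _ --> X](mulr0 U); apply: cvgMr.
  exact: cvg_harmonic.
have gb k x : `|g k x| <= `|U * G_R G (cube_radius (d := d) M) x|.
  rewrite /g -mulrA mulrCA normrM ler_piMl// normfV normr_nat invf_le1//.
  by rewrite ler1n.
have mb : borel_fun (fun x => U * G_R G (cube_radius (d := d) M) x).
  by apply: measurable_funM => //; exact: borel_G_R.
have := modular_cvg0 K_0 K_mono mK K_cvg0 mg mb gb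
  (modular_G_R L1G triplet (h_fin r0) U r0) gz.
move=> /fine_cvgP[[N1 _ hfin] /cvgr0Pnorm_le/(_ _ dl0)[N2 _ hs]].
pose k := maxn N1 N2.
have kfin := hfin k (leq_maxl _ _); have ks := hs k (leq_maxr _ _).
have k0 : 0 < k.+1%:R^-1 :> R by rewrite invr_gt0.
(* The empty list of derivatives is uniform convergence of the functions themselves. *)
apply: filterS (cv [::] _ k0) => n hn.
rewrite ger0_norm ?qnorm_ge0//.
have <- : qnorm P (s (chi n)) = qnorm P (fun w => s (phin n) w - s phi w).
  apply: qnorm_ae; [exact: ms|by apply: measurable_funB; exact: ms|].
  by apply: filterS (lin _ _ 1 (-1) (tn n) tphi) => w ->; rewrite mul1r mulN1r.
apply: (hq (convol G (chi n))); [exact: conv_mod|exact: s_int|].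
apply: (@le_trans _ _ (modular K (g k))); last first.
  by rewrite -(fineK kfin) lee_fin (le_trans _ ks)// ler_norm.
apply: (le_modular K_0 K_mono mK) => //.
  by apply: measurable_funM => //; case: (conv_mod (tchi n)).
move=> x; rewrite /g -mulrA !normrM ler_wpM2l//.
rewrite (ger0_norm (G_R_ge0 _ L1G _)) (gtr0_norm k0).
apply: (convol_le L1G x (test_fn_borel (tchi n)) (ltW k0) (ltW M0)).
  by move=> y; have := hn y; rewrite /= /chi mul1r mulN1r.
move=> y nM; have [h1 h2] := z y (fun Cy => nM (CM y Cy)).
by rewrite /chi h1 h2 !mulr0 addr0.
Qed.

Lemma convol_stationary : stationary P s.
Proof.
have [_ [ind [add [cf _]]]] := basis.
move=> t n phi B tphi mB.
have ttphi i := test_fn_translate t (tphi i).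
pose fs k i := simple_approx (convol G (phi i)) k.
have bfs k i : allb (fs k i).
  by have [] := simple_approx_ok (borel_convol L1G.1 (test_fn_borel (tphi i))) k.
have cX i : qcvg P (fun k => Lint L (ltr t (fs k i))) (s (translate (phi i) t)).
  apply: (qcvg_translate mL K_0 K_mono mK K_cvg0 q_small (conv_mod (tphi i))
    (conv_mod (ttphi i)) _ (s_int (ttphi i))).
  by move=> x; rewrite convol_translate.
have cY i : qcvg P (fun k => Lint L (fs k i)) (s (phi i)).
  exact: (RR_integral_approx mL K_0 K_mono mK K_cvg0 q_small (conv_mod (tphi i)) (s_int (tphi i))).
have mX i : measurable_fun setT (s (translate (phi i) t)) by exact: ms.
have mY i : measurable_fun setT (s (phi i)) by exact: ms.
have mLX i k : measurable_fun setT (Lint L (ltr t (fs k i))).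
  by apply: measurable_Lint => //; exact: allb_tr.
have mLY i k : measurable_fun setT (Lint L (fs k i)) by exact: measurable_Lint.
(* At each stage [k] both linear combinations are integrals of single lists, one the translate of
   the other, with equal transforms by [Ex_Lint_tr]; the equality passes to the limit in
   probability. *)
have key (u : 'I_n -> R) :
    Ex P (fun w => cos (\sum_(i < n) u i * s (translate (phi i) t) w)) =
    Ex P (fun w => cos (\sum_(i < n) u i * s (phi i) w)) /\
    Ex P (fun w => sin (\sum_(i < n) u i * s (translate (phi i) t) w)) =
    Ex P (fun w => sin (\sum_(i < n) u i * s (phi i) w)).
  have [cX1 sX1] := cvg_Ex_cos (fun k => measurable_lcomb u (index_enum 'I_n) (mLX^~ k))
    (measurable_lcomb u (index_enum 'I_n) mX) (qcvg_lcomb u (index_enum 'I_n) mLX mX cX).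
  have [cY1 sY1] := cvg_Ex_cos (fun k => measurable_lcomb u (index_enum 'I_n) (mLY^~ k))
    (measurable_lcomb u (index_enum 'I_n) mY) (qcvg_lcomb u (index_enum 'I_n) mLY mY cY).
  have e k := Ex_Lint_tr mL ind add cf t (allb_lcomb (u := u) (r := index_enum 'I_n) (bfs k)).
  have eX k : (fun w => \sum_(i < n) u i * Lint L (ltr t (fs k i)) w) =
      Lint L (ltr t (lcomb u (index_enum 'I_n) (fs k))).
    by apply/funext => w; rewrite ltr_lcomb Lint_lcomb.
  have eY k : (fun w => \sum_(i < n) u i * Lint L (fs k i) w) =
      Lint L (lcomb u (index_enum 'I_n) (fs k)).
    by apply/funext => w; rewrite Lint_lcomb.
  split; [apply: (eq_limits cX1 cY1)|apply: (eq_limits sX1 sY1)] => k.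
    have [h _] := e k; rewrite -(eX k) -(eY k) in h; exact: h.
  have [_ h] := e k; rewrite -(eX k) -(eY k) in h; exact: h.
exact: (joint_law_unique mX mY (fun u => (key u).1) (fun u => (key u).2) mB).
Qed.

End Main.

Theorem theorem3p4 (R : realType) (d : nat) (dO : measure_display)
  (Omega : measurableType dO) (P : probability Omega R)
  (a gamma : R) (nu : {measure set R -> \bar R})
  (Ld : ('rV[R]_d -> R) -> Omega -> R) (L : set 'rV[R]_d -> Omega -> R)
  (G : 'rV[R]_d -> R) :
  levy_triplet a nu ->
  levy_white_noise P a gamma nu Ld ->
  levy_basis_of P a gamma nu Ld L ->
  L1 G ->
  (forall rad : R, 0 < rad ->
     (\int[nu]_(r in [set r : R | (1 < `|r|)%R]) h_R G rad `|r| < +oo)%E) ->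
  (forall phi, test_fn phi -> RR_integrable P L (convol G phi)) /\
  (forall s : ('rV[R]_d -> R) -> Omega -> R,
     (forall phi, test_fn phi -> RR_integral P L (convol G phi) (s phi)) ->
     gen_process P s /\ stationary P s).
Proof.
move=> triplet _ basis L1G h_fin; split.
  by move=> phi; exact: (convol_RR_integrable triplet basis L1G h_fin).
move=> s s_int; split.
  exact: (convol_gen_process triplet basis L1G h_fin s_int).
exact: (convol_stationary triplet basis L1G h_fin s_int).
Qed.
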